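(* Let $N,d\in\mathbb N$. For $\epsilon>0$ let $\Phi_{N,d,\epsilon}\in(\mathcal M^{2d})'$ be the regularized symplectic Feynman distribution $$\Phi_{N,d,\epsilon}(A,B)=2^{dN}\pi^{dN^2}\exp\left(-\frac12\left(\binom{P_NA}{P_NB},K_\epsilon\binom{P_NA}{P_NB}\right)_{\mathcal T^{2d}}\right),\qquad A,B\in{\mathcal M'}^{d},$$ $$K_\epsilon=-\left((1-\epsilon)\,\mathrm{Id}_{{\mathcal M'}^{2d}}+i\begin{pmatrix}0&\mathrm{Id}_{{\mathcal M'}^{d}}\\ \mathrm{Id}_{{\mathcal M'}^{d}}&0\end{pmatrix}\right).$$ Then there exists a Hida distribution $\Phi_{N,d}\in(\mathcal M^{2d})'$ such that $$\lim_{\epsilon\to0}\Phi_{N,d,\epsilon}=\Phi_{N,d}$$ in the strong topology of $(\mathcal M^{2d})'$. The $T$-transform of $\Phi_{N,d}$ is given, for $(F,G)\in\mathcal M^{2d}$, by $$T\Phi_{N,d}(F,G)=2^{dN}\pi^{dN^2}\exp\left(-i\sum_{\mu=1}^dTr(P_NF_\mu\,P_NG_\mu)\right)\exp\left(-\frac12\left(\binom{P_N^cF}{P_N^cG},\binom{P_N^cF}{P_N^cG}\right)_{\mathcal T^{2d}}\right),$$ where $P_N^c=\mathrm{Id}_{{\mathcal M'}^d}-P_N$.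
   Context: Matrix spaces. $\mathcal T$ is the real Hilbert space of Hermitian Hilbert–Schmidt operators on an infinite-dimensional separable complex Hilbert space, represented via a fixed orthonormal basis as infinite Hermitian matrices $(a_{ij})_{i,j\in\mathbb N}$, with inner product $(A,B)=Tr(BA)$. $\mathcal M\subset\mathcal T$ is the subspace of matrices with only finitely many nonzero entries, with the nuclear topology given as the projective limit of the weighted Hilbert spaces $\mathcal T_p$ with norms $|F|_p^2=\sum_{i,j}p_{ij}|F_{ij}|^2$, over all symmetric weights $p=(p_{ij})$ with $p_{ij}\ge1$. Its dual $\mathcal M'$ is the space of all infinite Hermitian matrices, with pairing $\langle A,F\rangle=\sum_{i,j}A_{ij}F_{ji}$ extending $(\cdot,\cdot)$. For $m\in\mathbb N$, $\mathcal M^{m}\subset\mathcal T^{m}\subset{\mathcal M'}^{m}$ are the $m$-fold products, with pairing and inner product summed over components (extended bilinearly to complexifications); elements of ${\mathcal M'}^{2d}$ are written $\binom AB$ or $(A,B)$ with $A=(A_\mu)_{\mu=1}^d$, $B=(B_\mu)_{\mu=1}^d\in{\mathcal M'}^d$. $P_N:{\mathcal M'}^d\to\mathcal M^d$ is the projection which in each component keeps the entries with both indices $\le N$ and replaces all other entries by $0$; $P_NF_\mu$ denotes the $\mu$-th component of $P_NF$. $\mu_d$ is the standard Gaussian measure on ${\mathcal M'}^{2d}$, with characteristic function $\int\exp(i\langle A,F\rangle)\,d\mu_d(A)=\exp(-\frac12|F|^2)$, $F\in\mathcal M^{2d}$. Hida triple $(\mathcal M^{2d})\subset L^2(\mu_d)\subset(\mathcal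 M^{2d})'$. Wick monomials are defined by $\exp(\langle A,F\rangle-\frac12|F|^2)=\sum_{n\ge0}\frac1{n!}\langle:A^{\otimes n}:,F^{\otimes n}\rangle$, and each $f\in L^2(\mu_d)$ has a unique chaos decomposition $f=\sum_n\langle:A^{\otimes n}:,f^{(n)}\rangle$ with $f^{(n)}$ in the symmetric tensor power $(\mathcal T^{2d}_{\mathbb C})^{\hat\otimes n}$. The space of test functions $(\mathcal M^{2d})$ is the projective limit, over weights $p$ and $q\in\mathbb N$, of the Hilbert spaces given by the norms $\|\varphi\|_{p,q}^2=\sum_nn!\,2^{nq}|\varphi^{(n)}|_p^2$. Its topological dual $(\mathcal M^{2d})'$ is the space of Hida distributions, with bilinear dual pairing $\langle\!\langle\cdot,\cdot\rangle\!\rangle$ extending $\langle\!\langle f,\varphi\rangle\!\rangle=\int f\varphi\,d\mu_d$. The $T$-transform of $\Phi\in(\mathcal M^{2d})'$ is $T\Phi(F)=\langle\!\langle\Phi,\exp(i\langle\cdot,F\rangle)\rangle\!\rangle$, $F\in\mathcal M^{2d}$; it determines $\Phi$ uniquely. The functions $\Phi_{N,d,\epsilon}$ lie in $L^1(\mu_d)$ and are identified with the Hida distribution whose $T$-transform is $F\mapsto\int\exp(i\langle A,F\rangle)\Phi_{N,d,\epsilon}(A)\,d\mu_d(A)$. *)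

(* Defs.v *)
From HB Require Import structures.
From mathcomp Require Import all_boot all_order all_algebra.
From mathcomp Require Import complex.
From mathcomp Require Import all_classical all_reals all_analysis.

Set Implicit Arguments.
Unset Strict Implicit.
Unset Printing Implicit Defensive.

Import Order.TTheory GRing.Theory Num.Theory numFieldNormedType.Exports.

Local Open Scope classical_set_scope.
Local Open Scope complex_scope.
Local Open Scope ring_scope.

(* The topology, uniformity and norm of the complex numbers R[i] are those of
   R[i]^o in the libraries. *)

Local Notation normc := ComplexField.Normc.normc.

Section complex_analysis.
Variable R : realType.

Definition cexp (z : R[i]) : R[i] :=
  (expR (complex.Re z))%:C * (cos (complex.Im z) +i* sin (complex.Im z)).

Context d (T : measurableType d) (mu : {measure set T -> \bar R}).

Definition cintegral (f : T -> R[i]) : R[i] :=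
  (\int[mu]_x complex.Re (f x)) +i* (\int[mu]_x complex.Im (f x)).

Definition cintegrable (f : T -> R[i]) : Prop :=
  mu.-integrable setT (fun x => (complex.Re (f x))%:E) /\
  mu.-integrable setT (fun x => (complex.Im (f x))%:E).

Definition L2norm (f : T -> R[i]) : \bar R :=
  Lnorm mu 2%:E (fun x => (normc (f x))%:E).

Definition square_integrable (f : T -> R[i]) : Prop :=
  [/\ measurable_fun setT (fun x => complex.Re (f x)),
      measurable_fun setT (fun x => complex.Im (f x)) &
      (L2norm f < +oo)%E].

Definition cvg_L2 (u : nat -> T -> R[i]) (f : T -> R[i]) : Prop :=
  L2norm (fun x => u n x - f x) @[n --> \oo] --> (0 : \bar R)%E.

End complex_analysis.

(* m-tuples of infinite complex matrices: the complexification of M'^m.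
   Rows and columns are numbered from 0. *)
Notation cmatrices R m := ('I_m -> nat -> nat -> R[i]).

Section matrix_spaces.
Variables (R : realType) (m : nat).
Implicit Types (X Y F : cmatrices R m).

Definition is_hermitian X : Prop := forall k i j, X k j i = ((X k i j)^*)%C.

(* Position (k, i, j) stands for the entry (i, j) of the k-th matrix. *)
Definition position := ('I_m * nat * nat)%type.
Definition entry X (a : position) : R[i] := X a.1.1 a.1.2 a.2.
Definition transpose (a : position) : position := (a.1.1, a.2, a.1.2).

Record dualM := DualM {
  dualM_val :> cmatrices R m;
  dualM_hermitian : is_hermitian dualM_val }.

Definition spaceM : set (cmatrices R m) :=
  [set F | is_hermitian F /\ finite_set [set a | entry F a != 0]].

(* A sum over "\in" is 0 when its support is infinite.  Here the supports are
   finite: F has finitely many nonzero entries in [pairing X F], and so have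
   all the matrices in [mprod], [mtrace] and [inner]. *)
Definition pairing X F : R[i] :=
  \sum_(a \in [set: position]) entry X a * entry F (transpose a).

Definition mprod (x y : nat -> nat -> R[i]) : nat -> nat -> R[i] :=
  fun i j => \sum_(l \in [set: nat]) x i l * y l j.

Definition mtrace (x : nat -> nat -> R[i]) : R[i] :=
  \sum_(i \in [set: nat]) x i i.

(* (X, Y) = sum_k Tr(Y_k X_k), bilinear on the complexification. *)
Definition inner X Y : R[i] := \sum_(k < m) mtrace (mprod (Y k) (X k)).

Definition projN (N : nat) X : cmatrices R m :=
  fun k i j => if (i < N)%N && (j < N)%N then X k i j else 0.

Definition projNc (N : nat) X : cmatrices R m :=
  fun k i j => X k i j - projN N X k i j.

End matrix_spaces.

Section measurable_dual.
Variables (R : realType) (m : nat).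

HB.instance Definition _ := gen_eqMixin (dualM R m).
HB.instance Definition _ := gen_choiceMixin (dualM R m).

Lemma zero_hermitian : is_hermitian ((fun _ _ _ => 0) : cmatrices R m).
Proof. by move=> k i j; rewrite rmorph0. Qed.

HB.instance Definition _ := isPointed.Build (dualM R m) (DualM zero_hermitian).

(* The pairing of Hermitian matrices is real. *)
Definition cylinder_sets : set (set (dualM R m)) :=
  [set B | exists2 F : cmatrices R m, spaceM F &
    exists2 Y : set R, measurable Y &
      B = [set A : dualM R m | Y (complex.Re (pairing A F))]].

Definition dualM_measurable : set (set (dualM R m)) := <<s cylinder_sets >>.

Lemma dualM_measurable0 : dualM_measurable set0.
Proof. exact: sigma_algebra0. Qed.

Lemma dualM_measurableC B : dualM_measurable B -> dualM_measurable (~` B).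
Proof. exact: sigma_algebraC. Qed.

Lemma dualM_measurableU (B : (set (dualM R m))^nat) :
  (forall i, dualM_measurable (B i)) -> dualM_measurable (\bigcup_i B i).
Proof. exact: sigma_algebra_bigcup. Qed.

Definition dualM_display : measure_display.
Proof. by constructor. Qed.

HB.instance Definition _ := @isMeasurable.Build dualM_display (dualM R m)
  dualM_measurable dualM_measurable0 dualM_measurableC dualM_measurableU.

(* By Bochner-Minlos exactly one probability measure has this property. *)
Definition standard_gaussian (mu : probability (dualM R m) R) : Prop :=
  forall F : cmatrices R m, spaceM F ->
    cintegral mu (fun A => cexp ('i%C * pairing A F)) = cexp (- (inner F F / 2)).

End measurable_dual.

Section chaos.
Variables (R : realType) (m : nat).
Local Notation position := (position m).

(* Elements of the n-th tensor power of the space of m-tuples of infinite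
   complex matrices, and sequences of such elements, one for every degree. *)
Definition tensor n := n.-tuple position -> R[i].
Definition kernel_family := forall n, tensor n.

Definition symmetric_tensor n (k : tensor n) : Prop :=
  forall s t : n.-tuple position, perm_eq s t -> k s = k t.

Definition tensor_pairing n (w k : tensor n) : R[i] :=
  \sum_(t \in [set: n.-tuple position]) w t * k [tuple of map (@transpose m) t].

Definition tensor_power n (F : cmatrices R m) : tensor n :=
  fun t => \prod_(a <- t) entry F a.

(* The generating function determines the symmetric tensors :A^(x)n: : apply it
   to the multiples of F, then polarize. *)
Definition wick_powers (A : dualM R m) : set kernel_family :=
  [set W : kernel_family | (forall n, symmetric_tensor (W n)) /\
    forall F : cmatrices R m, spaceM F ->
      series (fun n => (n`!%:R)^-1 * tensor_pairing (W n) (tensor_power F)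
        : R[i]^o) @ \oo --> (cexp (pairing A F - inner F F / 2) : R[i]^o)].

Definition wick (A : dualM R m) : kernel_family :=
  xget (fun=> fun=> 0) (wick_powers A).
Arguments wick A n : clear implicits.

Definition truncate n (M : nat) (k : tensor n) : tensor n :=
  fun t => if all (fun a : position => (a.1.2 < M)%N && (a.2 < M)%N) t
           then k t else 0.

Definition weight (p : nat -> nat -> R) : Prop :=
  (forall i j, p i j = p j i) /\ (forall i j, 1 <= p i j).

Definition tensor_norm2 (p : nat -> nat -> R) n (k : tensor n) : \bar R :=
  \esum_(t in [set: n.-tuple position])
    ((\prod_(a <- t) p a.1.2 a.2) * normc (k t) ^+ 2)%:E.

Definition kernel_norm (p : nat -> nat -> R) (q : nat) (k : kernel_family) : \bar R :=
  ((\sum_(0 <= n <oo) (n`!%:R * 2 ^+ (n * q))%:E * tensor_norm2 p (k n))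
     `^ 2^-1)%E.

Variable mu : probability (dualM R m) R.

(* <:A^(x)n:, k> for k in the n-th symmetric tensor power of the complexified
   Hilbert space T^m, as the L^2-limit of its values at the truncations of k,
   which have finitely many nonzero coefficients. *)
Definition wick_integral n (k : tensor n) (g : dualM R m -> R[i]) : Prop :=
  square_integrable mu g /\
  cvg_L2 mu (fun M A => tensor_pairing (wick A n) (truncate M k)) g.

Definition chaos_decomposition (f : dualM R m -> R[i]) : set kernel_family :=
  [set k : kernel_family | [/\ square_integrable mu f,
    forall n, symmetric_tensor (k n) /\
              (tensor_norm2 (fun _ _ => 1%R) (k n) < +oo)%E &
    exists2 g : nat -> dualM R m -> R[i],
      forall n, wick_integral (k n) (g n) &
      cvg_L2 mu (fun n A => \sum_(l < n) g l A) f]].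

Definition chaos_kernel (f : dualM R m -> R[i]) : kernel_family :=
  xget (fun=> fun=> 0) (chaos_decomposition f).
Arguments chaos_kernel f n : clear implicits.

Definition hida_norm p q (f : dualM R m -> R[i]) : \bar R :=
  kernel_norm p q (chaos_kernel f).

Definition test_function : set (dualM R m -> R[i]) :=
  [set f | chaos_decomposition f !=set0 /\
    forall p q, weight p -> (hida_norm p q f < +oo)%E].

Definition bounded_test_functions (B : set (dualM R m -> R[i])) : Prop :=
  B `<=` test_function /\
  forall p q, weight p ->
    exists c : R, forall f, B f -> (hida_norm p q f <= c%:E)%E.

(* A Hida distribution is a functional on square-integrable functions, of which
   only the values at test functions matter; continuity forces the values at
   almost everywhere equal test functions to coincide.  As any two of the norms
   are dominated by a third one, the balls of single norms form a basis of the
   projective limit topology.  The dual pairing of Phi and f is Phi f. *)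
Record hida_distribution := HidaDistribution {
  hida_val :> (dualM R m -> R[i]) -> R[i];
  hida_linear : forall (a : R[i]) f g, test_function f -> test_function g ->
    hida_val (fun A => a * f A + g A) = a * hida_val f + hida_val g;
  hida_continuous : forall f (e : R), test_function f -> 0 < e ->
    exists p q, exists2 delta : R, weight p /\ 0 < delta &
      forall g, test_function g ->
        (hida_norm p q (fun A => (g A - f A)%R) < delta%:E)%E ->
        normc (hida_val g - hida_val f) < e }.

(* Convergence in the strong topology, as eps tends to 0 from the right. *)
Definition strong_cvg_at0 (Phi_ : R -> hida_distribution)
    (Phi : hida_distribution) : Prop :=
  {family bounded_test_functions,
    (fun eps => (Phi_ eps : (dualM R m -> R[i]) -> R[i]^o)) @ 0^'+ -->
    (Phi : (dualM R m -> R[i]) -> R[i]^o)}.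

Definition T_transform (Phi : hida_distribution) (F : cmatrices R m) : R[i] :=
  Phi (fun A => cexp ('i%C * pairing A F)).

Definition represents_L1 (Phi : hida_distribution) (f : dualM R m -> R[i]) :
    Prop :=
  cintegrable mu f /\
  forall F : cmatrices R m, spaceM F ->
    T_transform Phi F = cintegral mu (fun A => cexp ('i%C * pairing A F) * f A).

End chaos.
Arguments wick {R m} A n.
Arguments chaos_kernel {R m} mu f n.

Section feynman.
Variables (R : realType) (N d : nat).

Definition vcat (A B : cmatrices R d) : cmatrices R (d + d) :=
  fun k => match fintype.split k with inl l => A l | inr l => B l end.

Definition upper (X : cmatrices R (d + d)) : cmatrices R d :=
  fun l => X (lshift d l).

Definition lower (X : cmatrices R (d + d)) : cmatrices R d :=
  fun l => X (rshift d l).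

Definition K_op (eps : R) (X : cmatrices R (d + d)) : cmatrices R (d + d) :=
  fun k i j =>
    - ((1 - eps)%:C * X k i j + 'i%C * vcat (lower X) (upper X) k i j).

Definition feynman_const : R[i] := (2 ^+ (d * N) * pi ^+ (d * N ^ 2))%:C.

Definition feynman_regularized (eps : R) (X : dualM R (d + d)) : R[i] :=
  let PX := vcat (projN N (upper X)) (projN N (lower X)) in
  feynman_const * cexp (- (inner PX (K_op eps PX) / 2)).

End feynman.

(* Main.v *)
(* In the orthonormal basis of Hermitian matrices the coordinates of A are
   independent standard normal variables, and a test function f has the
   S-transform Sf(xi) = E[f(A) exp(<A,xi> - (xi,xi)/2)], an entire function of
   finite complex matrices xi.  With a standard Gaussian B, every functional
   f |-> c E[Sf(x P_N B + i y J P_N B)], with x, y real and J the exchange of the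
   two halves, is a Hida distribution: |Sf(xi)| is at most a Hida norm of f times
   exp(r |xi|^2 / 2) with r as small as desired.  Its T-transform has the
   quadratic form (y^2 - x^2) Id - 2 i x y J on the range of P_N, so x, y and c can
   be chosen, continuously in eps >= 0, to give the T-transform of the regularized
   function; at eps = 0 it is the stated one.  As |c Sf(xi) - c' Sf(xi')| is at most
   the Hida norm of f times the square root of a function of (c, xi), (c', xi')
   that vanishes on the diagonal, dominated convergence in B gives convergence
   uniformly on bounded sets. *)

Require Import Defs.
From mathcomp Require Import all_boot all_order all_algebra.
From mathcomp Require Import complex.
From mathcomp Require Import all_classical all_reals all_analysis.
From mathcomp Require Import measurable_realfun.
From mathcomp Require Import fingroup perm.
From mathcomp Require Import zify ring lra.

Import Order.TTheory GRing.Theory Num.Theory numFieldNormedType.Exports.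
Import ComplexField.Normc.

Set Implicit Arguments.
Unset Strict Implicit.
Unset Printing Implicit Defensive.

Local Open Scope classical_set_scope.
Local Open Scope complex_scope.
Local Open Scope ring_scope.

Local Notation Re := complex.Re.
Local Notation Im := complex.Im.

(** * Complex numbers and the complex exponential *)

(** The regularized functions alone give no uniform control: the L1-norm of
    [feynman_regularized N eps] is a constant times eps^(- d N^2). So convergence is proved for the
    Gaussian means, whose parameters satisfy one bound for all eps, and the regularized functions
    enter only through their T-transforms, for one eps at a time. Computing these is the laborious
    part, because the measure is given by its characteristic function alone. Three devices take the
    place of densities and independent coordinates. Exponential moments are finite by Tonelli's
    theorem, applied to a mixture of Gaussian bumps. Complex coefficients are reached from real or
    imaginary ones by comparing power series in a real parameter, with Hermite polynomials as
    coefficients. Quadratic exponents become linear through exp(w^2 X^2 / 2) = E[exp(w X B)] with an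
    auxiliary normal variable B. Hermite polynomials return as the pairings of Wick powers with
    tensor powers, so one generating function serves both purposes. *)

Section complex_basics.
Variable R : realType.
Implicit Types (z w : R[i]).

Lemma ReD z w : Re (z + w) = Re z + Re w. Proof. by case: z w => ? ? [? ?]. Qed.
Lemma ImD z w : Im (z + w) = Im z + Im w. Proof. by case: z w => ? ? [? ?]. Qed.
Lemma ReB z w : Re (z - w) = Re z - Re w. Proof. by case: z w => ? ? [? ?]. Qed.
Lemma ImB z w : Im (z - w) = Im z - Im w. Proof. by case: z w => ? ? [? ?]. Qed.
Lemma ReM z w : Re (z * w) = Re z * Re w - Im z * Im w.
Proof. by case: z w => ? ? [? ?]. Qed.
Lemma ImM z w : Im (z * w) = Re z * Im w + Im z * Re w.
Proof. by case: z w => ? ? [? ?]. Qed.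
Lemma Re_sum (I : Type) (r : seq I) (P : pred I) (F : I -> R[i]) :
  Re (\sum_(i <- r | P i) F i) = \sum_(i <- r | P i) Re (F i).
Proof. by elim/big_rec2: _ => // i x y _ <-; rewrite ReD. Qed.
Lemma real_complex_sum (I : Type) (r : seq I) (P : pred I) (F : I -> R) :
  (\sum_(i <- r | P i) F i)%:C = \sum_(i <- r | P i) (F i)%:C.
Proof. exact: rmorph_sum. Qed.

Lemma Re_conj z : Re z^* = Re z. Proof. by case: z. Qed.
Lemma Im_conj z : Im z^* = - Im z. Proof. by case: z. Qed.

Lemma complex_eqP z w : Re z = Re w -> Im z = Im w -> z = w.
Proof. by case: z w => ? ? [? ?] /= -> ->. Qed.

Lemma normc_ge0 z : 0 <= normc z.
Proof. by case: z => a b; rewrite /normc sqrtr_ge0. Qed.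

Lemma normcE2 z : normc z ^+ 2 = Re z ^+ 2 + Im z ^+ 2.
Proof. by case: z => a b; rewrite /normc sqr_sqrtr// addr_ge0// sqr_ge0. Qed.

Lemma normr_normc z : `|z| = (normc z)%:C.
Proof. by []. Qed.

Lemma normc_real (x : R) : normc x%:C = `|x|.
Proof. by rewrite /normc /= expr0n addr0 sqrtr_sqr. Qed.

Lemma normcX z n : normc (z ^+ n) = normc z ^+ n.
Proof.
elim: n => [|n IH]; first by rewrite !expr0 normc1.
by rewrite !exprS normcM IH.
Qed.

Lemma Re_le_normc z : `|Re z| <= normc z.
Proof.
rewrite -(ler_pXn2r (n := 2))// ?nnegrE ?normc_ge0// normcE2 real_normK ?num_real//.
by rewrite lerDl sqr_ge0.
Qed.

Lemma Im_le_normc z : `|Im z| <= normc z.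
Proof.
rewrite -(ler_pXn2r (n := 2))// ?nnegrE ?normc_ge0// normcE2 real_normK ?num_real//.
by rewrite lerDr sqr_ge0.
Qed.

Lemma normc_le z : normc z <= `|Re z| + `|Im z|.
Proof.
rewrite -(ler_pXn2r (n := 2))// ?nnegrE ?normc_ge0 ?addr_ge0// normcE2.
rewrite sqrrD !real_normK ?num_real// addrAC lerDl mulrn_wge0// mulr_ge0.
Qed.

Lemma normc_sum (I : Type) (r : seq I) (P : pred I) (F : I -> R[i]) :
  normc (\sum_(i <- r | P i) F i) <= \sum_(i <- r | P i) normc (F i).
Proof.
elim/big_rec2: _ => [|i x y _ IH]; first by rewrite normc0.
by apply: le_trans (le_normcD _ _) _; rewrite lerD2l.
Qed.

Lemma normc_distC z w : normc (z - w) = normc (w - z).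
Proof. by rewrite -opprB normcN. Qed.

Lemma normc_nat n : normc (n%:R : R[i]) = n%:R.
Proof. by rewrite -(rmorph_nat (real_complex R)) normc_real ger0_norm. Qed.

Lemma cexpD z w : cexp (z + w) = cexp z * cexp w.
Proof.
rewrite /cexp ReD ImD expRD cosD sinD.
by apply: complex_eqP; rewrite /= !(mul0r, subr0, addr0); ring.
Qed.

Lemma cexp_real (x : R) : cexp x%:C = (expR x)%:C.
Proof.
by rewrite /cexp /= cos0 sin0; apply: complex_eqP; rewrite /=; ring.
Qed.

Lemma cexp0 : cexp (0 : R[i]) = 1.
Proof. by rewrite -[0]/(0%:C) cexp_real expR0. Qed.

Lemma normc_cexp z : normc (cexp z) = expR (Re z).
Proof.
rewrite /cexp normcM normc_real ger0_norm ?expR_ge0//.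
by rewrite /normc cos2Dsin2 sqrtr1 mulr1.
Qed.

Lemma cexp_sum (I : Type) (r : seq I) (P : pred I) (F : I -> R[i]) :
  cexp (\sum_(i <- r | P i) F i) = \prod_(i <- r | P i) cexp (F i).
Proof.
by elim/big_rec2: _ => [|i x y _ <-]; rewrite ?cexp0 ?cexpD.
Qed.

Lemma cvgMc (c : R) (u : nat -> R) l :
  u n @[n --> \oo] --> l -> c * u n @[n --> \oo] --> c * l.
Proof. by move=> ul; apply: cvgM => //; apply: cvg_cst. Qed.

End complex_basics.

(** * Derivatives of complex-valued functions of a real variable *)

Section complex_derivative.
Variable R : realType.
Implicit Types (f g : R -> R[i]) (t : R).

Definition cderiv f t (df : R[i]) : Prop :=
  is_derive t 1 (fun u => Re (f u)) (Re df) /\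
  is_derive t 1 (fun u => Im (f u)) (Im df).

Lemma cderiv_ext f g t df : f =1 g -> cderiv f t df -> cderiv g t df.
Proof. by move=> /funext ->. Qed.

Lemma cderiv_cst (z : R[i]) t : cderiv (fun=> z) t 0.
Proof. by split; apply: is_derive_cst. Qed.

Lemma cderivD f g t df dg :
  cderiv f t df -> cderiv g t dg -> cderiv (fun u => f u + g u) t (df + dg).
Proof.
move=> [f1 f2] [g1 g2]; split.
  rewrite (_ : (fun u => _) = (fun u => Re (f u)) + (fun u => Re (g u))).
    by rewrite ReD; apply: is_deriveD.
  by apply/funext => u; rewrite ReD.
rewrite (_ : (fun u => _) = (fun u => Im (f u)) + (fun u => Im (g u))).
  by rewrite ImD; apply: is_deriveD.
by apply/funext => u; rewrite ImD.
Qed.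

Lemma cderivM f g t df dg : cderiv f t df -> cderiv g t dg ->
  cderiv (fun u => f u * g u) t (df * g t + f t * dg).
Proof.
move=> [f1 f2] [g1 g2]; split.
  rewrite (_ : (fun u => _) = (fun u => Re (f u)) * (fun u => Re (g u))
                            - (fun u => Im (f u)) * (fun u => Im (g u))).
    apply: is_derive_eq (is_deriveB (is_deriveM f1 g1) (is_deriveM f2 g2)) _.
    by rewrite ReD !ReM /GRing.scale /=; ring.
  by apply/funext => u; rewrite ReM.
rewrite (_ : (fun u => _) = (fun u => Re (f u)) * (fun u => Im (g u))
                          + (fun u => Im (f u)) * (fun u => Re (g u))).
  apply: is_derive_eq (is_deriveD (is_deriveM f1 g2) (is_deriveM f2 g1)) _.
  by rewrite ImD !ImM /GRing.scale /=; ring.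
by apply/funext => u; rewrite ImM.
Qed.

Lemma cderiv_id t : cderiv (fun u => u%:C) t 1.
Proof. by split => /=; [apply: is_derive_id | apply: is_derive_cst]. Qed.

Lemma cderivX n t : cderiv (fun u => u%:C ^+ n) t (n%:R * t%:C ^+ n.-1).
Proof.
elim: n => [|n IH].
  rewrite mul0r; apply: cderiv_ext (cderiv_cst 1 t) => u.
  by rewrite expr0.
have -> : n.+1%:R * t%:C ^+ n.+1.-1
    = 1 * t%:C ^+ n + t%:C * (n%:R * t%:C ^+ n.-1).
  case: n {IH} => [|n] /=; first by rewrite !mul0r mulr0 addr0.
  by rewrite mulrCA -exprS -mulrDl -natr1 addrC.
apply: cderiv_ext (cderivM (cderiv_id t) IH) => u.
by rewrite exprS.
Qed.

Lemma cderiv_cexp f t df :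
  cderiv f t df -> cderiv (fun u => cexp (f u)) t (df * cexp (f t)).
Proof.
move=> [f1 f2].
have h1 := is_derive1_comp (is_derive_expR (Re (f t))) f1.
have h2 := is_derive1_comp (is_derive_cos (Im (f t))) f2.
have h3 := is_derive1_comp (is_derive_sin (Im (f t))) f2.
split.
  rewrite (_ : (fun u => _) =
    (expR \o (fun u => Re (f u))) * (cos \o (fun u => Im (f u)))).
    apply: is_derive_eq (is_deriveM h1 h2) _.
    by rewrite ReM /GRing.scale /=; ring.
  by apply/funext => u; rewrite /cexp /= mul0r subr0.
rewrite (_ : (fun u => _) =
  (expR \o (fun u => Re (f u))) * (sin \o (fun u => Im (f u)))).
  apply: is_derive_eq (is_deriveM h1 h3) _.
  by rewrite ImM /GRing.scale /=; ring.
by apply/funext => u; rewrite /cexp /= mul0r addr0.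
Qed.

(** The mean value theorem has no complex-valued form, so it is applied to the real and to the
    imaginary part; this costs the factor two. *)
Lemma cderiv_le f (df : R -> R[i]) (e : R) :
  (forall t, cderiv f t (df t)) ->
  (forall t, 0 <= t <= 1 -> normc (df t) <= e) -> normc (f 1 - f 0) <= e + e.
Proof.
move=> fdf dfe.
have mvt (g dg : R -> R) : (forall t, is_derive t 1 g (dg t)) ->
    (forall t, 0 <= t <= 1 -> `|dg t| <= e) -> `|g 1 - g 0| <= e.
  move=> gdg dge.
  have gc : {within `[0, 1], continuous g}.
    apply: continuous_subspaceT => x; apply: differentiable_continuous.
    by apply/derivable1_diffP; have [] := gdg x.
  have [c c01 ->] := MVT ltr01 (fun x _ => gdg x) gc.
  rewrite subr0 mulr1; apply: dge.
  by move: c01; rewrite in_itv /= => /andP[/ltW -> /ltW ->].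
apply: le_trans (normc_le _) _; rewrite ReB ImB; apply: lerD.
  apply: (mvt (fun t => Re (f t)) (fun t => Re (df t))) => t; first by case: (fdf t).
  by move=> /dfe; apply: le_trans (Re_le_normc _).
apply: (mvt (fun t => Im (f t)) (fun t => Im (df t))) => t; first by case: (fdf t).
by move=> /dfe; apply: le_trans (Im_le_normc _).
Qed.

End complex_derivative.

(** * Hermite polynomials *)

Section hermite.

(* The pair (h_n, h_{n+1}) of Hermite polynomials with variance parameter s. *)
Fixpoint hermite2 (K : comNzRingType) (x s : K) n : K * K :=
  if n is n'.+1 then let: (a, b) := hermite2 x s n' in (b, x * b - n'.+1%:R * s * a)
  else (1, x).

Definition hermite (K : comNzRingType) (x s : K) n := (hermite2 x s n).1.

Lemma hermite2E (K : comNzRingType) (x s : K) n :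
  hermite2 x s n = (hermite x s n, hermite x s n.+1).
Proof. by rewrite /hermite /=; case: hermite2. Qed.

Lemma hermite0 (K : comNzRingType) (x s : K) : hermite x s 0 = 1.
Proof. by []. Qed.

Lemma hermite1 (K : comNzRingType) (x s : K) : hermite x s 1 = x.
Proof. by []. Qed.

Lemma hermiteSS (K : comNzRingType) (x s : K) n :
  hermite x s n.+2 = x * hermite x s n.+1 - n.+1%:R * s * hermite x s n.
Proof. by rewrite {1}/hermite [hermite2 _ _ n.+2]/= hermite2E. Qed.

Lemma hermite_ind2 (P : nat -> Prop) :
  P 0 -> P 1 -> (forall n, P n -> P n.+1 -> P n.+2) -> forall n, P n.
Proof.
move=> P0 P1 PSS n; suff [] : P n /\ P n.+1 by [].
by elim: n => // n [IH1 IH2]; split => //; apply: PSS.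
Qed.

Lemma hermiteZ (K : comNzRingType) (a x s : K) n :
  hermite (a * x) (a ^+ 2 * s) n = a ^+ n * hermite x s n.
Proof.
elim/hermite_ind2: n => [||n IH1 IH2]; first by rewrite expr0 mul1r.
  by rewrite !hermite1 expr1.
by rewrite !hermiteSS IH1 IH2 !exprS expr0; ring.
Qed.

Lemma hermite_s0 (K : comNzRingType) (x : K) n : hermite x 0 n = x ^+ n.
Proof.
elim/hermite_ind2: n => [||n _ IH]; rewrite ?hermite1 ?expr1//.
by rewrite hermiteSS IH mulr0 mul0r subr0 [RHS]exprS.
Qed.

Lemma hermite_morph (K L : comNzRingType) (phi : {rmorphism K -> L}) (x s : K) n :
  hermite (phi x) (phi s) n = phi (hermite x s n).
Proof.
elim/hermite_ind2: n => [||n IH1 IH2]; rewrite ?rmorph1//.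
by rewrite !hermiteSS IH1 IH2 rmorphB !rmorphM rmorph_nat.
Qed.

Variable R : realType.
Implicit Types x s : R[i].

(** With parameter [- normc s] every sign in the recurrence becomes positive, so the triangle
    inequality carries the real polynomial along as a majorant. *)
Lemma normc_hermite x s n :
  normc (hermite x s n) <= hermite (normc x) (- normc s) n.
Proof.
elim/hermite_ind2: n => [||n IH1 IH2].
- by rewrite !hermite0 normc1.
- by [].
rewrite !hermiteSS; apply: le_trans (le_normcD _ _) _.
rewrite normcN !normcM normc_nat mulrN mulNr opprK.
by apply: lerD; rewrite ler_wpM2l ?mulr_ge0 ?normc_ge0.
Qed.

Lemma hermite_ge0 (a b : R) n : 0 <= a -> 0 <= b -> 0 <= hermite a (- b) n.
Proof.
move=> a0 b0; elim/hermite_ind2: n => // n IH1 IH2.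
by rewrite hermiteSS mulrN mulNr opprK addr_ge0// !mulr_ge0.
Qed.

(** The coefficient of t^n in exp(t x - t^2 s / 2). *)
Definition hcoef x s n : R[i] := (n`!%:R)^-1 * hermite x s n.

Lemma hcoef0 x s : hcoef x s 0 = 1.
Proof. by rewrite /hcoef fact0 invr1 mul1r. Qed.

Lemma hcoef1 x s : hcoef x s 1 = x.
Proof. by rewrite /hcoef factS fact0 invr1 mul1r. Qed.

Lemma hcoefSS x s n :
  n.+2%:R * hcoef x s n.+2 = x * hcoef x s n.+1 - s * hcoef x s n.
Proof.
rewrite /hcoef hermiteSS !factS !natrM.
have h1 : (n`!%:R : R[i]) != 0 by rewrite pnatr_eq0 -lt0n fact_gt0.
have h2 : (n.+1%:R : R[i]) != 0 by rewrite pnatr_eq0.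
have h3 : (n.+2%:R : R[i]) != 0 by rewrite pnatr_eq0.
by field; apply/and3P; split.
Qed.

(** The recurrence divides by [n.+2]; once this exceeds a constant depending on x and s, a geometric
    bound of ratio 1/2 reproduces itself. *)
Lemma hcoef_bound x s : exists L, forall n, normc (hcoef x s n) <= L / 2 ^+ n.
Proof.
(* Chosen so that |x| L / 2^(n+1) + |s| L / 2^n = C L / 2^(n+2). *)
pose C := 2 * normc x + 4 * normc s.
pose m := Num.truncn C.
have mC : C < m.+1%:R by rewrite truncnS_gt.
pose L := \sum_(i < m.+2) normc (hcoef x s i) * 2 ^+ i.
exists L; have base n : (n < m.+2)%N -> normc (hcoef x s n) <= L / 2 ^+ n.
  move=> nm; rewrite ler_pdivlMr ?exprn_gt0// /L (bigD1 (Ordinal nm))//= lerDl.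
  by apply: sumr_ge0 => i _; rewrite mulr_ge0 ?normc_ge0 ?exprn_ge0.
elim/hermite_ind2 => [||n IH1 IH2]; [exact: base| |].
  by apply: base.
have [/base//|mn] := ltnP n.+2 m.+2.
have nC : C <= n.+2%:R.
  by apply: le_trans (ltW mC) _; rewrite ler_nat; apply: leq_trans mn; rewrite ltnW.
have L0 : 0 <= L.
  by apply: sumr_ge0 => i _; rewrite mulr_ge0 ?normc_ge0 ?exprn_ge0.
rewrite -(ler_pM2l (ltr0Sn _ n.+1)) -[in leLHS](@normc_nat R).
rewrite -normcM hcoefSS.
apply: le_trans (le_normcD _ _) _.
rewrite normcN [normc (x * _)]normcM [normc (s * _)]normcM.
apply: (@le_trans _ _ (C * (L / 2 ^+ n.+2))); last first.
  by apply: ler_wpM2r nC; rewrite divr_ge0 ?exprn_ge0.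
have -> : C * (L / 2 ^+ n.+2) = normc x * (L / 2 ^+ n.+1) + normc s * (L / 2 ^+ n).
  rewrite /C !exprS.
  have : (2 ^+ n : R) != 0 by rewrite expf_neq0.
  by move=> ?; field.
by apply: lerD; rewrite ler_wpM2l ?normc_ge0.
Qed.

Lemma hcoef_cvg0 x s : normc (hcoef x s n) @[n --> \oo] --> 0.
Proof.
have [L HL] := hcoef_bound x s.
apply: (@squeeze_cvgr _ _ _ _ (fun=> 0) (fun n => L / 2 ^+ n)).
- by near=> n; rewrite normc_ge0 HL.
- exact: cvg_cst.
- rewrite [X in _ --> X](_ : 0 = L * 0); last by rewrite mulr0.
  apply: (@cvgMc R L (fun n => (2 ^+ n)^-1)).
  rewrite (_ : (fun _ => _) = (fun n => (2^-1 : R) ^+ n)).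
    by apply: cvg_expr; rewrite ger0_norm// invf_lt1// ltr1n.
  by apply/funext => n; rewrite exprVn.
Unshelve. all: by end_near. Qed.

(** The partial sums solve the equation f' = (x - s t) f of the generating function up to an error
    made of the last two coefficients. *)
Lemma cderiv_hermite_sum x s t N :
  cderiv (fun u => \sum_(n < N.+2) hcoef x s n * u%:C ^+ n) t
    ((x - s * t%:C) * \sum_(n < N.+2) hcoef x s n * t%:C ^+ n
     + (s * hcoef x s N * t%:C ^+ N.+1 - x * hcoef x s N.+1 * t%:C ^+ N.+1
        + s * hcoef x s N.+1 * t%:C ^+ N.+2)).
Proof.
elim: N => [|N IH].
  have := cderivD (cderiv_cst 1 t) (cderivM (cderiv_cst x t) (cderiv_id t)).
  have <- : ((x - s * t%:C) * (\sum_(n < 2) hcoef x s n * t%:C ^+ n) +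
   (s * hcoef x s 0 * t%:C ^+ 1 - x * hcoef x s 1 * t%:C ^+ 1 +
    s * hcoef x s 1 * t%:C ^+ 2)) = 0 + (0 * t%:C + x * 1).
    by rewrite !big_ord_recr big_ord0 /= hcoef0 hcoef1 expr0; ring.
  apply: cderiv_ext => u.
  by rewrite !big_ord_recr big_ord0 /= hcoef0 hcoef1 expr0 add0r !mulr1.
have := cderivD IH (cderivM (cderiv_cst (hcoef x s N.+2) t) (cderivX N.+2 t)).
set d := (X in cderiv _ _ X); set d' := (X in _ -> cderiv _ _ X).
have -> : d' = d.
  rewrite /d /d' big_ord_recr /= mul0r add0r mulrA [hcoef _ _ _ * N.+2%:R]mulrC hcoefSS /= !exprS.
  by ring.
by apply: cderiv_ext => u; rewrite [RHS]big_ord_recr.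
Qed.

(** Multiplied by [E], which inverts the expected limit, the partial sum has derivative [E] times
    the error, uniformly small on [0, 1]. The product starts at 1, hence it ends close to 1. *)
Lemma hermite_gen x s :
  normc (\sum_(n < N) hcoef x s n - cexp (x - s / 2)) @[N --> \oo] --> 0.
Proof.
pose E u := cexp ((s / 2) * u%:C ^+ 2 - x * u%:C).
pose S N u := \sum_(n < N.+2) hcoef x s n * u%:C ^+ n.
pose rem N t := s * hcoef x s N * t%:C ^+ N.+1 - x * hcoef x s N.+1 * t%:C ^+ N.+1
        + s * hcoef x s N.+1 * t%:C ^+ N.+2.
have dE t : cderiv E t ((s * t%:C - x) * E t).
  have := cderiv_cexp (cderivD (cderivM (cderiv_cst (s / 2) t) (cderivX 2 t))
    (cderivM (cderiv_cst (- x) t) (cderiv_id t))).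
  rewrite /= !mul0r !add0r mulr1 expr1.
  have -> : s / 2 * (2%:R * t%:C) - x = s * t%:C - x by field.
  by rewrite mulNr; apply: cderiv_ext => u; rewrite mulNr.
have dES N t : cderiv (fun u => E u * S N u) t (E t * rem N t).
  have := cderivM (dE t) (cderiv_hermite_sum x s t N).
  set d := (X in cderiv _ _ X); set d' := (X in _ -> cderiv _ _ X).
  by have -> // : d' = d by rewrite /d /d' /rem /S; ring.
pose b N := normc s * normc (hcoef x s N) + normc x * normc (hcoef x s N.+1)
  + normc s * normc (hcoef x s N.+1).
pose M := expR (normc s + normc x).
have ES N : normc (E 1 * S N 1 - 1) <= M * b N + M * b N.
  have ES0 : E 0 * S N 0 = 1.
    rewrite /E /S expr0n !mulr0 subr0 cexp0 mul1r big_ord_recl hcoef0 expr0 mulr1.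
    by rewrite big1 ?addr0// => i _; rewrite expr0n mulr0.
  rewrite -[X in _ - X]ES0; apply: (cderiv_le (dES N)) => t /andP[t0 t1].
  rewrite normcM; apply: ler_pM; rewrite ?normc_ge0//.
    rewrite /E normc_cexp ler_expR; apply: le_trans (ler_norm _) _.
    apply: le_trans (Re_le_normc _) _; apply: le_trans (le_normcD _ _) _.
    rewrite normcN !(normcX, normcM) normc_real ger0_norm//.
    apply: lerD; last by rewrite ler_piMr ?normc_ge0.
    rewrite normcV normc_nat -mulrA ler_piMr ?normc_ge0//.
    by rewrite mulr_ile1 ?exprn_ile1 ?invr_ge0 ?exprn_ge0// invf_le1 ?ler1n.
  apply: le_trans (le_normcD _ _) _; apply: lerD.
    apply: le_trans (le_normcD _ _) _.
    rewrite normcN !(normcX, normcM) normc_real ger0_norm//.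
    by apply: lerD; rewrite ler_piMr ?mulr_ge0 ?normc_ge0// exprn_ile1.
  rewrite !(normcX, normcM) normc_real ger0_norm//.
  by rewrite ler_piMr ?mulr_ge0 ?normc_ge0// exprn_ile1.
have b0 : b N @[N --> \oo] --> 0.
  rewrite [X in _ --> X](_ : 0 = normc s * 0 + normc x * 0 + normc s * 0); last first.
    by rewrite !mulr0 !addr0.
  have c1 : normc (hcoef x s N.+1) @[N --> \oo] --> 0.
    by rewrite (cvg_shiftS (fun n => normc (hcoef x s n))); apply: hcoef_cvg0.
  by do 2?apply: cvgD; apply: cvgMc => //; apply: hcoef_cvg0.
pose K := normc (cexp (x - s / 2)).
rewrite -(cvg_shiftn 2).
apply: (@squeeze_cvgr _ _ _ _ (fun=> 0) (fun N => K * (M * b N + M * b N))).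
- near=> N; rewrite normc_ge0 /=.
  have -> : \sum_(n < N + 2) hcoef x s n - cexp (x - s / 2)
      = cexp (x - s / 2) * (E 1 * S N 1 - 1).
    have e1 : cexp (x - s / 2) * E 1 = 1.
      rewrite /E -cexpD expr1n !mulr1 -[RHS](cexp0 R); congr cexp; ring.
    rewrite mulrBr mulr1 mulrA e1 mul1r addn2; congr (_ - _).
    by apply: eq_bigr => i _; rewrite expr1n mulr1.
  by rewrite normcM ler_wpM2l ?normc_ge0.
- exact: cvg_cst.
- rewrite [X in _ --> X](_ : 0 = K * (M * 0 + M * 0)); last by rewrite !mulr0 addr0 mulr0.
  by apply: cvgMc; apply: cvgD; apply: cvgMc.
Unshelve. all: by end_near. Qed.

(** All terms are nonnegative, so the limit bounds every partial sum. With a = |x| and b = |s| this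
    is the dominating function for integrating Hermite series term by term. *)
Lemma hermite_gen_real (a b : R) : 0 <= a -> 0 <= b -> forall N,
  \sum_(n < N) (n`!%:R)^-1 * hermite a (- b) n <= expR (a + b / 2).
Proof.
move=> a0 b0 N.
have t0 n : 0 <= (n`!%:R)^-1 * hermite a (- b) n :> R.
  by rewrite mulr_ge0 ?invr_ge0 ?hermite_ge0.
have cvgS : (\sum_(n < N) (n`!%:R)^-1 * hermite a (- b) n : R) @[N --> \oo]
    --> expR (a + b / 2).
  apply/cvgrPdist_le => e e0.
  have /cvgrPdist_le/(_ e e0) := hermite_gen a%:C (- b)%:C.
  apply: filterS => M; rewrite sub0r normrN ger0_norm ?normc_ge0//.
  have -> : (\sum_(n < M) hcoef a%:C (- b)%:C n)
     = (\sum_(n < M) (n`!%:R)^-1 * hermite a (- b) n)%:C.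
    rewrite rmorph_sum /=; apply: eq_bigr => i _.
    by rewrite /hcoef hermite_morph rmorphM /= fmorphV rmorph_nat.
  have -> : a%:C - (- b)%:C / 2 = (a + b / 2)%:C.
    by rewrite rmorphD rmorphN rmorphM fmorphV /= rmorph_nat mulNr opprK.
  by rewrite cexp_real -rmorphB normc_real distrC.
apply: cvgr_to_ge cvgS _; near=> M.
have NM : (N <= M)%N by near: M; apply: nbhs_infty_ge.
rewrite -(subnKC NM) big_split_ord /= lerDl; exact: sumr_ge0.
Unshelve. all: by end_near.
Qed.

End hermite.

(** * Integrals of complex functions *)

Section complex_measurability.
Context d (T : measurableType d) (R : realType).
Implicit Types (f g : T -> R[i]).

Definition cmeasurable f : Prop :=
  measurable_fun setT (fun x => Re (f x)) /\
  measurable_fun setT (fun x => Im (f x)).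

Lemma cmeas_cst (z : R[i]) : cmeasurable (fun=> z).
Proof. by split; apply: measurable_cst. Qed.

Lemma cmeas_real (f : T -> R) :
  measurable_fun setT f -> cmeasurable (fun x => (f x)%:C).
Proof. by move=> mf; split => //; apply: measurable_cst. Qed.

Lemma cmeasD f g : cmeasurable f -> cmeasurable g -> cmeasurable (fun x => f x + g x).
Proof.
move=> [f1 f2] [g1 g2]; split.
  by under eq_fun do rewrite ReD; apply: measurable_funD.
by under eq_fun do rewrite ImD; apply: measurable_funD.
Qed.

Lemma cmeasM f g : cmeasurable f -> cmeasurable g -> cmeasurable (fun x => f x * g x).
Proof.
move=> [f1 f2] [g1 g2]; split.
  under eq_fun do rewrite ReM.
  by apply: measurable_funB; apply: measurable_funM.
under eq_fun do rewrite ImM.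
by apply: measurable_funD; apply: measurable_funM.
Qed.

Lemma cmeasN f : cmeasurable f -> cmeasurable (fun x => - f x).
Proof.
by move=> mf; under eq_fun do rewrite -mulN1r; apply: cmeasM => //; apply: cmeas_cst.
Qed.

Lemma cmeasB f g : cmeasurable f -> cmeasurable g -> cmeasurable (fun x => f x - g x).
Proof. by move=> mf mg; apply: cmeasD => //; apply: cmeasN. Qed.

Lemma cmeas_sum (I : Type) (r : seq I) (P : pred I) (F : I -> T -> R[i]) :
  (forall i, P i -> cmeasurable (F i)) ->
  cmeasurable (fun x => \sum_(i <- r | P i) F i x).
Proof.
move=> mF; elim: r => [|i r IH].
  by under eq_fun do rewrite big_nil; apply: cmeas_cst.
case Pi: (P i).
  by under eq_fun do rewrite big_cons Pi; apply: cmeasD => //; apply: mF.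
by under eq_fun do rewrite big_cons Pi.
Qed.

Lemma cmeas_prod (I : Type) (r : seq I) (P : pred I) (F : I -> T -> R[i]) :
  (forall i, P i -> cmeasurable (F i)) ->
  cmeasurable (fun x => \prod_(i <- r | P i) F i x).
Proof.
move=> mF; elim: r => [|i r IH].
  by under eq_fun do rewrite big_nil; apply: cmeas_cst.
case Pi: (P i).
  by under eq_fun do rewrite big_cons Pi; apply: cmeasM => //; apply: mF.
by under eq_fun do rewrite big_cons Pi.
Qed.

Lemma cmeas_cexp f : cmeasurable f -> cmeasurable (fun x => cexp (f x)).
Proof.
move=> [f1 f2]; split.
  rewrite (_ : (fun x => _) = (fun x => expR (Re (f x)) * cos (Im (f x)))).
    apply: measurable_funM; first exact: (measurableT_comp (@measurable_expR R)).
    apply: measurableT_comp => //; apply: continuous_measurable_fun.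
    exact: continuous_cos.
  by apply/funext => u; rewrite /cexp /= mul0r subr0.
rewrite (_ : (fun x => _) = (fun x => expR (Re (f x)) * sin (Im (f x)))).
  apply: measurable_funM; first exact: (measurableT_comp (@measurable_expR R)).
  apply: measurableT_comp => //; apply: continuous_measurable_fun.
  exact: continuous_sin.
by apply/funext => u; rewrite /cexp /= mul0r addr0.
Qed.

Lemma cmeas_normc f : cmeasurable f -> measurable_fun setT (fun x => normc (f x)).
Proof.
move=> [f1 f2].
rewrite (_ : (fun x => _) = (fun x => Num.sqrt (Re (f x) ^+ 2 + Im (f x) ^+ 2))).
  apply: (measurableT_comp (continuous_measurable_fun (@sqrt_continuous R))).
  by apply: measurable_funD; apply: measurable_funX.
by apply/funext => x; rewrite -normcE2 sqrtr_sqr ger0_norm ?normc_ge0.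
Qed.

Lemma cmeas_hermite f (s : R[i]) n :
  cmeasurable f -> cmeasurable (fun x => hermite (f x) s n).
Proof.
move=> mf; elim/hermite_ind2: n => [|//|n IH1 IH2]; first exact: (cmeas_cst 1).
under eq_fun do rewrite hermiteSS.
apply: cmeasB; apply: cmeasM => //; exact: cmeas_cst.
Qed.

End complex_measurability.

Section complex_integral.
Context d (T : measurableType d) (R : realType) (P : probability T R).
Implicit Types (f g : T -> R[i]).

Lemma cintegrable_meas f : cintegrable P f -> cmeasurable f.
Proof.
by move=> [/measurable_int f1 /measurable_int f2]; split; apply/measurable_EFinP.
Qed.

Lemma dominated_integrable (f g : T -> R) : measurable_fun setT f ->
  P.-integrable setT (EFin \o g) -> (forall x, `|f x| <= g x) ->
  P.-integrable setT (EFin \o f).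
Proof.
move=> mf ig fg; apply: le_integrable ig => //; first exact/measurable_EFinP.
by move=> x _ /=; rewrite lee_fin; apply: le_trans (fg x) (ler_norm _).
Qed.

Lemma cintegrable_dom f (g : T -> R) : cmeasurable f ->
  P.-integrable setT (EFin \o g) -> (forall x, normc (f x) <= g x) ->
  cintegrable P f.
Proof.
move=> [f1 f2] ig fg; split.
  apply: (@dominated_integrable (fun x => Re (f x)) g) => // x.
  exact: le_trans (Re_le_normc _) _.
apply: (@dominated_integrable (fun x => Im (f x)) g) => // x.
exact: le_trans (Im_le_normc _) _.
Qed.

Lemma integrable_normc f :
  cintegrable P f -> P.-integrable setT (EFin \o (fun x => normc (f x))).
Proof.
move=> fi; have [f1 f2] := fi.
apply: (@dominated_integrable _ (fun x => `|Re (f x)| + `|Im (f x)|)).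
- exact/cmeas_normc/cintegrable_meas.
- apply: (@integrableD _ _ _ P setT measurableT
    (fun x => (`|Re (f x)|)%:E) (fun x => (`|Im (f x)|)%:E)).
    exact: (integrable_abse f1).
  exact: (integrable_abse f2).
- by move=> x; rewrite ger0_norm ?normc_ge0// normc_le.
Qed.

Lemma cintegrable_cst (z : R[i]) : cintegrable P (fun=> z).
Proof. by split; apply: finite_measure_integrable_cst. Qed.

Lemma cintegrableD f g :
  cintegrable P f -> cintegrable P g -> cintegrable P (fun x => f x + g x).
Proof.
move=> [f1 f2] [g1 g2]; split.
  by under eq_fun do rewrite ReD EFinD; apply: integrableD.
by under eq_fun do rewrite ImD EFinD; apply: integrableD.
Qed.

Lemma cintegrableZ (z : R[i]) f : cintegrable P f -> cintegrable P (fun x => z * f x).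
Proof.
move=> fi; apply: (@cintegrable_dom _ (fun x => normc z * normc (f x))).
- by apply: cmeasM; [apply: cmeas_cst | apply: cintegrable_meas].
- exact: (integrableZl (f := fun x => (normc (f x))%:E) _ _ (integrable_normc fi)).
- by move=> x; rewrite normcM.
Qed.

Lemma cintegrable_sum (I : Type) (r : seq I) (Q : pred I) (F : I -> T -> R[i]) :
  (forall i, Q i -> cintegrable P (F i)) ->
  cintegrable P (fun x => \sum_(i <- r | Q i) F i x).
Proof.
move=> iF; elim: r => [|i r IH].
  by under eq_fun do rewrite big_nil; apply: cintegrable_cst.
case Qi: (Q i).
  by under eq_fun do rewrite big_cons Qi; apply: cintegrableD => //; apply: iF.
by under eq_fun do rewrite big_cons Qi.
Qed.

Lemma cintegral_cst (z : R[i]) : cintegral P (fun=> z) = z.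
Proof.
have PT : P [set: T] = 1%E by exact: probability_setT.
have cstE (a : R) : \int[P]_x (fun=> a) x = a by rewrite Rintegral_cst// [X in fine X]PT mulr1.
by apply: complex_eqP; apply: cstE.
Qed.

Lemma cintegralD f g : cintegrable P f -> cintegrable P g ->
  cintegral P (fun x => f x + g x) = cintegral P f + cintegral P g.
Proof.
move=> [f1 f2] [g1 g2]; apply: complex_eqP => /=.
  by under eq_Rintegral do rewrite ReD; rewrite RintegralD.
by under eq_Rintegral do rewrite ImD; rewrite RintegralD.
Qed.

Lemma cintegralZ (z : R[i]) f : cintegrable P f ->
  cintegral P (fun x => z * f x) = z * cintegral P f.
Proof.
move=> [f1 f2]; have iZ (a : R) (h : T -> R) : P.-integrable setT (EFin \o h) ->
    P.-integrable setT (EFin \o (fun x => a * h x)).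
  by move=> ih; apply: (@integrableZl _ _ _ P setT measurableT a (fun x => (h x)%:E)).
apply: complex_eqP; rewrite ?ReM ?ImM /=.
  under eq_Rintegral do rewrite ReM.
  by rewrite RintegralB ?RintegralZl//; apply: iZ.
under eq_Rintegral do rewrite ImM.
by rewrite RintegralD ?RintegralZl//; apply: iZ.
Qed.

Lemma cintegral_sum (I : Type) (r : seq I) (Q : pred I) (F : I -> T -> R[i]) :
  (forall i, Q i -> cintegrable P (F i)) ->
  cintegral P (fun x => \sum_(i <- r | Q i) F i x)
    = \sum_(i <- r | Q i) cintegral P (F i).
Proof.
move=> iF; elim: r => [|i r IH].
  rewrite big_nil; under [X in cintegral P X]eq_fun do rewrite big_nil.
  exact: cintegral_cst.
rewrite big_cons; case Qi: (Q i); last by under [X in cintegral P X]eq_fun do rewrite big_cons Qi.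
under [X in cintegral P X]eq_fun do rewrite big_cons Qi.
by rewrite cintegralD ?IH//; [apply: iF|apply: cintegrable_sum].
Qed.

Lemma cintegralB f g : cintegrable P f -> cintegrable P g ->
  cintegral P (fun x => f x - g x) = cintegral P f - cintegral P g.
Proof.
move=> fi gi; under [X in cintegral P X]eq_fun do rewrite -[X in _ + X]mulN1r.
by rewrite cintegralD ?cintegralZ ?mulN1r//; apply: cintegrableZ.
Qed.

Lemma cintegrableB f g :
  cintegrable P f -> cintegrable P g -> cintegrable P (fun x => f x - g x).
Proof.
move=> fi gi; under eq_fun do rewrite -[X in _ + X]mulN1r.
by apply: cintegrableD => //; apply: cintegrableZ.
Qed.

Lemma cintegral_real (f : T -> R) :
  cintegral P (fun x => (f x)%:C) = (\int[P]_x f x)%:C.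
Proof. by apply: complex_eqP => //=; rewrite Rintegral_cst// mul0r. Qed.

(** Real and imaginary parts are bounded separately, which is where the factor 2 in the later
    estimates of complex integrals comes from. *)
Lemma normc_cintegral f (g : T -> R) : cintegrable P f ->
  P.-integrable setT (EFin \o g) -> (forall x, normc (f x) <= g x) ->
  normc (cintegral P f) <= 2 * \int[P]_x g x.
Proof.
move=> [f1 f2] ig fg; apply: le_trans (normc_le _) _ => /=.
rewrite mulr_natl mulr2n; apply: lerD; apply: le_trans (le_normr_Rintegral _ _) _ => //.
  apply: le_Rintegral => // [|x _]; first exact: (integrable_abse f1).
  exact: le_trans (Re_le_normc _) _.
apply: le_Rintegral => // [|x _]; first exact: (integrable_abse f2).
exact: le_trans (Im_le_normc _) _.
Qed.

Lemma dominated_Rintegral (f_ : nat -> T -> R) (f g : T -> R) :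
  (forall n, measurable_fun setT (f_ n)) -> measurable_fun setT f ->
  (forall x, f_ n x @[n --> \oo] --> f x) ->
  P.-integrable setT (EFin \o g) -> (forall n x, `|f_ n x| <= g x) ->
  \int[P]_x f_ n x @[n --> \oo] --> \int[P]_x f x.
Proof.
move=> mf_ mf f_f ig fg.
have [] := @dominated_convergence _ _ _ P setT measurableT
  (fun n => EFin \o f_ n) (EFin \o f) (EFin \o g).
- by move=> n; apply/measurable_EFinP.
- exact/measurable_EFinP.
- by apply/aeW => x _; apply/fine_cvgP; split; [near=> n|apply: f_f].
- exact: ig.
- by apply/aeW => x n _ /=; rewrite lee_fin.
move=> fi _; rewrite -[X in _ --> X]fineK ?integrable_fin_num//.
move=> /fine_cvgP[_]; rewrite /Rintegral; apply: cvg_trans.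
by [].
Unshelve. all: by end_near. Qed.

Lemma dominated_cintegral (f_ : nat -> T -> R[i]) f (g : T -> R) :
  (forall n, cmeasurable (f_ n)) -> cmeasurable f ->
  (forall x, normc (f_ n x - f x) @[n --> \oo] --> 0) ->
  P.-integrable setT (EFin \o g) -> (forall n x, normc (f_ n x) <= g x) ->
  normc (cintegral P (f_ n) - cintegral P f) @[n --> \oo] --> 0.
Proof.
move=> mf_ mf f_f ig fg.
have ifn n : cintegrable P (f_ n) by apply: cintegrable_dom (fg n).
have fg' x : normc (f x) <= g x.
  apply/ler_addgt0Pr => e e0.
  have /cvgrPdist_lt/(_ e e0) := f_f x => -[n _ /(_ n (leqnn n))].
  rewrite /= sub0r normrN ger0_norm ?normc_ge0// => h.
  have -> : f x = f_ n x + - (f_ n x - f x) by rewrite opprB addrC subrK.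
  apply: le_trans (le_normcD _ _) _; rewrite normcN.
  by apply: lerD => //; apply: ltW.
have if_ : cintegrable P f by apply: cintegrable_dom fg'.
have h : \int[P]_x normc (f_ n x - f x) @[n --> \oo] --> \int[P]_x (0 : R).
  apply: (@dominated_Rintegral _ _ (fun x => g x + g x)) => //.
  - by move=> n; apply/cmeas_normc/cmeasB.
  - exact: (@integrableD _ _ _ P setT measurableT (EFin \o g) (EFin \o g)).
  - move=> n x; rewrite ger0_norm ?normc_ge0//.
    by apply: le_trans (le_normcD _ _) _; rewrite normcN; apply: lerD.
rewrite Rintegral_cst// mul0r in h.
apply: (@squeeze_cvgr _ _ _ _ (fun=> 0)
  (fun n => 2 * \int[P]_x normc (f_ n x - f x))).
- near=> n; rewrite normc_ge0 andTb.
  have ib : cintegrable P (fun x => f_ n x - f x) by apply: cintegrableB.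
  have -> : cintegral P (f_ n) - cintegral P f = cintegral P (fun x => f_ n x - f x).
    by rewrite cintegralB.
  exact: normc_cintegral (integrable_normc ib) _.
- exact: cvg_cst.
- by rewrite -[X in _ --> X](mulr0 2); apply: cvgMc.
Unshelve. all: by end_near. Qed.

End complex_integral.

(** * Fubini's theorem for complex functions *)

Section complex_fubini.
Context d1 d2 (T1 : measurableType d1) (T2 : measurableType d2) (R : realType).
Variables (P1 : probability T1 R) (P2 : probability T2 R).

Lemma cmeas_pair1 (F : T1 * T2 -> R[i]) y :
  cmeasurable F -> cmeasurable (fun x => F (x, y)).
Proof. by move=> [f1 f2]; split; [apply: (measurableT_comp f1) | apply: (measurableT_comp f2)];
  apply: measurable_pair2. Qed.

Lemma cmeas_pair2 (F : T1 * T2 -> R[i]) x :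
  cmeasurable F -> cmeasurable (fun y => F (x, y)).
Proof. by move=> [f1 f2]; split; [apply: (measurableT_comp f1) | apply: (measurableT_comp f2)];
  apply: measurable_pair1. Qed.

Lemma integrable_of_le (f : T2 -> R) (c : R) : measurable_fun setT f ->
  (forall x, 0 <= f x) -> (\int[P2]_y (f y)%:E <= c%:E)%E ->
  P2.-integrable setT (EFin \o f).
Proof.
move=> mf f0 fc; apply/integrableP; split; first exact/measurable_EFinP.
under eq_integral do rewrite gee0_abs ?lee_fin//=.
exact: le_lt_trans fc (ltry _).
Qed.

Lemma cintegrable_of_le (f : T2 -> R[i]) (c : R) : cmeasurable f ->
  (\int[P2]_y (normc (f y))%:E <= c%:E)%E -> cintegrable P2 f.
Proof.
move=> mf fc; apply: (@cintegrable_dom _ _ _ _ _ (fun y => normc (f y))) => //.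
by apply: integrable_of_le fc; [apply: cmeas_normc|move=> ?; apply: normc_ge0].
Qed.

Variables (F : T1 * T2 -> R[i]) (G : T1 -> R).
Hypotheses (mF : cmeasurable F)
  (FG : forall x, (\int[P2]_y (normc (F (x, y)))%:E <= (G x)%:E)%E)
  (iG : P1.-integrable setT (EFin \o G)).

Let prod_integrable (f : T1 * T2 -> R) : measurable_fun setT f ->
  (forall z, `|f z| <= normc (F z)) -> (P1 \x P2)%E.-integrable setT (EFin \o f).
Proof.
move=> mf fF; apply/integrable12ltyP; first exact/measurable_EFinP.
have mFn : measurable_fun setT (fun z => (normc (F z))%:E).
  by apply/measurable_EFinP; apply: cmeas_normc.
apply: (@le_lt_trans _ _ (\int[P1]_x (G x)%:E)%E); last first.
  by move/integrableP : iG => [_]; apply: le_lt_trans; apply: le_trans (le_abse_integral _ _ _) => //;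
    [apply: lee_abs|apply: measurable_int iG].
apply: ge0_le_integral => //.
- by move=> x _; apply: integral_ge0.
- apply: (@measurable_fun_fubini_tonelli_F _ _ _ _ _ P2 (fun z => `|(f z)%:E|%E)) => //.
  by apply: measurableT_comp => //; apply/measurable_EFinP.
- exact: measurable_int iG.
- move=> x _; apply: le_trans (FG x); apply: ge0_le_integral => //.
  + apply: measurableT_comp => //; apply/measurable_EFinP.
    by apply: measurableT_comp mf _; apply: measurable_pair1.
  + by apply: measurableT_comp mFn _; apply: measurable_pair1.
  + by move=> y _; rewrite lee_fin fF.
Qed.

(** Real integrals discard infinite values, so the slices have to be integrable at every point and
    not just almost everywhere. Those in the second variable are so by the bound [G]. *)
Lemma cFubini : (forall y, cintegrable P1 (fun x => F (x, y))) ->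
  cintegrable P1 (fun x => cintegral P2 (fun y => F (x, y))) /\
  cintegral P1 (fun x => cintegral P2 (fun y => F (x, y))) =
  cintegral P2 (fun y => cintegral P1 (fun x => F (x, y))).
Proof.
move=> iF1.
have iF2 x : cintegrable P2 (fun y => F (x, y)).
  by apply: cintegrable_of_le (FG x); apply: cmeas_pair2.
have iR : (P1 \x P2)%E.-integrable setT (EFin \o (fun z => Re (F z))).
  by apply: prod_integrable => [|z]; [case: mF | apply: Re_le_normc].
have iI : (P1 \x P2)%E.-integrable setT (EFin \o (fun z => Im (F z))).
  by apply: prod_integrable => [|z]; [case: mF | apply: Im_le_normc].
have fK1 (f : T1 * T2 -> R) x : P2.-integrable setT (fun y => (f (x, y))%:E) ->
    (\int[P2]_y f (x, y))%:E = (\int[P2]_y (f (x, y))%:E)%E.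
  by move=> h; rewrite fineK// integrable_fin_num.
have fK2 (f : T1 * T2 -> R) y : P1.-integrable setT (fun x => (f (x, y))%:E) ->
    (\int[P1]_x f (x, y))%:E = (\int[P1]_x (f (x, y))%:E)%E.
  by move=> h; rewrite fineK// integrable_fin_num.
split; first split => /=.
- under eq_fun do rewrite (fK1 (fun z => Re (F z))) ?(iF2 _).1//.
  exact: (integrable_fubini_F iR).
- under eq_fun do rewrite (fK1 (fun z => Im (F z))) ?(iF2 _).2//.
  exact: (integrable_fubini_F iI).
apply: complex_eqP => /=.
  rewrite [LHS]/Rintegral [RHS]/Rintegral; congr fine.
  under eq_integral do rewrite (fK1 (fun z => Re (F z))) ?(iF2 _).1//.
  rewrite (Fubini iR) /=.
  by under [RHS]eq_integral do rewrite (fK2 (fun z => Re (F z))) ?(iF1 _).1//.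
rewrite [LHS]/Rintegral [RHS]/Rintegral; congr fine.
under eq_integral do rewrite (fK1 (fun z => Im (F z))) ?(iF2 _).2//.
rewrite (Fubini iI) /=.
by under [RHS]eq_integral do rewrite (fK2 (fun z => Im (F z))) ?(iF1 _).2//.
Qed.

End complex_fubini.

(** * Convergence of complex sequences and uniqueness of power series *)

Section complex_sequences.
Variable R : realType.
Implicit Types (u : nat -> R[i]) (l : R[i]).

Definition ccvg u l : Prop := normc (u n - l) @[n --> \oo] --> 0.

Lemma ccvg_squeeze u l (e : nat -> R) : (forall n, normc (u n - l) <= e n) ->
  e n @[n --> \oo] --> 0 -> ccvg u l.
Proof.
move=> ue e0; apply: (@squeeze_cvgr _ _ _ _ (fun=> 0) e) => //; last exact: cvg_cst.
by near=> n; rewrite normc_ge0 ue.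
Unshelve. all: by end_near. Qed.

Lemma ccvgD u v l m : ccvg u l -> ccvg v m -> ccvg (fun n => u n + v n) (l + m).
Proof.
move=> ul vm; apply: (@ccvg_squeeze _ _ (fun n => normc (u n - l) + normc (v n - m))).
  by move=> n; rewrite opprD addrACA; apply: le_normcD.
by rewrite -[X in _ --> X](addr0 0); apply: cvgD.
Qed.

Lemma ccvgZ u l (z : R[i]) : ccvg u l -> ccvg (fun n => z * u n) (z * l).
Proof.
move=> ul; apply: (@ccvg_squeeze _ _ (fun n => normc z * normc (u n - l))).
  by move=> n; rewrite -mulrBr normcM.
by rewrite -[X in _ --> X](mulr0 (normc z)); apply: cvgMc.
Qed.

Lemma ccvg_ext u v l : u =1 v -> ccvg u l -> ccvg v l.
Proof. by move=> /funext ->. Qed.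

Lemma ccvg_unique u l m : ccvg u l -> ccvg u m -> l = m.
Proof.
move=> ul um; apply/eqP; rewrite -subr_eq0; apply/eqP/eq0_normc.
apply/eqP; rewrite eq_le normc_ge0 andbT.
have h : normc (u n - l) + normc (u n - m) @[n --> \oo] --> 0.
  by rewrite -[X in _ --> X](addr0 0); apply: cvgD.
apply: (cvgr_to_ge h); near=> n.
have -> : l - m = (u n - m) - (u n - l) by ring.
by rewrite addrC; apply: le_trans (le_normcD _ _) _; rewrite normcN addrC.
Unshelve. all: by end_near. Qed.

Lemma ccvg_complex_topology u l :
  ccvg u l <-> (u : nat -> R[i]^o) @ \oo --> (l : R[i]^o).
Proof.
split => [ul|/cvgrPdist_lt ul].
  apply/cvgrPdist_lt => e; rewrite ltcE /= => /andP[/eqP e2 e1].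
  have /cvgrPdist_lt/(_ _ e1) := ul; apply: filterS => n.
  rewrite sub0r normrN ger0_norm ?normc_ge0// distrC normr_normc ltcE /=.
  by rewrite -e2 eqxx.
apply/cvgrPdist_lt => e e0.
have /ul : (0 : R[i]) < e%:C by rewrite ltcE /= eqxx.
apply: filterS => n; rewrite distrC normr_normc ltcR sub0r normrN.
by rewrite ger0_norm ?normc_ge0.
Qed.

(** Convergence at t = 1 bounds all coefficients by some C. If those before k vanish, then |a_k| t^k
    is at most the tail C (t^(k+1) + t^(k+2) + ...), which is at most 2 C t^(k+1) for t <= 1/2; now
    let t tend to 0. *)
Lemma power_series_eq0 (a : nat -> R[i]) :
  (forall t : R, ccvg (fun N => \sum_(n < N) a n * t%:C ^+ n) 0) -> forall k, a k = 0.
Proof.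
move=> a0; have [C aC] : exists C, forall n, normc (a n) <= C.
  have S1 := a0 1.
  have b : bounded_near id (normc (\sum_(n < N) a n * 1%:C ^+ n - 0) @[N --> \oo]).
    by apply: cvg_bounded; apply: cvgP S1.
  have [C [_ hC]] : bounded_fun (fun N => normc (\sum_(n < N) a n * 1%:C ^+ n - 0)).
    by apply: cvg_seq_bounded; apply: cvgP S1.
  have hC' N : normc (\sum_(n < N) a n) <= C + 1.
    have /(_ N I) := hC (C + 1) (ltr_pwDr ltr01 (lexx C)).
    rewrite /= ger0_norm ?normc_ge0// subr0.
    by under eq_bigr do rewrite expr1n mulr1.
  exists (C + 1 + (C + 1)) => n.
  have -> : a n = \sum_(i < n.+1) a i - \sum_(i < n) a i.
    by rewrite big_ord_recr /= addrC addrK.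
  by apply: le_trans (le_normcD _ _) _; rewrite normcN; apply: lerD.
have C0 : 0 <= C by apply: le_trans (normc_ge0 _) (aC 0).
elim/ltn_ind => k IH.
have key (t : R) : 0 < t -> t <= 1 / 2 -> normc (a k) <= 2 * C * t.
  move=> t0 t2.
  (* A telescoping bound for the geometric tail: t <= 1/2 gives t^j <= 2 t^j - 2 t^(j+1). *)
  have bnd m : normc (\sum_(n < k.+1 + m) a n * t%:C ^+ n - a k * t%:C ^+ k)
      <= C * (2 * t ^+ k.+1 - 2 * t ^+ (k.+1 + m)).
    elim: m => [|m IHm].
      rewrite addn0 subrr mulr0 big_ord_recr /= big1 ?add0r ?subrr ?normc0//.
      by move=> i _; rewrite IH ?mul0r.
    rewrite addnS big_ord_recr /= addrAC.
    apply: le_trans (le_normcD _ _) _.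
    rewrite [normc (_ * _)]normcM normcX normc_real (ger0_norm (ltW t0)).
    apply: (@le_trans _ _ (C * (2 * t ^+ k.+1 - 2 * t ^+ (k.+1 + m)) + C * t ^+ (k.+1 + m))).
      by apply: lerD => //; rewrite ler_wpM2r// exprn_ge0// ltW.
    rewrite [X in _ <= C * (_ - _ * X)]exprS -mulrDr ler_wpM2l// -addrA lerD2l.
    have : 0 <= t ^+ (k.+1 + m) by rewrite exprn_ge0// ltW.
    by move: (t ^+ _) => q q0; nra.
  have lim : normc (a k * t%:C ^+ k) <= 2 * C * t ^+ k.+1.
    have h : 2 * C * t ^+ k.+1 + normc (\sum_(n < N) a n * t%:C ^+ n - 0) @[N --> \oo]
        --> 2 * C * t ^+ k.+1.
      by rewrite -[X in _ --> X]addr0; apply: cvgD; [apply: cvg_cst|apply: a0].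
    apply: (cvgr_to_ge h); near=> N.
    have kN : (k.+1 <= N)%N by near: N; apply: nbhs_infty_ge.
    have -> : a k * t%:C ^+ k = - (\sum_(n < N) a n * t%:C ^+ n - a k * t%:C ^+ k)
      + (\sum_(n < N) a n * t%:C ^+ n - 0) by ring.
    apply: le_trans (le_normcD _ _) _; rewrite normcN; apply: lerD => //.
    have := bnd (N - k.+1)%N; rewrite subnKC// => /le_trans; apply.
    rewrite [2 * C]mulrC -mulrA ler_wpM2l// gerBl mulr_ge0// exprn_ge0// ltW//.
  move: lim; rewrite normcM normcX normc_real (ger0_norm (ltW t0)).
  by rewrite exprS mulrA ler_pM2r// exprn_gt0.
apply: eq0_normc; apply/eqP; rewrite eq_le normc_ge0 andbT.
apply/ler_addgt0Pl => e e0; rewrite addr0.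
pose t := Num.min (1 / 2) (e / (2 * C + 1)).
have C1 : 0 < 2 * C + 1 by rewrite ltr_wpDl// mulr_ge0.
have t0 : 0 < t by rewrite lt_min; apply/andP; split; apply: divr_gt0.
apply: le_trans (key t t0 _) _; first by rewrite ge_min lexx.
apply: (@le_trans _ _ ((2 * C + 1) * (e / (2 * C + 1)))).
  apply: ler_pM; rewrite ?mulr_ge0 ?(ltW t0)//.
    by rewrite lerDl.
  by rewrite /t ge_min lexx orbT.
by rewrite mulrC divfK// gt_eqF.
Unshelve. all: by end_near. Qed.

Lemma power_series_unique (a b : nat -> R[i]) (f : R -> R[i]) :
  (forall t : R, ccvg (fun N => \sum_(n < N) a n * t%:C ^+ n) (f t)) ->
  (forall t : R, ccvg (fun N => \sum_(n < N) b n * t%:C ^+ n) (f t)) -> a =1 b.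
Proof.
move=> af bf k; apply/eqP; rewrite -subr_eq0; apply/eqP.
apply: (@power_series_eq0 (fun k => a k - b k)) => t.
have := ccvgD (af t) (ccvgZ (-1) (bf t)); rewrite mulN1r subrr.
apply: ccvg_ext => N; rewrite mulN1r -sumrB.
by apply: eq_bigr => i _; rewrite mulrBl.
Qed.

Lemma hcoefZ (a x s : R[i]) n : hcoef (a * x) (a ^+ 2 * s) n = hcoef x s n * a ^+ n.
Proof. by rewrite /hcoef hermiteZ mulrCA mulrC. Qed.

Lemma hcoef_series (x s : R[i]) : ccvg (fun N => \sum_(n < N) hcoef x s n) (cexp (x - s / 2)).
Proof. exact: hermite_gen. Qed.

Lemma hcoef_tseries (x s : R[i]) (t : R[i]) :
  ccvg (fun N => \sum_(n < N) hcoef x s n * t ^+ n) (cexp (t * x - t ^+ 2 * s / 2)).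
Proof.
apply: ccvg_ext (hcoef_series (t * x) (t ^+ 2 * s)) => N.
by apply: eq_bigr => n _; rewrite hcoefZ.
Qed.

End complex_sequences.

(** * Analytic continuation of exponential means *)

Section exponential_integrability.
Context d (T : measurableType d) (R : realType) (P : probability T R).
Implicit Types (X Y : T -> R[i]).

(** [Y] acts as a complex density under which [X] has all exponential moments, so that the mean of
    [Y * cexp (z * X)] is an entire function of z. *)
Definition exp_integrable X Y : Prop := [/\ cmeasurable X, cmeasurable Y &
  forall r : R, P.-integrable setT (EFin \o (fun x => normc (Y x) * expR (r * normc (X x))))].

Lemma exp_integrable_scale X Y (z : R[i]) :
  exp_integrable X Y -> exp_integrable (fun x => z * X x) Y.
Proof.
move=> [mX mY iXY]; split => //; first by apply: cmeasM => //; apply: cmeas_cst.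
by move=> r; have := iXY (r * normc z); congr (P.-integrable _ _);
  apply/funext => x /=; rewrite normcM mulrA.
Qed.

Section series.
Variables (X Y : T -> R[i]).
Hypothesis iXY : exp_integrable X Y.

Let hermite_partial (s : R[i]) N x :
  normc (\sum_(n < N) hcoef (X x) s n) <= expR (normc s / 2) * expR (1 * normc (X x)).
Proof.
rewrite mul1r -expRD addrC.
apply: le_trans (hermite_gen_real (normc_ge0 (X x)) (normc_ge0 s) N).
apply: le_trans (normc_sum _ _ _) _; apply: ler_sum => n _.
rewrite /hcoef normcM normcV normc_nat.
by rewrite ler_wpM2l ?invr_ge0// normc_hermite.
Qed.

Let dom (c r : R) : P.-integrable setT
  (EFin \o (fun x => c * (normc (Y x) * expR (r * normc (X x))))).
Proof.
have [_ _ iY] := iXY.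
apply: (@integrableZl _ _ _ P setT measurableT c
  (fun x => (normc (Y x) * expR (r * normc (X x)))%:E)).
exact: iY.
Qed.

Lemma cintegrable_hermite (s : R[i]) n : cintegrable P (fun x => Y x * hermite (X x) s n).
Proof.
have [mX mY _] := iXY.
apply: (cintegrable_dom (g := fun x =>
  (2 * n`!%:R * expR (normc s / 2)) * (normc (Y x) * expR (1 * normc (X x))))) => //.
  by apply: cmeasM => //; apply: cmeas_hermite.
move=> x; rewrite normcM mulrCA ler_wpM2l ?normc_ge0//.
(* A single term is a difference of two partial sums, both under the same exponential bound. *)
have -> : hermite (X x) s n = n`!%:R *
   (\sum_(i < n.+1) hcoef (X x) s i - \sum_(i < n) hcoef (X x) s i).
  rewrite big_ord_recr /= [X in X - _]addrC addrK /hcoef mulrA mulfV ?mul1r//.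
rewrite normcM normc_nat -[2 * _]mulrC -!mulrA ler_wpM2l//.
apply: le_trans (le_normcD _ _) _; rewrite normcN mulr_natl mulr2n.
by apply: lerD; apply: hermite_partial.
Qed.

Lemma cintegrable_cexp (z : R[i]) : cintegrable P (fun x => Y x * cexp (z * X x)).
Proof.
have [mX mY iY] := iXY.
apply: (cintegrable_dom (g := fun x => normc (Y x) * expR (normc z * normc (X x)))) => //.
  by apply: cmeasM => //; apply: cmeas_cexp; apply: cmeasM => //; apply: cmeas_cst.
move=> x; rewrite normcM ler_wpM2l ?normc_ge0//.
rewrite normc_cexp ler_expR -normcM.
exact: le_trans (ler_norm _) (Re_le_normc _).
Qed.

Lemma cintegral_hermite_series (s : R[i]) :
  ccvg (fun N => \sum_(n < N) (n`!%:R)^-1 * cintegral P (fun x => Y x * hermite (X x) s n))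
       (cintegral P (fun x => Y x * cexp (X x - s / 2))).
Proof.
have [mX mY iY] := iXY.
have mh N : cmeasurable (fun x => \sum_(n < N) hcoef (X x) s n).
  by apply: cmeas_sum => n _; apply: cmeasM; [apply: cmeas_cst|apply: cmeas_hermite].
have := @dominated_cintegral _ _ _ P (fun N x => Y x * \sum_(n < N) hcoef (X x) s n)
  (fun x => Y x * cexp (X x - s / 2))
  (fun x => expR (normc s / 2) * (normc (Y x) * expR (1 * normc (X x)))).
have E N : cintegral P (fun x => Y x * \sum_(n < N) hcoef (X x) s n)
   = \sum_(n < N) (n`!%:R)^-1 * cintegral P (fun x => Y x * hermite (X x) s n).
  under eq_bigr => n _ do rewrite -(cintegralZ _ (cintegrable_hermite s n)).
  rewrite -cintegral_sum => [|n _]; last by apply: cintegrableZ; apply: cintegrable_hermite.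
  congr cintegral; apply/funext => x; rewrite mulr_sumr.
  by apply: eq_bigr => n _; rewrite mulrCA.
move=> H; apply: ccvg_ext E (H _ _ _ _ _) => //.
- by move=> N; apply: cmeasM.
- apply: cmeasM => //; apply: cmeas_cexp; apply: cmeasB => //; exact: cmeas_cst.
- by move=> x; apply: (ccvgZ (Y x) (hcoef_series (X x) s)).
- move=> N x; rewrite normcM mulrCA.
  by rewrite ler_wpM2l ?normc_ge0.
Qed.

End series.

Section extension.
Variables (X Y : T -> R[i]) (C a b : R[i]).
Hypotheses (iXY : exp_integrable X Y)
  (EXY : forall t : R, cintegral P (fun x => Y x * cexp (t%:C * X x))
                       = C * cexp (t%:C * a - t%:C ^+ 2 * b / 2)).

(** The hypothesis equates two generating functions in a real t. Multiplying both by exp(- t^2 s /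
    2) shifts the Hermite parameter by [s], and uniqueness of power series compares degree by
    degree. *)
Lemma cintegral_hermite (s : R[i]) n :
  cintegral P (fun x => Y x * hermite (X x) s n) = C * hermite a (b + s) n.
Proof.
have fn0 : (n`!%:R : R[i])^-1 != 0 by rewrite invr_eq0 pnatr_eq0 -lt0n fact_gt0.
apply: (mulfI fn0); move: n {fn0}.
apply: (power_series_unique (f := fun t => C * cexp (t%:C * a - t%:C ^+ 2 * (b + s) / 2))) => t.
  have := cintegral_hermite_series (exp_integrable_scale t%:C iXY) (t%:C ^+ 2 * s).
  have -> : cintegral P (fun x => Y x * cexp (t%:C * X x - t%:C ^+ 2 * s / 2))
     = C * cexp (t%:C * a - t%:C ^+ 2 * (b + s) / 2).
    have -> : t%:C * a - t%:C ^+ 2 * (b + s) / 2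
       = - (t%:C ^+ 2 * s / 2) + (t%:C * a - t%:C ^+ 2 * b / 2) by field.
    rewrite cexpD mulrCA -EXY -cintegralZ; last exact: cintegrable_cexp.
    by congr cintegral; apply/funext => x; rewrite addrC cexpD mulrCA.
  apply: ccvg_ext => N; apply: eq_bigr => n _.
  have -> : cintegral P (fun x => Y x * hermite (t%:C * X x) (t%:C ^+ 2 * s) n)
     = t%:C ^+ n * cintegral P (fun x => Y x * hermite (X x) s n).
    rewrite -cintegralZ; last exact: cintegrable_hermite.
    by congr cintegral; apply/funext => x; rewrite hermiteZ mulrCA.
  by ring.
have := ccvgZ C (hcoef_tseries a (b + s) t%:C).
apply: ccvg_ext => N; rewrite mulr_sumr; apply: eq_bigr => n _.
by rewrite /hcoef mulrA mulrCA.
Qed.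

(** Continuation from real t to complex z: the Hermite means at parameter 0, that is the moments,
    are already known from real t, and they sum to both sides. *)
Lemma cintegral_cexp_ext (z : R[i]) :
  cintegral P (fun x => Y x * cexp (z * X x)) = C * cexp (z * a - z ^+ 2 * b / 2).
Proof.
have := cintegral_hermite_series (exp_integrable_scale z iXY) 0.
have -> : cintegral P (fun x => Y x * cexp (z * X x - 0 / 2))
   = cintegral P (fun x => Y x * cexp (z * X x)) 
  by congr cintegral; apply/funext => x; rewrite mul0r subr0.
move=> /ccvg_unique; apply.
have := ccvgZ C (hcoef_tseries a b z).
apply: ccvg_ext => N; rewrite mulr_sumr; apply: eq_bigr => n _.
have -> : cintegral P (fun x => Y x * hermite (z * X x) 0 n) = z ^+ n * (C * hermite a b n).
  rewrite -{1}[b]addr0 -(cintegral_hermite 0 n) -cintegralZ; last exact: cintegrable_hermite.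
  congr cintegral; apply/funext => x.
  by rewrite -[X in hermite _ X](mulr0 (z ^+ 2)) hermiteZ mulrCA.
by rewrite /hcoef; ring.
Qed.

End extension.

End exponential_integrability.

(** * The normal law and Gaussian families *)

Section normal_law.
Variable R : realType.
Local Notation leb := (@lebesgue_measure R).

(** The Radon-Nikodym derivative of the normal law agrees almost everywhere with the density,
    because both have the same integral over every measurable set. *)
Lemma integral_normal_prob_ge0 (m s : R) (f : R -> \bar R) :
  (forall x, (0 <= f x)%E) -> measurable_fun setT f ->
  (\int[normal_prob m s]_x f x = \int[leb]_x (f x * (normal_pdf m s x)%:E))%E.
Proof.
move=> f0 mf; have dom := normal_prob_dominates m s.
rewrite -(Radon_Nikodym_SigmaFinite.change_of_variables dom)//.
apply: ae_eq_integral => //.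
- apply: emeasurable_funM => //.
  exact: measurable_int (Radon_Nikodym_SigmaFinite.f_integrable dom).
- apply: emeasurable_funM => //.
  by apply/measurable_EFinP; apply: measurable_normal_pdf.
- apply: ae_eqe_mul2l; apply: integral_ae_eq => //.
  + exact: Radon_Nikodym_SigmaFinite.f_integrable.
  + by apply/measurable_EFinP; apply: measurable_normal_pdf.
  + by move=> E _ mE; rewrite -Radon_Nikodym_SigmaFinite.f_integral.
Qed.

Definition gauss : probability (measurableTypeR R) R := normal_prob (0 : R) 1.

Lemma integral_gauss_exp (c z : R) : c < 1 ->
  (\int[gauss]_x (expR (c / 2 * x ^+ 2 + z * x))%:E)%E =
  ((Num.sqrt (1 - c))^-1 * expR (z ^+ 2 / (1 - c) / 2))%:E.
Proof.
move=> c1; have c0 : 0 < 1 - c by rewrite subr_gt0.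
have sc0 : 0 < Num.sqrt (1 - c) by rewrite sqrtr_gt0.
have mE : measurable_fun setT (fun x : R => expR (c / 2 * x ^+ 2 + z * x)).
  apply: (measurableT_comp (@measurable_expR R)).
  by apply: measurable_funD; apply: measurable_funM.
rewrite integral_normal_prob_ge0//; last exact/measurable_EFinP.
pose K := (Num.sqrt (1 - c))^-1 * expR (z ^+ 2 / (1 - c) / 2).
(* Completing the square: the integrand times the standard density is [K] times the normal density
   of mean [m] and standard deviation [s]. *)
rewrite -/K; pose m := z / (1 - c); pose s := (Num.sqrt (1 - c))^-1.
have s0 : s != 0 by rewrite invr_eq0 gt_eqF.
have E x : expR (c / 2 * x ^+ 2 + z * x) * normal_pdf 0 1 x = K * normal_pdf m s x.
  have s2 : s ^+ 2 = (1 - c)^-1 by rewrite /s exprVn sqr_sqrtr// ltW.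
  rewrite !normal_pdfE ?oner_eq0// /normal_peak /normal_fun /K.
  have -> : Num.sqrt (s ^+ 2 * pi *+ 2) = s * Num.sqrt (1 ^+ 2 * pi *+ 2).
    by rewrite expr1n mul1r -mulrnAr sqrtrM ?sqr_ge0// sqrtr_sqr ger0_norm// invr_ge0 ltW.
  rewrite s2 [in RHS]invfM invrK [in LHS]mulrCA -expRD.
  rewrite [RHS]mulrACA mulKf ?gt_eqF//.
  rewrite -expRD; congr (_ * expR _).
  by rewrite /m; field; rewrite gt_eqF.
under eq_integral do rewrite -EFinM E EFinM.
by rewrite integralZl ?integral_normal_pdf ?mule1//; apply: integrable_normal_pdf.
Qed.

Lemma expR_norm_le (r x : R) : expR (r * `|x|) <= expR (r * x) + expR (- r * x).
Proof.
have [x0|x0] := ler0P x; first by rewrite mulrN -mulNr lerDr expR_ge0.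
by rewrite lerDl expR_ge0.
Qed.

Lemma integrable_gauss_exp (c r : R) : c < 1 ->
  gauss.-integrable setT (EFin \o (fun x : R => expR (c / 2 * x ^+ 2) * expR (r * `|x|))).
Proof.
move=> c1.
have mE z : measurable_fun setT (fun x : R => expR (c / 2 * x ^+ 2 + z * x)).
  apply: (measurableT_comp (@measurable_expR R)).
  by apply: measurable_funD; apply: measurable_funM.
have iz z : gauss.-integrable setT (EFin \o (fun x : R => expR (c / 2 * x ^+ 2 + z * x))).
  apply: (integrable_of_le (c := (Num.sqrt (1 - c))^-1 * expR (z ^+ 2 / (1 - c) / 2))) => //.
    exact: mE.
  by rewrite integral_gauss_exp.
apply: (@dominated_integrable _ _ _ gauss _ (fun x : R => expR (c / 2 * x ^+ 2 + r * x)
   + expR (c / 2 * x ^+ 2 + (- r) * x))).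
- apply: measurable_funM; apply: (measurableT_comp (@measurable_expR R)).
    by apply: measurable_funM.
  apply: measurable_funM => //; exact: measurableT_comp.
- exact: (@integrableD _ _ _ gauss setT measurableT _ _ (iz r) (iz (- r))).
- move=> x; rewrite ger0_norm ?mulr_ge0 ?expR_ge0// !expRD -mulrDr.
  by rewrite ler_wpM2l ?expR_ge0// expR_norm_le.
Qed.

Lemma gauss_exp_integrable (c : R) : c < 1 ->
  exp_integrable gauss (fun x : R => x%:C) (fun x : R => (expR (c / 2 * x ^+ 2))%:C).
Proof.
move=> c1; split; [exact: cmeas_real|apply: cmeas_real|].
  by apply: (measurableT_comp (@measurable_expR R)); apply: measurable_funM.
move=> r; have := integrable_gauss_exp r c1.
congr (gauss.-integrable _ _); apply/funext => x.
by rewrite /comp !normc_real (ger0_norm (expR_ge0 _)).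
Qed.

(** The real case is a completed square; complex z is reached by continuation with the density exp(c
    x^2 / 2), for which a = 0 and b = - 1 / (1 - c). *)
Lemma gauss_quad (c : R) (z : R[i]) : c < 1 ->
  cintegrable gauss (fun x : R => cexp ((c / 2 * x ^+ 2)%:C + z * x%:C)) /\
  cintegral gauss (fun x : R => cexp ((c / 2 * x ^+ 2)%:C + z * x%:C))
  = ((Num.sqrt (1 - c))^-1)%:C * cexp (z ^+ 2 / (1 - c)%:C / 2).
Proof.
move=> c1; have c0 : 1 - c != 0 by rewrite gt_eqF// subr_gt0.
have E : (fun x : R => cexp ((c / 2 * x ^+ 2)%:C + z * x%:C))
   = (fun x : R => (expR (c / 2 * x ^+ 2))%:C * cexp (z * x%:C)).
  by apply/funext => x; rewrite cexpD cexp_real.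
rewrite E; split; first exact: cintegrable_cexp (gauss_exp_integrable c1) z.
have := cintegral_cexp_ext (C := ((Num.sqrt (1 - c))^-1)%:C) (a := 0)
   (b := (- (1 - c)^-1)%:C) (gauss_exp_integrable c1).
move=> -> => [|t].
  congr (_ * cexp _); rewrite mulr0 sub0r rmorphN /= fmorphV.
  by rewrite mulrN mulNr opprK.
have -> : (fun x : R => (expR (c / 2 * x ^+ 2))%:C * cexp (t%:C * x%:C))
   = (fun x : R => (expR (c / 2 * x ^+ 2 + t * x))%:C).
  by apply/funext => x; rewrite -rmorphM cexp_real -rmorphM -expRD.
rewrite cintegral_real /Rintegral integral_gauss_exp//= rmorphM /=; congr (_ * _).
rewrite mulr0 sub0r -cexp_real; congr cexp.
rewrite !(rmorphXn, rmorphM, rmorphN) /= !fmorphV rmorph_nat.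
by rewrite mulrN mulNr opprK.
Qed.

Lemma gauss_cexp (z : R[i]) :
  cintegrable gauss (fun x : R => cexp (z * x%:C)) /\
  cintegral gauss (fun x : R => cexp (z * x%:C)) = cexp (z ^+ 2 / 2).
Proof.
have := gauss_quad z ltr01.
rewrite subr0 sqrtr1 invr1 mul1r divr1.
have -> // : (fun x : R => cexp ((0 / 2 * x ^+ 2)%:C + z * x%:C)) = (fun x : R => cexp (z * x%:C)).
by apply/funext => x; rewrite !mul0r add0r.
Qed.

End normal_law.

(** * Exponential moments from the characteristic function *)

Section standard_normal_variable.
Context d (T : measurableType d) (R : realType) (P : probability T R).
Variable X : T -> R.
Hypothesis mX : measurable_fun setT X.
Hypothesis charX : forall t : R,
  cintegral P (fun x => cexp ('i%C * t%:C * (X x)%:C)) = cexp (- (t ^+ 2 / 2)%:C).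

Lemma cmeas_expi_gauss : cmeasurable (fun z : T * measurableTypeR R =>
  cexp ('i%C * (z.2 : R)%:C * (X z.1)%:C)).
Proof.
apply: cmeas_cexp; apply: cmeasM; last first.
  by apply: cmeas_real; apply: measurableT_comp mX _; apply: measurable_fst.
by apply: cmeasM; [exact: cmeas_cst|apply: cmeas_real; apply: measurable_snd].
Qed.

(* A Gaussian bump is a superposition of characters of [X]. *)
Lemma integral_gauss_bump (y : R) :
  \int[P]_x expR (- (X x - y) ^+ 2 / 2) = (Num.sqrt 2)^-1 * expR (- y ^+ 2 / 4).
Proof.
pose F (z : T * measurableTypeR R) := cexp ('i%C * (z.2 : R)%:C * (X z.1)%:C)
   * cexp (- 'i%C * y%:C * (z.2 : R)%:C).
have mF : cmeasurable F.
  apply: cmeasM; first exact: cmeas_expi_gauss.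
  apply: cmeas_cexp; apply: cmeasM; first exact: cmeas_cst.
  by apply: cmeas_real; apply: measurable_snd.
have Fn z : normc (F z) = 1.
  rewrite /F -cexpD normc_cexp -[RHS]expR0; congr expR.
  by rewrite ReD !ReM /=; ring.
have Re1 (z : R[i]) (a : R) : z = a%:C -> a = Re z by move=> ->.
apply: complexI; rewrite -cintegral_real.
have [_ EF] : cintegrable P (fun x => cintegral (gauss R) (fun y => F (x, y))) /\
  cintegral P (fun x => cintegral (gauss R) (fun y => F (x, y))) =
  cintegral (gauss R) (fun y => cintegral P (fun x => F (x, y))).
  apply: (@cFubini _ _ _ _ _ P (gauss R) F (fun=> 1)) => //.
  - by move=> x; under eq_integral do rewrite Fn; rewrite integral_cst// mul1e probability_le1.
  - exact: finite_measure_integrable_cst.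
  - move=> e; apply: (@cintegrable_dom _ _ _ _ _ (fun=> 1)).
    + exact: cmeas_pair1.
    + exact: finite_measure_integrable_cst.
    + by move=> x; rewrite Fn.
have -> : (fun x => (expR (- (X x - y) ^+ 2 / 2))%:C)
  = (fun x => cintegral (gauss R) (fun y => F (x, y))).
  apply/funext => x; rewrite /F /=.
  have -> : (fun e : R => cexp ('i%C * e%:C * (X x)%:C) * cexp (- 'i%C * y%:C * e%:C))
    = (fun e : R => cexp (('i%C * (X x - y)%:C) * e%:C)).
    by apply/funext => e; rewrite -cexpD rmorphB; congr cexp; ring.
  rewrite (gauss_cexp _).2 -cexp_real; congr cexp.
  rewrite exprMn sqr_i mulN1r !rmorphM rmorphN rmorphXn /= fmorphV rmorph_nat.
  by rewrite mulNr.
rewrite EF.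
have -> : (fun e : R => cintegral P (fun x => F (x, e)))
  = (fun e : R => cexp ((- 1 / 2 * e ^+ 2)%:C + (- 'i%C * y%:C) * e%:C)).
  apply/funext => e; rewrite /F /=.
  have -> : (fun x => cexp ('i%C * e%:C * (X x)%:C) * cexp (- 'i%C * y%:C * e%:C))
    = (fun x => cexp (- 'i%C * y%:C * e%:C) * cexp ('i%C * e%:C * (X x)%:C)).
    by apply/funext => x; rewrite mulrC.
  rewrite cintegralZ; last first.
    apply: (@cintegrable_dom _ _ _ _ _ (fun=> 1)).
    + exact: (cmeas_pair1 e cmeas_expi_gauss).
    + exact: finite_measure_integrable_cst.
    + move=> x; rewrite normc_cexp -expR0 ler_expR.
      by rewrite !ReM /=; lra.
  rewrite charX mulrC cexpD; congr (cexp _ * _).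
  by rewrite -rmorphN; congr (_%:C); field.
rewrite (gauss_quad _ _).2 ?(lt_trans _ ltr01)// ?oppr_lt0//.
rewrite rmorphM /= -cexp_real; congr ((Num.sqrt _)^-1%:C * cexp _); first by rewrite opprK.
rewrite !exprMn sqrrN sqr_i mulN1r opprK.
have -> : (1 + 1 : R) = 2 by [].
rewrite !(rmorphXn, rmorphM, rmorphN) /= !fmorphV !rmorph_nat.
by field.
Qed.

(** The characteristic function gives means of bounded functions only. To reach exp(X^2 / 6), it is
    written as a positive mixture of Gaussian bumps in X, whose means are known; Tonelli's theorem
    needs no integrability in advance. Then r |X| <= 3 r^2 / 2 + X^2 / 6. *)
Lemma integrable_exp_std_normal (r : R) :
  P.-integrable setT (EFin \o (fun x => expR (r * `|X x|))).
Proof.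
(* The weight exp(g y^2) on the bumps must have g > 1/2 for the mixture to grow in X, and g < 3/4
   for the mean, proportional to exp((g - 1/4) y^2), to be integrable against [gauss]; 5/8 is the
   midpoint. *)
pose f (z : T * measurableTypeR R) :=
  (expR (5 / 8 * (z.2 : R) ^+ 2) * expR (- (X z.1 - z.2) ^+ 2 / 2))%:E.
have mf : measurable_fun setT f.
  apply/measurable_EFinP; apply: measurable_funM; apply: (measurableT_comp (@measurable_expR R)).
    apply: measurable_funM => //; apply: measurable_funX; exact: measurable_snd.
  apply: measurable_funM => //; apply: (measurableT_comp (@oppr_measurable R setT)) => //.
  apply: measurable_funX; apply: measurable_funB; last exact: measurable_snd.
  by apply: measurableT_comp mX _; apply: measurable_fst.
have f0 z : (0 <= f z)%E by rewrite lee_fin mulr_ge0 ?expR_ge0.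
pose K : R := (Num.sqrt (1 - 1 / 4))^-1.
have K0 : 0 < K by rewrite invr_gt0 sqrtr_gt0; lra.
have L x : (\int[gauss R]_y f (x, y))%E = (K * expR (X x ^+ 2 / 6))%:E.
  under eq_integral => y _.
    rewrite /f /= -expRD.
    rewrite (_ : _ + _ = - (X x ^+ 2 / 2) + ((1 / 4) / 2 * y ^+ 2 + X x * y)); last by field.
    rewrite expRD EFinM; over.
  rewrite ge0_integralZl ?lee_fin ?expR_ge0//; last first.
    apply/measurable_EFinP; apply: (measurableT_comp (@measurable_expR R)).
    by apply: measurable_funD; apply: measurable_funM.
  rewrite integral_gauss_exp; last by lra.
  by rewrite -EFinM -/K mulrCA -expRD; congr ((_ * expR _)%:E); field.
have fub := @fubini_tonelli _ _ _ _ _ P (gauss R) f mf f0.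
pose C : R := (Num.sqrt 2)^-1 * (Num.sqrt (1 - 3 / 4))^-1 * expR (0 ^+ 2 / (1 - 3 / 4) / 2).
have R1 : (\int[gauss R]_y \int[P]_x f (x, y))%E = C%:E.
  have inner (y : R) : (\int[P]_x f (x, y))%E =
      ((Num.sqrt 2)^-1%:E * (expR (3 / 4 / 2 * y ^+ 2 + 0 * y))%:E)%E.
    rewrite /f /=.
    have ib : P.-integrable setT (EFin \o (fun x => expR (- (X x - y) ^+ 2 / 2))).
      apply: (@dominated_integrable _ _ _ _ _ (fun=> 1)).
      - apply: (measurableT_comp (@measurable_expR R)); apply: measurable_funM => //.
        apply: (measurableT_comp (@oppr_measurable R setT)) => //.
        by apply: measurable_funX; apply: measurable_funB.
      - exact: finite_measure_integrable_cst.
      - move=> x; rewrite ger0_norm ?expR_ge0// -expR0 ler_expR mulNr oppr_le0.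
        by rewrite divr_ge0 ?sqr_ge0.
    under eq_integral do rewrite EFinM.
    rewrite integralZl//.
    rewrite -(fineK (integrable_fin_num measurableT ib)).
    rewrite [X in (_ * X%:E)%E]integral_gauss_bump -!EFinM; congr EFin.
    by rewrite mulrCA -expRD; congr (_ * expR _); field.
  under eq_integral do rewrite inner.
  rewrite ge0_integralZl ?lee_fin ?invr_ge0//; last first.
    apply/measurable_EFinP; apply: (measurableT_comp (@measurable_expR R)).
    by apply: measurable_funD; apply: measurable_funM.
  by rewrite integral_gauss_exp; [rewrite -EFinM mulrA|lra].
have mX2 : measurable_fun setT (fun x => expR (X x ^+ 2 / 6)).
  apply: (measurableT_comp (@measurable_expR R)); apply: measurable_funM => //.
  exact: measurable_funX.
have i6 : P.-integrable setT (EFin \o (fun x => expR (X x ^+ 2 / 6))).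
  apply: (integrable_of_le (c := K^-1 * C)) => //.
  rewrite EFinM -R1 -fub.
  under [X in (_ <= _ * X)%E]eq_integral do rewrite L EFinM.
  rewrite ge0_integralZl ?lee_fin ?(ltW K0)//; last first.
    exact/measurable_EFinP.
  by rewrite muleA -EFinM mulVf ?mul1e// gt_eqF.
apply: (dominated_integrable (g := fun x => expR (3 / 2 * r ^+ 2) * expR (X x ^+ 2 / 6))).
- apply: (measurableT_comp (@measurable_expR R)); apply: measurable_funM => //.
  exact: measurableT_comp.
- exact: (@integrableZl _ _ _ P setT measurableT (expR (3 / 2 * r ^+ 2))
    (fun x => (expR (X x ^+ 2 / 6))%:E)).
- move=> x; rewrite ger0_norm ?expR_ge0// -expRD ler_expR -[X x ^+ 2]real_normK ?num_real//.
  by have := sqr_ge0 (3 * r - `|X x|); nra.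
Qed.

End standard_normal_variable.

(** * Quadratic exponents in one coordinate *)

Section gaussian_step.
Context d (T : measurableType d) (R : realType) (P : probability T R).
Variables (X : T -> R) (Y : T -> R[i]) (y0 : R[i]) (y1 : R).
Hypotheses (mX : measurable_fun setT X) (mY : cmeasurable Y).
Hypothesis intY : forall t : R,
  P.-integrable setT (EFin \o (fun x => normc (Y x) * expR (t * X x))).
Hypothesis EnY : forall t : R,
  \int[P]_x (normc (Y x) * expR (t * X x)) = y1 * expR (t ^+ 2 / 2).
Hypothesis EY : forall z : R[i],
  cintegral P (fun x => Y x * cexp (z * (X x)%:C)) = y0 * cexp (z ^+ 2 / 2).

Let mnY : measurable_fun setT (fun x => normc (Y x)).
Proof. exact: cmeas_normc. Qed.

(** The factor exp(p X^2 / 2) is the mean of exp(w X B) over a normal B, with w^2 = p. By Tonelli's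
    theorem only exponents linear in X remain, and these are covered by [EnY]. *)
Lemma integrable_gaussian_quad (p t : R) : 0 <= p < 1 ->
  P.-integrable setT (EFin \o (fun x => normc (Y x) * expR (p / 2 * X x ^+ 2 + t * X x))).
Proof.
move=> /andP[p0 p1]; pose w := Num.sqrt p.
have w2 : w ^+ 2 = p by rewrite sqr_sqrtr.
pose f (z : T * measurableTypeR R) :=
  (normc (Y z.1) * expR ((t + w * (z.2 : R)) * X z.1))%:E.
have mf : measurable_fun setT f.
  apply/measurable_EFinP; apply: measurable_funM.
    by apply: measurableT_comp mnY _; apply: measurable_fst.
  apply: (measurableT_comp (@measurable_expR R)); apply: measurable_funM.
    apply: measurable_funD => //; apply: measurable_funM => //; exact: measurable_snd.
  by apply: measurableT_comp mX _; apply: measurable_fst.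
have f0 z : (0 <= f z)%E by rewrite lee_fin mulr_ge0 ?expR_ge0 ?normc_ge0.
have fub := @fubini_tonelli _ _ _ _ _ P (gauss R) f mf f0.
have L x : (\int[gauss R]_y f (x, y))%E =
    (normc (Y x) * expR (p / 2 * X x ^+ 2 + t * X x))%:E.
  have e (y : R) : f (x, y) = ((normc (Y x) * expR (t * X x))%:E *
      (expR (0 / 2 * y ^+ 2 + w * X x * y))%:E)%E.
    by rewrite /f /= -EFinM -(mulrA (normc (Y x))) -expRD; congr ((_ * expR _)%:E); field.
  under eq_integral do rewrite e.
  rewrite ge0_integralZl ?lee_fin ?mulr_ge0 ?expR_ge0 ?normc_ge0//; last first.
    apply/measurable_EFinP; apply: (measurableT_comp (@measurable_expR R)).
    by apply: measurable_funD; apply: measurable_funM.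
  rewrite integral_gauss_exp// -EFinM subr0 sqrtr1 invr1 mul1r mulr1 -(mulrA (normc (Y x))) -expRD.
  by rewrite exprMn w2; congr ((_ * expR _)%:E); field.
have Rt (y : R) : (\int[P]_x f (x, y))%E =
    ((y1 * expR (t ^+ 2 / 2))%:E * (expR (p / 2 * y ^+ 2 + t * w * y))%:E)%E.
  rewrite /f -(fineK (integrable_fin_num measurableT (intY (t + w * y)))).
  rewrite [X in X%:E = _](EnY (t + w * y)) -EFinM -(mulrA y1) -expRD; congr ((_ * expR _)%:E).
  by rewrite -w2; field.
have y10 : 0 <= y1.
  have := EnY 0; rewrite expr0n mul0r expR0 mulr1 => <-.
  by apply: Rintegral_ge0 => x _; rewrite mulr_ge0 ?normc_ge0 ?expR_ge0.
apply: (integrable_of_le (c := y1 * expR (t ^+ 2 / 2) *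
   ((Num.sqrt (1 - p))^-1 * expR ((t * w) ^+ 2 / (1 - p) / 2)))).
- apply: measurable_funM => //; apply: (measurableT_comp (@measurable_expR R)).
  by apply: measurable_funD; apply: measurable_funM => //; apply: measurable_funX.
- by move=> x; rewrite mulr_ge0 ?normc_ge0 ?expR_ge0.
- under eq_integral do rewrite -L.
  rewrite fub; under eq_integral do rewrite Rt.
  rewrite ge0_integralZl ?lee_fin ?mulr_ge0 ?expR_ge0//; last first.
    apply/measurable_EFinP; apply: (measurableT_comp (@measurable_expR R)).
    by apply: measurable_funD; apply: measurable_funM.
  by rewrite integral_gauss_exp.
Qed.

Lemma cintegral_gaussian_quad (c : R) (z : R[i]) : c < 1 ->
  cintegrable P (fun x => Y x * cexp ((c / 2 * X x ^+ 2)%:C + z * (X x)%:C)) /\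
  cintegral P (fun x => Y x * cexp ((c / 2 * X x ^+ 2)%:C + z * (X x)%:C))
  = y0 * (((Num.sqrt (1 - c))^-1)%:C * cexp (z ^+ 2 / (1 - c)%:C / 2)).
Proof.
move=> c1; have c0 : (1 - c)%:C != 0 :> R[i].
  by rewrite -[0]/(0%:C) (inj_eq (@complexI R)) gt_eqF// subr_gt0.
pose p := Num.max c 0.
have p01 : 0 <= p < 1 by rewrite le_max lexx orbT gt_max c1 ltr01.
have mC : cmeasurable (fun x => (X x)%:C) by exact: cmeas_real.
have mQ : cmeasurable (fun x => Y x * cexp ((c / 2 * X x ^+ 2)%:C + z * (X x)%:C)).
  apply: cmeasM => //; apply: cmeas_cexp; apply: cmeasD.
    by apply: cmeas_real; apply: measurable_funM => //; apply: measurable_funX.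
  by apply: cmeasM => //; apply: cmeas_cst.
split.
  apply: (cintegrable_dom mQ (integrable_gaussian_quad (Re z) p01)) => x.
  rewrite normcM ler_wpM2l ?normc_ge0// normc_cexp ler_expR.
  rewrite ReD ReM /= mulr0 subr0 lerD2r ler_wpM2r ?sqr_ge0// ler_pM2r//.
  by rewrite le_max lexx.
(* For negative c the root is imaginary and contributes nothing to absolute values; this is why p is
   the maximum of c and 0. *)
have [w [w2 wp]] : exists w : R[i], w ^+ 2 = c%:C /\ Re w ^+ 2 = p.
  have [c_ge0|c_lt0] := leP 0 c.
    exists (Num.sqrt c)%:C; rewrite -rmorphXn /= sqr_sqrtr// /p.
    by split => //; apply/esym/max_idPl.
  exists (0 +i* Num.sqrt (- c)); split.
    apply: complex_eqP; rewrite expr2 ?ReM ?ImM /= !(mul0r, mulr0, addr0)//.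
    by rewrite sub0r -expr2 sqr_sqrtr ?oppr_ge0 ?opprK// ltW.
  by rewrite /= expr0n /p; apply/esym/max_idPr/ltW.
pose F (e : T * measurableTypeR R) :=
  Y e.1 * cexp (z * (X e.1)%:C + w * (X e.1)%:C * (e.2 : R)%:C).
have mX1 : cmeasurable (fun e : T * measurableTypeR R => (X e.1)%:C).
  by apply: cmeas_real; apply: measurableT_comp mX _; apply: measurable_fst.
have mF : cmeasurable F.
  apply: cmeasM.
    by split; [apply: (measurableT_comp mY.1)|apply: (measurableT_comp mY.2)];
      apply: measurable_fst.
  apply: cmeas_cexp; apply: cmeasD; first by apply: cmeasM => //; apply: cmeas_cst.
  apply: cmeasM; first by apply: cmeasM => //; apply: cmeas_cst.
  by apply: cmeas_real; apply: measurable_snd.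
have iX (u : R[i]) : cintegrable P (fun x => Y x * cexp (u * (X x)%:C)).
  apply: (cintegrable_dom _ (intY (Re u))).
    by apply: cmeasM => //; apply: cmeas_cexp; apply: cmeasM => //; apply: cmeas_cst.
  by move=> x; rewrite normcM normc_cexp ReM /= mulr0 subr0.
have [||_ EF] := @cFubini _ _ _ _ _ P (gauss R) F
   (fun x => normc (Y x) * expR (p / 2 * X x ^+ 2 + Re z * X x)) mF _
   (integrable_gaussian_quad (Re z) p01).
- move=> x.
  have e (y : R) : (normc (F (x, y)))%:E = ((normc (Y x) * expR (Re z * X x))%:E *
      (expR (0 / 2 * y ^+ 2 + Re w * X x * y))%:E)%E.
    rewrite /F normcM normc_cexp -EFinM -(mulrA (normc (Y x))) -expRD.
    congr ((_ * expR _)%:E).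
    by rewrite ReD !ReM /=; ring.
  under eq_integral do rewrite e.
  rewrite ge0_integralZl ?lee_fin ?mulr_ge0 ?expR_ge0 ?normc_ge0//; last first.
    apply/measurable_EFinP; apply: (measurableT_comp (@measurable_expR R)).
    by apply: measurable_funD; apply: measurable_funM.
  rewrite integral_gauss_exp// -EFinM subr0 sqrtr1 invr1 mul1r mulr1 -(mulrA (normc (Y x))) -expRD.
  by rewrite exprMn wp lee_fin le_eqVlt; apply/orP; left; apply/eqP; congr (_ * expR _); field.
- move=> y; rewrite /F.
  have -> : (fun x => Y x * cexp (z * (X x)%:C + w * (X x)%:C * y%:C))
    = (fun x => Y x * cexp ((z + w * y%:C) * (X x)%:C)).
    by apply/funext => x; congr (_ * cexp _); ring.
  exact: iX.
have -> : (fun x => Y x * cexp ((c / 2 * X x ^+ 2)%:C + z * (X x)%:C))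
   = (fun x => cintegral (gauss R) (fun y => F (x, y))).
  apply/funext => x; rewrite /F /=.
  have -> : (fun y : R => Y x * cexp (z * (X x)%:C + w * (X x)%:C * y%:C))
    = (fun y : R => (Y x * cexp (z * (X x)%:C)) * cexp (w * (X x)%:C * y%:C)).
    by apply/funext => y; rewrite cexpD mulrA.
  rewrite cintegralZ ?(gauss_cexp _).2; last exact: (gauss_cexp _).1.
  rewrite -(mulrA (Y x)) -cexpD addrC exprMn w2; congr (_ * cexp (_ + _)).
  by rewrite !(rmorphXn, rmorphM) /= fmorphV rmorph_nat; ring.
rewrite EF.
have -> : (fun y : R => cintegral P (fun x => F (x, y))) = (fun y : R =>
   (y0 * cexp (z ^+ 2 / 2)) * cexp ((c / 2 * y ^+ 2)%:C + z * w * y%:C)).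
  apply/funext => y; rewrite /F /=.
  have -> : (fun x => Y x * cexp (z * (X x)%:C + w * (X x)%:C * y%:C))
    = (fun x => Y x * cexp ((z + w * y%:C) * (X x)%:C)).
    by apply/funext => x; congr (_ * cexp _); ring.
  rewrite EY -(mulrA y0) -cexpD; congr (_ * cexp _).
  by rewrite !(rmorphXn, rmorphM) /= fmorphV rmorph_nat -w2; field.
have [iq Eq] := gauss_quad (z * w) c1.
rewrite cintegralZ// Eq -mulrA; congr (_ * _); rewrite mulrCA -cexpD; congr (_ * cexp _).
by rewrite exprMn w2 rmorphB rmorph1; rewrite rmorphB rmorph1 in c0; field.
Qed.

End gaussian_step.

(** * Families of jointly normal variables *)

Section gaussian_family.
Context d (T : measurableType d) (R : realType) (P : probability T R) (I : choiceType).
Variable y : I -> T -> R.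
Hypothesis my : forall a, measurable_fun setT (y a).
Hypothesis chary : forall (s : seq I) (f : I -> R), uniq s ->
  cintegral P (fun x => cexp ('i%C * (\sum_(a <- s) f a * y a x)%:C))
  = cexp (- ((\sum_(a <- s) f a ^+ 2) / 2)%:C).

Lemma integrable_exp_coordinate a (r : R) :
  P.-integrable setT (EFin \o (fun x => expR (r * `|y a x|))).
Proof.
apply: integrable_exp_std_normal => // t.
have := @chary [:: a] (fun=> t) isT.
rewrite big_seq1; under [X in cintegral _ X]eq_fun do rewrite big_seq1.
move=> <-; congr cintegral; apply/funext => x.
by rewrite rmorphM mulrA.
Qed.

(** Since exp(u + v) <= exp(2 u) + exp(2 v), exponential moments of single coordinates suffice, by
    induction on the list with r doubled at each step. *)
Lemma integrable_exp_sum (s : seq I) (r : R) : 0 <= r ->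
  P.-integrable setT (EFin \o (fun x => expR (r * \sum_(a <- s) `|y a x|))).
Proof.
elim: s r => [|a s IH] r r0.
  rewrite (_ : (EFin \o _) = cst 1%E); first exact: finite_measure_integrable_cst.
  by apply/funext => x /=; rewrite big_nil mulr0 expR0.
have r20 : 0 <= 2 * r by rewrite mulr_ge0.
apply: (@dominated_integrable _ _ _ P _
  (fun x => expR (2 * r * `|y a x|) + expR (2 * r * \sum_(a <- s) `|y a x|))).
- apply: (measurableT_comp (@measurable_expR R)); apply: measurable_funM => //.
  by apply: measurable_sum => b; apply: measurableT_comp.
- exact: (@integrableD _ _ _ P setT measurableT _ _
    (integrable_exp_coordinate a (2 * r)) (IH _ r20)).
- move=> x; rewrite ger0_norm ?expR_ge0// big_cons mulrDr expRD.
  have dbl (u : R) : expR (2 * r * u) = expR (r * u) * expR (r * u).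
    by rewrite -expRD; congr expR; ring.
  rewrite !dbl; move: (expR _) (expR _) (expR_ge0 (r * `|y a x|)) (expR_ge0 (r * \sum_(b <- s) `|y b x|)).
  by move=> u v; nra.
Qed.

Lemma sum_mul_le (s : seq I) (f g : I -> R) : (forall a, 0 <= f a) -> (forall a, 0 <= g a) ->
  \sum_(a <- s) f a * g a <= (\sum_(a <- s) f a) * \sum_(a <- s) g a.
Proof.
move=> f0 g0; rewrite mulr_suml; elim: s => [|a s IH]; first by rewrite !big_nil.
rewrite !big_cons; apply: lerD.
  by rewrite ler_wpM2l// lerDl sumr_ge0.
by apply: le_trans IH _; apply: ler_sum => b _; rewrite ler_wpM2l// lerDr.
Qed.

Lemma Re_linear_le (s : seq I) (Q : pred I) (z : I -> R[i]) x :
  Re (\sum_(a <- s | Q a) z a * (y a x)%:C) <=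
  (\sum_(a <- s) normc (z a)) * \sum_(a <- s) `|y a x|.
Proof.
apply: le_trans (ler_norm _) _; apply: le_trans (Re_le_normc _) _.
apply: le_trans (normc_sum _ _ _) _.
apply: (@le_trans _ _ (\sum_(a <- s) normc (z a) * `|y a x|)).
  rewrite big_mkcond; apply: ler_sum => a _; case: (Q a); last by rewrite mulr_ge0 ?normc_ge0.
  by rewrite normcM normc_real.
by apply: sum_mul_le => a //; apply: normc_ge0.
Qed.

Lemma cmeas_linear (s : seq I) (Q : pred I) (z : I -> R[i]) :
  cmeasurable (fun x => \sum_(a <- s | Q a) z a * (y a x)%:C).
Proof.
by apply: cmeas_sum => a _; apply: cmeasM; [apply: cmeas_cst|apply: cmeas_real].
Qed.

Lemma exp_integrable_linear (s : seq I) (Q Q' : pred I) (z z' : I -> R[i]) :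
  exp_integrable P (fun x => \sum_(a <- s | Q' a) z' a * (y a x)%:C)
    (fun x => cexp (\sum_(a <- s | Q a) z a * (y a x)%:C)).
Proof.
split; [exact: cmeas_linear | apply: cmeas_cexp; exact: cmeas_linear |] => r.
pose K := \sum_(a <- s) normc (z a); pose K' := \sum_(a <- s) normc (z' a).
have K0 : 0 <= K by apply: sumr_ge0 => a _; apply: normc_ge0.
have K'0 : 0 <= K' by apply: sumr_ge0 => a _; apply: normc_ge0.
have KK0 : 0 <= K + `|r| * K' by rewrite addr_ge0// mulr_ge0.
apply: (dominated_integrable _ (integrable_exp_sum s KK0)).
  apply: measurable_funM; first by apply/cmeas_normc/cmeas_cexp/cmeas_linear.
  apply: (measurableT_comp (@measurable_expR R)); apply: measurable_funM => //.
  by apply/cmeas_normc/cmeas_linear.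
move=> x; rewrite normc_cexp -expRD ger0_norm ?expR_ge0// ler_expR mulrDl.
apply: lerD; first exact: Re_linear_le.
apply: (@le_trans _ _ (`|r| * normc (\sum_(a <- s | Q' a) z' a * (y a x)%:C))).
  by rewrite ler_wpM2r ?normc_ge0 ?ler_norm.
rewrite -mulrA ler_wpM2l//; apply: le_trans (normc_sum _ _ _) _.
apply: (@le_trans _ _ (\sum_(a <- s) normc (z' a) * `|y a x|)).
  rewrite big_mkcond; apply: ler_sum => a _; case: (Q' a); last by rewrite mulr_ge0 ?normc_ge0.
  by rewrite normcM normc_real.
by apply: sum_mul_le => a //; apply: normc_ge0.
Qed.

Lemma cintegrable_linear (s : seq I) (z : I -> R[i]) :
  cintegrable P (fun x => cexp (\sum_(a <- s) z a * (y a x)%:C)).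
Proof.
have := cintegrable_cexp (exp_integrable_linear s xpredT pred0 z z) 0.
by under eq_fun do rewrite mul0r cexp0 mulr1.
Qed.

(** Purely imaginary coefficients are the case of characteristic functions. The list [q] collects
    the coordinates whose coefficient may have a real part; it grows by one coordinate at a time,
    through continuation in that coefficient from i t with t real, the others being fixed. *)
Lemma gaussian_linear (s : seq I) (z : I -> R[i]) : uniq s ->
  cintegral P (fun x => cexp (\sum_(a <- s) z a * (y a x)%:C))
  = cexp ((\sum_(a <- s) z a ^+ 2) / 2).
Proof.
move=> us.
suff H (q : seq I) : forall z : I -> R[i], (forall a, a \in s -> a \notin q -> Re (z a) = 0) ->
    cintegral P (fun x => cexp (\sum_(a <- s) z a * (y a x)%:C))
    = cexp ((\sum_(a <- s) z a ^+ 2) / 2).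
  by apply: (H s) => a ->.
elim: q => [|a q IH] {}z zq.
  have := chary (fun a => Im (z a)) us.
  have zi b : b \in s -> z b = 'i%C * (Im (z b))%:C.
    by move=> bs; rewrite [LHS]complexE zq// add0r.
  have -> : (fun x => cexp ('i%C * (\sum_(a <- s) Im (z a) * y a x)%:C))
    = (fun x => cexp (\sum_(a <- s) z a * (y a x)%:C)).
    apply/funext => x; congr cexp; rewrite rmorph_sum mulr_sumr.
    by apply: eq_big_seq => b bs; rewrite rmorphM mulrA -zi.
  move=> ->; congr cexp; rewrite rmorphM /= fmorphV rmorph_nat -mulNr; congr (_ / _).
  rewrite rmorph_sum -sumrN; apply: eq_big_seq => b bs.
  by rewrite [in RHS]zi// exprMn sqr_i mulN1r rmorphXn.
have [as_|as_] := boolP (a \in s); last first.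
  apply: IH => b bs bq; apply: zq => //; rewrite inE negb_or bq andbT.
  by apply: contraNneq as_ => <-.
pose Y x := cexp (\sum_(b <- s | b != a) z b * (y b x)%:C).
pose X x := \sum_(b <- s | b == a) 'i%C * (y b x)%:C.
have XE x : X x = 'i%C * (y a x)%:C by rewrite /X -big_filter filter_pred1_uniq// big_seq1.
have iXY : exp_integrable P X Y.
  exact: (exp_integrable_linear s (fun b => b != a) (pred1 a) z (fun=> 'i%C)).
have split_sum (w : R[i]) x :
    \sum_(b <- s) (if b == a then w else z b) * (y b x)%:C
    = w * (y a x)%:C + \sum_(b <- s | b != a) z b * (y b x)%:C.
  rewrite [LHS](bigD1_seq a as_ us) /= eqxx; congr (_ + _).
  by apply: eq_bigr => b /negbTE ->.
have split_sq (w : R[i]) :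
    \sum_(b <- s) (if b == a then w else z b) ^+ 2
    = w ^+ 2 + \sum_(b <- s | b != a) z b ^+ 2.
  rewrite [LHS](bigD1_seq a as_ us) /= eqxx; congr (_ + _).
  by apply: eq_bigr => b /negbTE ->.
pose C := cexp ((\sum_(b <- s | b != a) z b ^+ 2) / 2).
have EXY (t : R) : cintegral P (fun x => Y x * cexp (t%:C * X x))
    = C * cexp (t%:C * 0 - t%:C ^+ 2 * 1 / 2).
  have := IH (fun b => if b == a then 'i%C * t%:C else z b).
  under [X in cintegral _ X]eq_fun do rewrite split_sum.
  rewrite split_sq => H.
  have -> : (fun x => Y x * cexp (t%:C * X x)) = (fun x =>
      cexp ('i%C * t%:C * (y a x)%:C + \sum_(b <- s | b != a) z b * (y b x)%:C)).
    by apply/funext => x; rewrite /Y -cexpD XE addrC [t%:C * _]mulrCA mulrA.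
  rewrite H => [|b bs bq].
    by rewrite -cexpD; congr cexp; rewrite exprMn sqr_i; field.
  case: eqP => [_|/eqP ba]; first by rewrite ReM /=; ring.
  by apply: zq; rewrite // inE negb_or ba.
(* [X] carries a factor i, so the exponent with coefficient [z a] is reached at - i z_a. *)
have := cintegral_cexp_ext iXY EXY (- 'i%C * z a).
have -> : (fun x => Y x * cexp (- 'i%C * z a * X x))
   = (fun x => cexp (\sum_(a <- s) z a * (y a x)%:C)).
  apply/funext => x; rewrite [in RHS](bigD1_seq a as_ us) /= XE /Y -cexpD addrC.
  by rewrite [- 'i%C * z a]mulrC mulrA -[_ * 'i%C]mulrA mulNr -expr2 sqr_i opprK mulr1.
move=> ->; rewrite -cexpD; congr cexp; rewrite (bigD1_seq a as_ us) /= exprMn sqrrN sqr_i.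
by field.
Qed.

(** Quadratic coefficients are switched on one by one, on the coordinates in [q]: the exponential
    [Q] in the other coordinates is the complex density [Y] of the one-coordinate step. *)
Lemma gaussian_quad (s : seq I) (c : I -> R) (z : I -> R[i]) : uniq s ->
  (forall a, c a < 1) ->
  cintegrable P (fun x => cexp (\sum_(a <- s) ((c a / 2 * y a x ^+ 2)%:C + z a * (y a x)%:C))) /\
  cintegral P (fun x => cexp (\sum_(a <- s) ((c a / 2 * y a x ^+ 2)%:C + z a * (y a x)%:C)))
  = \prod_(a <- s) (((Num.sqrt (1 - c a))^-1)%:C * cexp (z a ^+ 2 / (1 - c a)%:C / 2)).
Proof.
move=> us.
suff H (q : seq I) : forall (c : I -> R) (z : I -> R[i]), (forall a, c a < 1) ->
   (forall a, a \in s -> a \notin q -> c a = 0) ->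
   cintegrable P (fun x => cexp (\sum_(a <- s) ((c a / 2 * y a x ^+ 2)%:C + z a * (y a x)%:C))) /\
  cintegral P (fun x => cexp (\sum_(a <- s) ((c a / 2 * y a x ^+ 2)%:C + z a * (y a x)%:C)))
  = \prod_(a <- s) (((Num.sqrt (1 - c a))^-1)%:C * cexp (z a ^+ 2 / (1 - c a)%:C / 2)).
  by move=> c1; apply: (H s) => // a ->.
elim: q => [|a q IH] {}c {}z c1 cq.
  have -> : (fun x => cexp (\sum_(a <- s) ((c a / 2 * y a x ^+ 2)%:C + z a * (y a x)%:C)))
    = (fun x => cexp (\sum_(a <- s) z a * (y a x)%:C)).
    apply/funext => x; congr cexp; apply: eq_big_seq => b bs.
    by rewrite cq// !mul0r add0r.
  split; first exact: cintegrable_linear.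
  rewrite gaussian_linear// mulr_suml cexp_sum; apply: eq_big_seq => b bs.
  by rewrite cq// subr0 sqrtr1 invr1 divr1 mul1r.
have [as_|as_] := boolP (a \in s); last first.
  apply: IH => // b bs bq; apply: cq => //; rewrite inE negb_or bq andbT.
  by apply: contraNneq as_ => <-.
pose Q (u : I -> R[i]) x :=
  cexp (\sum_(b <- s | b != a) ((c b / 2 * y b x ^+ 2)%:C + u b * (y b x)%:C)).
pose K (u : I -> R[i]) := \prod_(b <- s | b != a)
  (((Num.sqrt (1 - c b))^-1)%:C * cexp (u b ^+ 2 / (1 - c b)%:C / 2)).
have IHQ (u : I -> R[i]) (w : R[i]) :
   cintegrable P (fun x => Q u x * cexp (w * (y a x)%:C)) /\
   cintegral P (fun x => Q u x * cexp (w * (y a x)%:C)) = K u * cexp (w ^+ 2 / 2).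
  have := IH (fun b => if b == a then 0 else c b) (fun b => if b == a then w else u b).
  have spl x : \sum_(b <- s) (((if b == a then 0 else c b) / 2 * y b x ^+ 2)%:C
      + (if b == a then w else u b) * (y b x)%:C)
    = w * (y a x)%:C + \sum_(b <- s | b != a) ((c b / 2 * y b x ^+ 2)%:C + u b * (y b x)%:C).
    rewrite [LHS](bigD1_seq a as_ us) /= eqxx !mul0r add0r; congr (_ + _).
    by apply: eq_bigr => b /negbTE ->.
  have -> : (fun x => cexp (\sum_(a0 <- s) (((if a0 == a then 0 else c a0) / 2 * y a0 x ^+ 2)%:C
      + (if a0 == a then w else u a0) * (y a0 x)%:C)))
    = (fun x => Q u x * cexp (w * (y a x)%:C)).
    by apply/funext => x; rewrite spl cexpD mulrC.
  rewrite [\prod_(b <- s) _](bigD1_seq a as_ us) /= eqxx subr0 sqrtr1 invr1 divr1 mul1r mulrC.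
  rewrite (eq_bigr (fun b => ((Num.sqrt (1 - c b))^-1)%:C * cexp (u b ^+ 2 / (1 - c b)%:C / 2))).
    apply; first by move=> b; case: eqP.
    move=> b bs bq; case: eqP => // /eqP ba; apply: cq => //.
    by rewrite inE negb_or ba.
  by move=> b /negbTE ->.
(* The modulus of [Q z] is [Q rz], as the quadratic part is real; so the induction hypothesis also
   supplies the absolute exponential moments that the step asks for. *)
pose rz b := (Re (z b))%:C.
have nQ x t : normc (Q z x) * expR (t * y a x) = Re (Q rz x * cexp (t%:C * (y a x)%:C)).
  rewrite /Q -cexpD normc_cexp -expRD.
  have -> : \sum_(b <- s | b != a) ((c b / 2 * y b x ^+ 2)%:C + rz b * (y b x)%:C)
      + t%:C * (y a x)%:C
    = (Re (\sum_(b <- s | b != a) ((c b / 2 * y b x ^+ 2)%:C + z b * (y b x)%:C))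
       + t * y a x)%:C.
    rewrite rmorphD /= rmorphM; congr (_ + _).
    rewrite Re_sum real_complex_sum; apply: eq_bigr => b _.
    by apply: complex_eqP; rewrite /rz ?(ReD, ImD, ReM, ImM) /=; ring.
  by rewrite cexp_real.
have [||| |i1 i2] := @cintegral_gaussian_quad _ T R P (y a) (Q z) (K z) (Re (K rz)) (my a)
   _ _ _ _ (c a) (z a) (c1 a).
- apply: cmeas_cexp; apply: cmeas_sum => b _; apply: cmeasD.
    by apply: cmeas_real; apply: measurable_funM => //; apply: measurable_funX.
  by apply: cmeasM; [apply: cmeas_cst|apply: cmeas_real].
- move=> t; have [[h _] _] := IHQ rz t%:C.
  by under eq_fun do rewrite nQ.
- move=> t; have [_ h] := IHQ rz t%:C.
  under eq_Rintegral do rewrite nQ.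
  rewrite -[LHS]/(Re (cintegral P (fun x => Q rz x * cexp (t%:C * (y a x)%:C)))) h.
  have -> : t%:C ^+ 2 / 2 = (t ^+ 2 / 2)%:C :> R[i].
    by rewrite rmorphM rmorphXn /= fmorphV rmorph_nat.
  by rewrite cexp_real ReM /= mulr0 subr0.
- by move=> w; case: (IHQ z w).
have E : (fun x => cexp (\sum_(a <- s) ((c a / 2 * y a x ^+ 2)%:C + z a * (y a x)%:C)))
   = (fun x => Q z x * cexp ((c a / 2 * y a x ^+ 2)%:C + z a * (y a x)%:C)).
  by apply/funext => x; rewrite [X in cexp X = _](bigD1_seq a as_ us) /= [LHS]cexpD [LHS]mulrC.
rewrite E; split => //; by rewrite i2 [RHS](bigD1_seq a as_ us) /= mulrC.
Qed.

End gaussian_family.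

(** * Coordinates of Hermitian matrices *)

Section positions.
Variables (R : realType) (m : nat).
Local Notation position := (position m).
Local Notation transpose := (@transpose m).
Implicit Types (X Y F : cmatrices R m) (a b : position).

Lemma fsum_seq (I : choiceType) (V : nmodType) (r : seq I) (f : I -> V) : uniq r ->
  (forall i, i \notin r -> f i = 0) -> \sum_(i \in [set: I]) f i = \sum_(i <- r) f i.
Proof.
move=> ur f0; rewrite (fsbigE r)// => [|i _]; last exact: f0.
by apply: eq_bigl => i; rewrite in_setT.
Qed.

Lemma transposeK : involutive transpose.
Proof. by case=> [[k i] j]. Qed.

Definition box (M : nat) : seq position :=
  [seq (p, j) | p <- [seq (k, i) | k <- enum 'I_m, i <- iota 0 M], j <- iota 0 M].

Lemma mem_box M a : (a \in box M) = (a.1.2 < M)%N && (a.2 < M)%N.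
Proof.
case: a => [[k i] j] /=; apply/allpairsP/andP => /=.
  move=> [[p j']] /= [pP jP []] kE jE; move: pP jP; rewrite -kE -jE mem_iota add0n /=.
  move=> /allpairsP[[k' i']] /= [_ + [_ ->]]; by rewrite mem_iota add0n.
move=> [iM jM]; exists ((k, i), j) => /=; split => //; last by rewrite mem_iota.
by apply/allpairsP; exists (k, i); split => //=; rewrite ?mem_enum// mem_iota.
Qed.

Lemma box_uniq M : uniq (box M).
Proof.
apply: allpairs_uniq; rewrite ?iota_uniq//; last by move=> [? ?] [? ?].
by apply: allpairs_uniq; rewrite ?iota_uniq ?enum_uniq// => -[? ?] [? ?].
Qed.

Lemma box_sub M N : (M <= N)%N -> {subset box M <= box N}.
Proof.
by move=> MN a; rewrite !mem_box => /andP[aM bM]; rewrite (leq_trans aM)// (leq_trans bM).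
Qed.

Lemma transpose_box M a : (transpose a \in box M) = (a \in box M).
Proof. by rewrite !mem_box andbC. Qed.

Lemma perm_transpose_box M : perm_eq (map transpose (box M)) (box M).
Proof.
apply: uniq_perm; rewrite ?(map_inj_uniq (inv_inj transposeK)) ?box_uniq// => a.
by rewrite -{1}(transposeK a) mem_map ?transpose_box//; apply: inv_inj transposeK.
Qed.

Lemma sum_transpose (V : nmodType) M (f : position -> V) :
  \sum_(a <- box M) f (transpose a) = \sum_(a <- box M) f a.
Proof. by rewrite -[RHS](perm_big _ (perm_transpose_box M)) big_map. Qed.

Lemma big_box (V : nmodType) M (f : position -> V) :
  \sum_(a <- box M) f a = \sum_(k < m) \sum_(i <- iota 0 M) \sum_(j <- iota 0 M) f (k, i, j).
Proof.
rewrite /box big_allpairs_dep /= big_allpairs_dep /= big_enum.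
by [].
Qed.

Definition boxed M F : Prop := forall a, a \notin box M -> entry F a = 0.

Lemma boxed_sub M N F : (M <= N)%N -> boxed M F -> boxed N F.
Proof. by move=> MN bF a aN; apply: bF; apply: contra aN; apply: box_sub. Qed.

Lemma finite_boxed F : finite_set [set a | entry F a != 0] -> exists M, boxed M F.
Proof.
move=> /finite_seqP[s sE]; exists (\sum_(a <- s) (a.1.2 + a.2).+1)%N => a.
apply: contraNeq => aF; have as_ : a \in s.
  by have : [set a | entry F a != 0] a by []; rewrite sE.
rewrite mem_box (big_rem a as_) /=.
by apply/andP; split; lia.
Qed.

Lemma boxed_finite M F : boxed M F -> finite_set [set a | entry F a != 0].
Proof.
move=> bF; apply: (sub_finite_set _ (finite_seq (box M))) => a /=.
by apply: contraNT => /bF ->.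
Qed.

Lemma pairing_box M X F : boxed M F ->
  pairing X F = \sum_(a <- box M) entry X a * entry F (transpose a).
Proof.
move=> bF; apply: fsum_seq; first exact: box_uniq.
by move=> a; rewrite -transpose_box => /bF ->; rewrite mulr0.
Qed.

Lemma inner_box M X Y : boxed M Y ->
  inner X Y = \sum_(a <- box M) entry X a * entry Y (transpose a).
Proof.
move=> bY; rewrite -sum_transpose big_box; apply: eq_bigr => k _.
have Y0 i j : ~~ ((i < M)%N && (j < M)%N) -> Y k i j = 0.
  by move=> h; apply: (bY (k, i, j)); rewrite mem_box.
have inM (i : nat) : i \notin iota 0 M -> (i < M)%N = false.
  by rewrite mem_iota add0n => /negbTE.
have row0 i : \sum_(l \in [set: nat]) Y k i l * X k l i
    = \sum_(l <- iota 0 M) Y k i l * X k l i.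
  by apply: fsum_seq; [exact: iota_uniq|move=> l /inM lM; rewrite Y0 ?mul0r// lM andbF].
rewrite /mtrace /mprod.
transitivity (\sum_(i <- iota 0 M) \sum_(l \in [set: nat]) Y k i l * X k l i).
  apply: fsum_seq; first exact: iota_uniq.
  move=> i /inM iM; rewrite row0 big1// => l _.
  by rewrite Y0 ?mul0r// iM.
by apply: eq_bigr => i _; rewrite row0; apply: eq_bigr => l _; rewrite mulrC.
Qed.

Lemma inner_pairing M X Y : boxed M Y -> inner X Y = pairing X Y.
Proof. by move=> bY; rewrite (inner_box _ bY) (pairing_box _ bY). Qed.

(* The coordinates of [X] in the basis of the matrices [of_coord (delta_a)],
   which are Hermitian and orthonormal. *)
Definition coord X a : R[i] :=
  ((1 - 'i%C) * entry X a + (1 + 'i%C) * entry X (transpose a)) / 2.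

Definition of_coord (g : position -> R[i]) : cmatrices R m := fun k i j =>
  ((1 + 'i%C) * g (k, i, j) + (1 - 'i%C) * g (k, j, i)) / 2.

Let sqi : 'i%C * 'i%C = -1 :> R[i].
Proof. by rewrite -expr2 sqr_i. Qed.

Lemma entry_of_coord g a :
  entry (of_coord g) a = ((1 + 'i%C) * g a + (1 - 'i%C) * g (transpose a)) / 2.
Proof. by case: a => [[k i] j]. Qed.

Lemma of_coordK g a : coord (of_coord g) a = g a.
Proof.
rewrite /coord !entry_of_coord transposeK.
have -> : ((1 - 'i%C) * (((1 + 'i%C) * g a + (1 - 'i%C) * g (transpose a)) / 2) +
  (1 + 'i%C) * (((1 + 'i%C) * g (transpose a) + (1 - 'i%C) * g a) / 2)) / 2
  = (2 * (1 - 'i%C * 'i%C) * g a + 2 * (1 + 'i%C * 'i%C) * g (transpose a)) / 4 by field.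
by rewrite sqi; field.
Qed.

Lemma coordK X a : entry (of_coord (coord X)) a = entry X a.
Proof.
rewrite entry_of_coord /coord transposeK.
have -> : ((1 + 'i%C) * (((1 - 'i%C) * entry X a + (1 + 'i%C) * entry X (transpose a)) / 2) +
  (1 - 'i%C) * (((1 - 'i%C) * entry X (transpose a) + (1 + 'i%C) * entry X a) / 2)) / 2
  = (2 * (1 - 'i%C * 'i%C) * entry X a + 2 * (1 + 'i%C * 'i%C) * entry X (transpose a)) / 4
  by field.
by rewrite sqi; field.
Qed.

Lemma boxed_coord M F a : boxed M F -> a \notin box M -> coord F a = 0.
Proof.
move=> bF aM; rewrite /coord (bF a)// (bF (transpose a)) ?transpose_box//.
by rewrite !mulr0 addr0 mul0r.
Qed.

Lemma boxed_of_coord M g : (forall a, a \notin box M -> g a = 0) -> boxed M (of_coord g).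
Proof.
move=> g0 a aM; rewrite entry_of_coord !g0 ?transpose_box//.
by rewrite !mulr0 addr0 mul0r.
Qed.

(** Termwise the two products differ by transposition and by a multiple of [q (transpose a) - q a];
    both effects disappear in the sum, because the box is symmetric. *)
Lemma parseval M X Y :
  \sum_(a <- box M) entry X a * entry Y (transpose a) = \sum_(a <- box M) coord X a * coord Y a.
Proof.
pose p a := entry X a * entry Y (transpose a); pose q a := entry X a * entry Y a.
have E a : coord X a * coord Y a =
  (p a + p (transpose a)) / 2 + (('i%C / 2) * q (transpose a) - ('i%C / 2) * q a).
  rewrite /coord /p /q transposeK.
  set u := entry X a; set v := entry X (transpose a).
  set u' := entry Y a; set v' := entry Y (transpose a).
  have -> : ((1 - 'i%C) * u + (1 + 'i%C) * v) / 2 * (((1 - 'i%C) * u' + (1 + 'i%C) * v') / 2)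
   = ((1 - 'i%C * 'i%C) * (u * v' + v * u') + (1 + 'i%C * 'i%C) * (v * v' + u * u')
      + 2 * 'i%C * (v * v' - u * u')) / 4 by field.
  by rewrite sqi; field.
rewrite (eq_bigr _ (fun a _ => E a)) big_split /= sumrB -!mulr_sumr sum_transpose subrr addr0.
by rewrite -mulr_suml big_split /= sum_transpose -/p; field.
Qed.

Lemma pairing_coord M X F : boxed M F ->
  pairing X F = \sum_(a <- box M) coord F a * coord X a.
Proof.
move=> bF; rewrite (pairing_box _ bF) parseval.
by apply: eq_bigr => a _; rewrite mulrC.
Qed.

Lemma inner_coord M X Y : boxed M Y ->
  inner X Y = \sum_(a <- box M) coord X a * coord Y a.
Proof. by move=> bY; rewrite (inner_box _ bY) parseval. Qed.

Lemma hermitian_coordP X : is_hermitian X <-> forall a, Im (coord X a) = 0.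
Proof.
split=> [hX [[k i] j]|cX k i j].
  rewrite /coord -[entry X (k, i, j)]/(X k i j) -[entry X _]/(X k j i) (hX k i j).
  case: (X k i j) => x y.
  by rewrite -(rmorph_nat (real_complex R)) -fmorphV !(ReM, ImM, ReD, ImD, ReB, ImB) /=; ring.
have := coordK X (k, i, j); have := coordK X (k, j, i); rewrite !entry_of_coord.
rewrite -[entry X (k, j, i)]/(X k j i) -[entry X (k, i, j)]/(X k i j) => <- <-.
rewrite -[transpose (k, j, i)]/(k, i, j) -[transpose (k, i, j)]/(k, j, i).
rewrite -(rmorph_nat (real_complex R)) -fmorphV.
move: (cX (k, i, j)) (cX (k, j, i)); move: (coord X (k, i, j)) (coord X (k, j, i)) => u v u0 v0.
apply: complex_eqP; rewrite ?Re_conj ?Im_conj !(ReM, ImM, ReD, ImD, ReB, ImB) u0 v0 /=; ring.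
Qed.

Definition rcoord a (A : dualM R m) : R := Re (coord A a).

Lemma coord_dualM (A : dualM R m) a : coord A a = (rcoord a A)%:C.
Proof.
have := (hermitian_coordP A).1 (@dualM_hermitian _ _ A) a.
by rewrite /rcoord; case: (coord A a) => x y /= ->.
Qed.

Lemma spaceM_of_coord M (g : position -> R) : (forall a, a \notin box M -> g a = 0) ->
  spaceM (of_coord (fun a => (g a)%:C)).
Proof.
move=> g0; split; first by apply/hermitian_coordP => a; rewrite of_coordK.
by apply: (@boxed_finite M); apply: boxed_of_coord => a /g0 ->.
Qed.

Lemma spaceM_boxed F : spaceM F -> exists M, boxed M F.
Proof. by move=> [_ /finite_boxed]. Qed.

(** The coordinate is the pairing with a basis matrix, so its preimages are cylinder sets. *)
Lemma measurable_rcoord a : measurable_fun setT (rcoord a).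
Proof.
move=> _ Y mY; rewrite setTI; apply: sub_sigma_algebra.
pose g b : R := (b == a)%:R; pose M := (a.1.2 + a.2).+1.
have aM : a \in box M by rewrite mem_box; apply/andP; split; rewrite /M; lia.
have g0 b : b \notin box M -> g b = 0.
  by rewrite /g; case: eqP => // ->; rewrite aM.
exists (of_coord (fun b => (g b)%:C)); first exact: spaceM_of_coord g0.
exists Y => //; apply/seteqP; suff E A : pairing A (of_coord (fun b => (g b)%:C)) = coord A a.
  by split=> A /=; rewrite E.
have bg : boxed M (of_coord (fun b => (g b)%:C)) by apply: boxed_of_coord => b /g0 ->.
rewrite (pairing_coord _ bg).
rewrite (bigD1_seq a aM (box_uniq _)) /= of_coordK /g eqxx mul1r big1 ?addr0// => b /negbTE ba.
by rewrite of_coordK ba mul0r.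
Qed.

End positions.

Arguments box {m} M.

Section standard_gaussian_coordinates.
Variables (R : realType) (m : nat) (mu : probability (dualM R m) R).
Hypothesis gaussian_mu : standard_gaussian mu.

(** Real combinations of coordinates are pairings with Hermitian matrices of finite support; this
    turns the defining property of the measure into a joint characteristic function. *)
Lemma char_rcoord (s : seq (position m)) (f : position m -> R) : uniq s ->
  cintegral mu (fun A => cexp ('i%C * (\sum_(a <- s) f a * rcoord a A)%:C))
  = cexp (- ((\sum_(a <- s) f a ^+ 2) / 2)%:C).
Proof.
move=> us; pose M := (\sum_(a <- s) (a.1.2 + a.2).+1)%N.
have sM a : a \in s -> a \in box M.
  by move=> as_; rewrite mem_box /M (big_rem a as_) /=; apply/andP; split; lia.
pose g a : R := if a \in s then f a else 0.
have g0 a : a \notin box M -> g a = 0.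
  by rewrite /g; case: ifP => // /sM ->.
have bF : boxed M (of_coord (fun a => (g a)%:C)).
  by apply: boxed_of_coord => a /g0 ->.
have restrict (h : position m -> R[i]) : (forall a, a \notin s -> h a = 0) ->
    \sum_(a <- box M) h a = \sum_(a <- s) h a.
  move=> h0; rewrite -[LHS](fsum_seq (box_uniq m M)) ?(fsum_seq us h0)//.
  by move=> a aM; apply: h0; apply: contra aM; apply: sM.
have := gaussian_mu (spaceM_of_coord g0).
rewrite (inner_coord _ bF) restrict => [|a as_]; last first.
  by rewrite !of_coordK /g (negbTE as_) mul0r.
have -> : - ((\sum_(a <- s) coord (of_coord (fun a0 => (g a0)%:C)) a *
       coord (of_coord (fun a0 => (g a0)%:C)) a) / 2) = - ((\sum_(a <- s) f a ^+ 2) / 2)%:C.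
  rewrite rmorphM /= fmorphV rmorph_nat real_complex_sum; congr (- (_ / _)).
  by apply: eq_big_seq => a as_; rewrite of_coordK /g as_ -rmorphM.
move=> <-; congr cintegral; apply/funext => A; congr (cexp (_ * _)).
rewrite (pairing_coord _ bF) restrict => [|a as_]; last first.
  by rewrite of_coordK /g (negbTE as_) mul0r.
rewrite real_complex_sum; apply: eq_big_seq => a as_.
by rewrite of_coordK /g as_ coord_dualM -rmorphM.
Qed.

End standard_gaussian_coordinates.

(** * Wick powers *)

Section tuple_boxes.
Variables (R : realType) (m : nat).
Local Notation position := (position m).
Local Notation transpose := (@transpose m).
Local Notation tensor := (tensor R m).

Fixpoint tbox (M n : nat) : seq (n.-tuple position) :=
  if n is n'.+1 then [seq cons_tuple a t | a <- box M, t <- tbox M n'] else [:: [tuple]].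

Lemma mem_tbox M n (t : n.-tuple position) : (t \in tbox M n) = all (mem (box M)) t.
Proof.
elim: n t => [|n IH] t; first by rewrite [t]tuple0 inE eqxx.
case/tupleP: t => a t /=; rewrite -IH; apply/allpairsP/andP => /=.
  by move=> [[b u]] /= [bM uM /(congr1 val) /= [-> tu]]; split => //; rewrite (val_inj tu : t = u).
by move=> [aM tM]; exists (a, t).
Qed.

Lemma tbox_uniq M n : uniq (tbox M n).
Proof.
elim: n => [|n IH] //=; apply: allpairs_uniq => //; first exact: box_uniq.
by move=> [a t] [b u] _ _ /(congr1 val) /= [-> tu]; rewrite (val_inj tu : t = u).
Qed.

Lemma sum_tboxS (V : nmodType) M n (f : n.+1.-tuple position -> V) :
  \sum_(t <- tbox M n.+1) f t = \sum_(a <- box M) \sum_(t <- tbox M n) f (cons_tuple a t).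
Proof. by rewrite /= big_allpairs_dep. Qed.

Lemma sum_tbox_prod (K : comNzRingType) M n (g : position -> K) :
  \sum_(t <- tbox M n) \prod_(a <- t) g a = (\sum_(a <- box M) g a) ^+ n.
Proof.
elim: n => [|n IH]; first by rewrite /= big_seq1 big_nil expr0.
rewrite sum_tboxS exprS -IH mulr_suml; apply: eq_bigr => a _.
by rewrite mulr_sumr; apply: eq_bigr => t _; rewrite big_cons.
Qed.

Lemma prod_transpose_eq0 M n (t : n.-tuple position) (F : cmatrices R m) :
  boxed M F -> t \notin tbox M n ->
  tensor_power F [tuple of map transpose t] = 0.
Proof.
move=> bF; rewrite mem_tbox /tensor_power big_map => /allPn[a at_ aM].
by rewrite (big_rem a at_) /= bF ?mul0r// transpose_box.
Qed.

Lemma tensor_pairing_box M n (w k : tensor n) :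
  (forall t, t \notin tbox M n -> k [tuple of map transpose t] = 0) ->
  tensor_pairing w k = \sum_(t <- tbox M n) w t * k [tuple of map transpose t].
Proof.
by move=> k0; apply: fsum_seq => [|t /k0 ->]; [exact: tbox_uniq|rewrite mulr0].
Qed.

Lemma tensor_pairing_power M n (w : tensor n) (F : cmatrices R m) : boxed M F ->
  tensor_pairing w (tensor_power (n := n) F)
  = \sum_(t <- tbox M n) w t * \prod_(a <- t) entry F (transpose a).
Proof.
move=> bF; rewrite (@tensor_pairing_box M) => [|t]; last exact: prod_transpose_eq0.
by apply: eq_bigr => t _; rewrite /tensor_power big_map.
Qed.

Definition tupleperm n (s : 'S_n) (t : n.-tuple position) : n.-tuple position :=
  [tuple tnth t (s i) | i < n].

Lemma tuplepermM n (s u : 'S_n) t : tupleperm s (tupleperm u t) = tupleperm (s * u)%g t.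
Proof. by apply: eq_from_tnth => i; rewrite !tnth_mktuple permM. Qed.

Lemma tupleperm1 n t : tupleperm (1%g : 'S_n) t = t.
Proof. by apply: eq_from_tnth => i; rewrite tnth_mktuple perm1. Qed.

Lemma tupleperm_inj n (s : 'S_n) : injective (tupleperm s).
Proof.
apply: (can_inj (g := tupleperm s^-1)) => t.
by rewrite tuplepermM mulVg tupleperm1.
Qed.

Lemma tupleperm_perm n (s : 'S_n) t : perm_eq (tupleperm s t) t.
Proof. by apply/tuple_permP; exists s. Qed.

Lemma sum_tupleperm (V : nmodType) M n (s : 'S_n) (f : n.-tuple position -> V) :
  \sum_(t <- tbox M n) f (tupleperm s t) = \sum_(t <- tbox M n) f t.
Proof.
have p : perm_eq (map (tupleperm s) (tbox M n)) (tbox M n).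
  apply: uniq_perm; rewrite ?(map_inj_uniq (@tupleperm_inj n s)) ?tbox_uniq// => t.
  have -> : t = tupleperm s (tupleperm s^-1 t) by rewrite tuplepermM mulgV tupleperm1.
  rewrite (mem_map (@tupleperm_inj n s)) !mem_tbox.
  by rewrite !(perm_all _ (tupleperm_perm _ _)).
by rewrite -[RHS](perm_big _ p) big_map.
Qed.

Lemma prod_tupleperm (K : comNzRingType) n (s : 'S_n) (t : n.-tuple position) (g : position -> K) :
  \prod_(a <- tupleperm s t) g a = \prod_(a <- t) g a.
Proof. exact: perm_big (tupleperm_perm s t). Qed.

End tuple_boxes.

Arguments tbox {m} M n.

Section wick_existence.
Variables (R : realType) (m : nat).
Local Notation position := (position m).
Local Notation transpose := (@transpose m).
Variable X : cmatrices R m.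

(* Tensors H_n, not yet symmetrized, with H_(n+2) = X (x) H_(n+1) - (n+1) tau (x) H_n. *)
Fixpoint wick_seq (l : seq position) : R[i] :=
  match l with
  | [::] => 1
  | a :: l1 => match l1 with
    | [::] => entry X a
    | b :: l2 => entry X a * wick_seq l1
                 - (size l2).+1%:R * (b == transpose a)%:R * wick_seq l2
    end
  end.

Definition wick_sym n : tensor R m n := fun t =>
  (n`!%:R)^-1 * \sum_(s : 'S_n) wick_seq (tupleperm s t).

Arguments wick_sym n : clear implicits.

Lemma wick_sym_symmetric n : symmetric_tensor (wick_sym n).
Proof.
move=> s t /tuple_permP[u su]; congr (_ * _).
have -> : s = tupleperm u t by exact: val_inj su.
under eq_bigr do rewrite tuplepermM.
by rewrite [RHS](reindex_inj (mulIg u)).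
Qed.

(** Paired with a tensor power of F, the contraction term yields the factor (F, F), so the
    recurrence of the tensors becomes the Hermite recurrence. *)
Lemma wick_seq_pairing M (F : cmatrices R m) n : boxed M F ->
  \sum_(t <- tbox M n) wick_seq t * \prod_(a <- t) entry F (transpose a)
  = hermite (pairing X F) (inner F F) n.
Proof.
move=> bF; elim/hermite_ind2: n => [||n IH1 IH2].
- by rewrite big_seq1 big_nil mulr1 hermite0.
- rewrite sum_tboxS hermite1 (pairing_box _ bF); apply: eq_bigr => a _.
  by rewrite big_seq1 /= big_seq1.
rewrite hermiteSS -IH1 -IH2 (pairing_box _ bF) (inner_box _ bF) sum_tboxS.
have -> : \sum_(a <- box M) \sum_(t <- tbox M n.+1)
    wick_seq (cons_tuple a t) * \prod_(b <- cons_tuple a t) entry F (transpose b)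
  = \sum_(a <- box M) \sum_(t <- tbox M n.+1)
      (entry X a * entry F (transpose a)) * (wick_seq t * \prod_(b <- t) entry F (transpose b))
  - \sum_(a <- box M) \sum_(b <- box M) \sum_(t <- tbox M n)
      (n.+1%:R * ((b == transpose a)%:R * entry F (transpose b) * entry F (transpose a)))
      * (wick_seq t * \prod_(b <- t) entry F (transpose b)).
  rewrite -sumrB; apply: eq_bigr => a _; rewrite !sum_tboxS -sumrB.
  apply: eq_bigr => b _; rewrite -sumrB; apply: eq_bigr => t _.
  rewrite /= !big_cons size_tuple; ring.
congr (_ - _).
  by rewrite mulr_suml; apply: eq_bigr => a _; rewrite mulr_sumr.
set S := \sum_(t <- tbox M n) _.
have -> : n.+1%:R * (\sum_(a <- box M) entry F a * entry F (transpose a)) * S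
    = \sum_(a <- box M) n.+1%:R * (entry F a * entry F (transpose a)) * S.
  by rewrite [n.+1%:R * _]mulr_sumr mulr_suml.
apply: eq_big_seq => a aM.
rewrite (bigD1_seq (transpose a)) ?transpose_box ?box_uniq//= eqxx transposeK.
rewrite [X in _ + X]big1 => [|b /negbTE ba]; last first.
  by rewrite big1// => t _; rewrite ba !mul0r mulr0 mul0r.
by rewrite addr0 mul1r -mulr_sumr.
Qed.

(** Tensor powers are symmetric, so averaging over permutations leaves the pairing unchanged. *)
Lemma wick_sym_pairing (F : cmatrices R m) n : spaceM F ->
  tensor_pairing (wick_sym n) (tensor_power F) = hermite (pairing X F) (inner F F) n.
Proof.
move=> /spaceM_boxed[M bF]; rewrite (tensor_pairing_power _ bF) -(wick_seq_pairing _ bF).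
have n0 : (n`!%:R : R[i]) != 0 by rewrite pnatr_eq0 -lt0n fact_gt0.
apply: (mulfI n0); rewrite mulr_sumr.
have -> : \sum_(t <- tbox M n) n`!%:R * (wick_sym n t * \prod_(a <- t) entry F (transpose a))
  = \sum_(s : 'S_n) \sum_(t <- tbox M n) wick_seq (tupleperm s t)
        * \prod_(a <- tupleperm s t) entry F (transpose a).
  rewrite exchange_big; apply: eq_bigr => t _.
  rewrite mulrA mulrA mulfV// mul1r mulr_suml; apply: eq_bigr => s _.
  by rewrite prod_tupleperm.
under eq_bigr => s _ do rewrite (sum_tupleperm M s
  (fun t => wick_seq t * \prod_(a <- t) entry F (transpose a))).
by rewrite sumr_const card_Sn mulr_natl.
Qed.

End wick_existence.

Arguments wick_sym {R m} X n.

Section wick_pairing.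
Variables (R : realType) (m : nat).

Lemma spaceM_scale (F : cmatrices R m) (t : R) :
  spaceM F -> spaceM (fun k i j => t%:C * F k i j).
Proof.
move=> sF; have [M bF] := spaceM_boxed sF; case: sF => hF fF; split.
  by move=> k i j; rewrite hF rmorphM /= oppr0.
by apply: (@boxed_finite _ _ M) => a /bF; rewrite /entry => ->; rewrite mulr0.
Qed.

Variable A : dualM R m.

(** [wick] is a choice from [wick_powers] with the zero family as default; the tensors [wick_sym]
    are the witness that the choice is not the default case. *)
Lemma wick_powersP : wick_powers A (wick A).
Proof.
apply: xgetPex; exists (wick_sym A); split; first exact: wick_sym_symmetric.
move=> F sF; apply/ccvg_complex_topology.
have := hcoef_series (pairing A F) (inner F F).
apply: ccvg_ext => N; rewrite /series /= big_mkord; apply: eq_bigr => n _.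
by rewrite wick_sym_pairing.
Qed.

Lemma wick_symmetric n : symmetric_tensor (wick A n).
Proof. by case: wick_powersP. Qed.

(** The defining series is taken at t F for all real t; comparing powers of t separates the
    degrees. *)
Lemma wick_pairing (F : cmatrices R m) n : spaceM F ->
  tensor_pairing (wick A n) (tensor_power F) = hermite (pairing A F) (inner F F) n.
Proof.
move=> sF; have [M bF] := spaceM_boxed sF.
have n0 : (n`!%:R : R[i])^-1 != 0 by rewrite invr_eq0 pnatr_eq0 -lt0n fact_gt0.
apply: (mulfI n0); move: n {n0}.
apply: (power_series_unique (f := fun t => cexp (t%:C * pairing A F - t%:C ^+ 2 * inner F F / 2)));
  last by move=> t; apply: hcoef_tseries.
move=> t; have [_ /(_ _ (spaceM_scale t sF))] := wick_powersP.
have btF : boxed M (fun k i j => t%:C * F k i j).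
  by move=> a /bF; rewrite /entry => ->; rewrite mulr0.
have -> : pairing A (fun k i j => t%:C * F k i j) = t%:C * pairing A F.
  rewrite (pairing_box _ btF) (pairing_box _ bF) mulr_sumr; apply: eq_bigr => a _.
  by rewrite /entry mulrCA.
have -> : inner (fun k i j => t%:C * F k i j) (fun k i j => t%:C * F k i j)
   = t%:C ^+ 2 * inner F F.
  rewrite (inner_box _ btF) (inner_box _ bF) mulr_sumr; apply: eq_bigr => a _.
  by rewrite /entry mulrACA -expr2.
move=> /ccvg_complex_topology; apply: ccvg_ext => N.
rewrite /series /= big_mkord; apply: eq_bigr => n _.
rewrite -mulrA; congr (_ * _).
rewrite (tensor_pairing_power _ btF) (tensor_pairing_power _ bF) mulr_suml.
apply: eq_bigr => u _; rewrite -mulrA; congr (_ * _).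
rewrite /entry big_split /= mulrC; congr (_ * _).
by rewrite big_const_seq count_predT size_tuple iter_mulr mulr1.
Qed.

End wick_pairing.

(** * Polarization *)

Section polarization.
Variables (K : comNzRingType) (n : nat).

(** The sum factors over the points i, and the factor of i is 1 or 0 according to whether i is in
    the image of f. On a finite set, surjective means injective. *)
Lemma sum_signs_injective (f : {ffun 'I_n -> 'I_n}) :
  \sum_(e : {ffun 'I_n -> bool}) ((\prod_i (-1) ^+ (~~ e i)) * \prod_j (e (f j))%:R)
  = (injectiveb f)%:R :> K.
Proof.
pose h (i : 'I_n) (b : bool) : K := (-1) ^+ (~~ b) * b%:R ^+ #|[pred j | f j == i]|.
have -> : \sum_(e : {ffun 'I_n -> bool}) ((\prod_i (-1) ^+ (~~ e i)) * \prod_j (e (f j))%:R)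
   = \sum_(e : {ffun 'I_n -> bool}) \prod_i h i (e i).
  apply: eq_bigr => e _; rewrite big_split /=; congr (_ * _).
  rewrite (partition_big f xpredT)//=; apply: eq_bigr => i _.
  rewrite (eq_bigr (fun=> (e i)%:R)); last by move=> j /eqP ->.
  by rewrite prodr_const; congr (_ ^+ _).
rewrite -bigA_distr_bigA /=.
have hE i : \sum_b h i b = (0 < #|[pred j | f j == i]|)%:R.
  rewrite big_bool /h /= expr0 expr1 mul1r expr1n expr0n.
  by case: #|_| => [|k] /=; rewrite mulN1r ?subrr ?oppr0 ?addr0.
rewrite (eq_bigr _ (fun i _ => hE i)).
have [inj|ninj] := boolP (injectiveb f).
  rewrite big1// => i _; suff -> : (0 < #|[pred j | f j == i]|)%N by [].
  have /codomP[j ij] : i \in codom f by apply: inj_card_onto => //; apply/injectiveP.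
  by apply/card_gt0P; exists j; rewrite inE -ij.
have [i ni] : exists i, i \notin codom f.
  apply/existsP; rewrite -negb_forall; apply: contra ninj => /forallP sf.
  rewrite /injectiveb /dinjectiveb; apply/card_uniqP; rewrite size_map -cardE.
  by apply: eq_card => i; have := sf i; rewrite /codom => ->.
rewrite (bigD1 i)//= (_ : #|_| = 0%N) ?mul0r//.
apply: eq_card0 => j; rewrite !inE; apply: contraNF ni => /eqP <-; exact: codom_f.
Qed.

(** Expanding the product of sums gives one term for each map f; the signed sum over subsets keeps
    the injective ones, which are the permutations. *)
Lemma polarization (g : 'I_n -> 'I_n -> K) :
  \sum_(e : {ffun 'I_n -> bool})
     ((\prod_i (-1) ^+ (~~ e i)) * \prod_j \sum_i (e i)%:R * g i j)
  = \sum_(s : 'S_n) \prod_j g (s j) j.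
Proof.
pose F := {ffun 'I_n -> 'I_n}.
transitivity (\sum_(f : F) (injectiveb f)%:R * \prod_j g (f j) j).
  under eq_bigr => e _ do rewrite bigA_distr_bigA /= mulr_sumr.
  rewrite exchange_big; apply: eq_bigr => f _; rewrite -sum_signs_injective mulr_suml.
  by apply: eq_bigr => e _; rewrite big_split mulrA.
rewrite (bigID (fun f : F => injectiveb f)) /= addrC big1 ?add0r => [|f /negbTE ->]; last first.
  by rewrite mul0r.
rewrite (reindex (@pval _)) /=; last first.
  pose in_Sn := insubd (1%g : 'S_n).
  by exists in_Sn => /= f Uf; first apply: val_inj; apply: insubdK.
apply: eq_big => [s|s _]; first by case: s.
rewrite (_ : injectiveb _ = true) ?mul1r; last by case: s.
by apply: eq_bigr => j _; rewrite pvalE.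
Qed.

End polarization.

Section symmetric_tensors.
Variables (R : realType) (m : nat).
Local Notation position := (position m).
Local Notation transpose := (@transpose m).

Lemma polarize_symmetric M n (V : tensor R m n) (g : 'I_n -> position -> R[i]) :
  symmetric_tensor V ->
  \sum_(e : {ffun 'I_n -> bool}) ((\prod_i (-1) ^+ (~~ e i)) *
     \sum_(u <- tbox M n) V u * \prod_(a <- u) \sum_i (e i)%:R * g i a)
  = n`!%:R * \sum_(u <- tbox M n) V u * \prod_j g j (tnth u j).
Proof.
move=> symV.
transitivity (\sum_(u <- tbox M n) V u * \sum_(s : 'S_n) \prod_j g (s j) (tnth u j)).
  under eq_bigr => e _ do rewrite mulr_sumr.
  rewrite exchange_big; apply: eq_bigr => u _.
  rewrite -(polarization (fun i j => g i (tnth u j))) mulr_sumr.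
  by apply: eq_bigr => e _; rewrite big_tuple mulrCA.
under eq_bigr => u _ do rewrite mulr_sumr.
rewrite exchange_big /=.
have E (s : 'S_n) : \sum_(u <- tbox M n) V u * \prod_j g (s j) (tnth u j)
    = \sum_(u <- tbox M n) V u * \prod_j g j (tnth u j).
  rewrite -[RHS](sum_tupleperm M s^-1); apply: eq_bigr => u _.
  rewrite (symV _ _ (tupleperm_perm s^-1 u)); congr (_ * _).
  rewrite [RHS](reindex_inj (@perm_inj _ s)); apply: eq_bigr => j _.
  by rewrite tnth_mktuple permK.
by rewrite (eq_bigr _ (fun s _ => E s)) sumr_const card_Sn mulr_natl.
Qed.

Definition basis_pos (a : position) (b : bool) : position := if b then a else transpose a.

Definition delta_pos (a b : position) : R := (b == a)%:R.

(** Off the diagonal matrix units are not Hermitian; with these coefficients they are complex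
    combinations of the basis matrices at a position and at its transpose. Pairing with the unit at
    the transpose of [a] extracts the entry at [a]. *)
Definition basis_coef (b : bool) : R[i] := if b then (1 + 'i%C) / 2 else (1 - 'i%C) / 2.

Lemma sum_basis_coef a u :
  \sum_b basis_coef b * entry (of_coord (fun c => (delta_pos (basis_pos a b) c)%:C))
    (transpose u) = (u == a)%:R.
Proof.
rewrite big_bool /= !entry_of_coord transposeK /delta_pos /basis_coef /=.
have tK := @transposeK m.
rewrite (can2_eq tK tK) (inj_eq (inv_inj tK)).
rewrite !rmorph_nat; set p := (u == a)%:R; set q := (u == transpose a)%:R.
have -> : (1 + 'i%C) / 2 * (((1 + 'i%C) * q + (1 - 'i%C) * p) / 2) +
   (1 - 'i%C) / 2 * (((1 + 'i%C) * p + (1 - 'i%C) * q) / 2)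
  = ((1 - 'i%C * 'i%C) * p + (1 + 'i%C * 'i%C) * q) / 2 :> R[i] by field.
by rewrite -expr2 sqr_i; field.
Qed.

Lemma sum_spaceM_coord M (I : finType) (g : I -> position -> R) :
  (forall i a, a \notin box M -> g i a = 0) ->
  spaceM (of_coord (fun a => (\sum_i g i a)%:C)).
Proof. by move=> g0; apply: (@spaceM_of_coord _ _ M) => a aM; rewrite big1// => i _; apply: g0. Qed.

(* The coefficient [V t] of a symmetric tensor is determined by the pairings of
   V with powers of Hermitian matrices. *)
Lemma symmetric_tensor_coef n (t : n.-tuple position) :
  exists (J : finType) (c : J -> R[i]) (F : J -> cmatrices R m),
    (forall j, spaceM (F j)) /\
    forall V : tensor R m n, symmetric_tensor V ->
      V t = \sum_j c j * tensor_pairing V (tensor_power (F j)).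
Proof.
pose M := (\sum_(a <- t) (a.1.2 + a.2).+1)%N.
have tM i : tnth t i \in box M.
  rewrite mem_box /M (big_rem (tnth t i)) ?mem_tnth//=; apply/andP; split; lia.
(* The index holds two choices: for each factor one of the two basis matrices that make up a matrix
   unit, and a subset of the factors for polarization. *)
pose g (j : {ffun 'I_n -> bool} * {ffun 'I_n -> bool}) i a : R :=
  (j.2 i)%:R * delta_pos (basis_pos (tnth t i) (j.1 i)) a.
have g0 j i a : a \notin box M -> g j i a = 0.
  rewrite /g /delta_pos => aM; case: eqP aM => [->|]; rewrite ?mulr0//.
  by rewrite /basis_pos; case: (j.1 i); rewrite ?transpose_box tM.
pose F j := of_coord (fun a => (\sum_i g j i a)%:C).
have bF j : boxed M (F j) by apply: boxed_of_coord => a aM; rewrite big1// => i _; apply: g0.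
exists ({ffun 'I_n -> bool} * {ffun 'I_n -> bool})%type.
exists (fun j : {ffun 'I_n -> bool} * {ffun 'I_n -> bool} => (n`!%:R)^-1 * (\prod_i basis_coef (j.1 i)) * \prod_i (-1) ^+ (~~ j.2 i)).
exists F; split; first by move=> j; apply: sum_spaceM_coord (g0 j).
move=> V symV; have n0 : (n`!%:R : R[i]) != 0 by rewrite pnatr_eq0 -lt0n fact_gt0.
pose h (s : {ffun 'I_n -> bool}) i u :=
  entry (of_coord (fun c => (delta_pos (basis_pos (tnth t i) (s i)) c)%:C)) (transpose u).
transitivity (\sum_(s : {ffun 'I_n -> bool}) (\prod_i basis_coef (s i)) *
   \sum_(u <- tbox M n) V u * \prod_j h s j (tnth u j)).
  have tt : t \in tbox M n.
    by rewrite mem_tbox; apply/allP => a /tnthP[i ->]; apply: tM.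
  transitivity (\sum_(u <- tbox M n) V u * \prod_j (tnth u j == tnth t j)%:R).
    rewrite (bigD1_seq t tt (tbox_uniq _ _ _)) /= [X in _ = _ + X]big1.
      by rewrite addr0 big1 ?mulr1// => j _; rewrite eqxx.
    move=> u; rewrite eqEtuple negb_forall => /existsP[j /negbTE uj].
    by rewrite (bigD1 j)//= uj mul0r mulr0.
  under [RHS]eq_bigr => s _ do rewrite mulr_sumr.
  rewrite exchange_big /=; apply: eq_bigr => u _.
  under eq_bigr => j _ do rewrite -sum_basis_coef.
  rewrite bigA_distr_bigA /= mulr_sumr; apply: eq_bigr => s _.
  by rewrite big_split /= mulrCA.
rewrite -(pair_bigA _ (fun s e : {ffun 'I_n -> bool} => (n`!%:R)^-1 * (\prod_i basis_coef (s i)) *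
   (\prod_i (-1) ^+ (~~ e i)) * tensor_pairing V (tensor_power (F (s, e))))) /=.
apply: eq_bigr => s _; apply: (mulfI n0); rewrite mulrCA -polarize_symmetric//.
rewrite !mulr_sumr; apply: eq_bigr => e _.
rewrite (tensor_pairing_power _ (bF _)).
have -> : \sum_(u <- tbox M n) V u * \prod_(a <- u) (\sum_i (e i)%:R * h s i a)
   = \sum_(u <- tbox M n) V u * \prod_(a <- u) entry (F (s, e)) (transpose a).
  apply: eq_bigr => u _; congr (_ * _); apply: eq_bigr => a _.
  rewrite /h /F !entry_of_coord; under eq_bigr do rewrite entry_of_coord.
  rewrite !real_complex_sum !mulr_sumr -big_split mulr_suml; apply: eq_bigr => i _.
  by rewrite /g /= !rmorphM !rmorph_nat /=; ring.
by rewrite !mulrA mulfV// mul1r.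
Qed.

End symmetric_tensors.

Lemma cexp_pair (R : realType) (a b : R) : cexp (a +i* b) = (expR a)%:C * (cos b +i* sin b).
Proof. by []. Qed.

#[local] Opaque cexp.

Lemma ccvg_eventually (R : realType) (u : nat -> R[i]) (l : R[i]) (N : nat) :
  (forall n, (N <= n)%N -> u n = l) -> ccvg u l.
Proof.
move=> ul; apply/cvgrPdist_lt => e e0; exists N => // n /= Nn.
by rewrite ul// subrr normc0 subrr normr0.
Qed.

(** * The S-transform *)

Section L2_pairing.
Context d (T : measurableType d) (R : realType) (P : probability T R).
Implicit Types f g : T -> R[i].

Lemma hoelder_L2 f g : cmeasurable f -> cmeasurable g ->
  (L2norm P f < +oo)%E -> (L2norm P g < +oo)%E ->
  cintegrable P (fun x => f x * g x) /\
  normc (cintegral P (fun x => f x * g x)) <= 2 * (fine (L2norm P f) * fine (L2norm P g)).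
Proof.
move=> mf mg f2 g2.
have mnf := cmeas_normc mf; have mng := cmeas_normc mg.
have f2fin : L2norm P f \is a fin_num by rewrite ge0_fin_numE ?Lnorm_ge0.
have g2fin : L2norm P g \is a fin_num by rewrite ge0_fin_numE ?Lnorm_ge0.
have H : (\int[P]_x (normc (f x) * normc (g x))%:E <= L2norm P f * L2norm P g)%E.
  have := @hoelder _ _ _ P (fun x => normc (f x)) (fun x => normc (g x)) 2 2 mnf mng.
  rewrite Lnorm1; under eq_integral do rewrite /= ger0_norm ?mulr_ge0 ?normc_ge0//.
  by apply => //; lra.
have ifg : cintegrable P (fun x => f x * g x).
  apply: (cintegrable_of_le (c := fine (L2norm P f) * fine (L2norm P g))).
    exact: cmeasM.
  under eq_integral do rewrite normcM.
  by rewrite EFinM !fineK.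
split => //; apply: le_trans (normc_cintegral ifg (integrable_normc ifg) (fun=> lexx _)) _.
rewrite ler_pM2l// -lee_fin EFinM !fineK//.
apply: le_trans H.
  by under eq_integral do rewrite /= normcM.
exact: (integrable_fin_num measurableT (integrable_normc ifg)).
Qed.

Lemma cvg_L2_pairing (u : nat -> T -> R[i]) f g :
  (forall n, cmeasurable (u n)) -> (forall n, cintegrable P (fun x => u n x * g x)) ->
  square_integrable P f -> square_integrable P g -> cvg_L2 P u f ->
  ccvg (fun n => cintegral P (fun x => u n x * g x)) (cintegral P (fun x => f x * g x)).
Proof.
move=> mu iu [f1 f2 f3] [g1 g2 g3] uf.
have mf : cmeasurable f by []. have mg : cmeasurable g by [].
have [ifg _] := hoelder_L2 mf mg f3 g3.
have ufin := uf; move/fine_cvgP : ufin => [ufin ulim].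
apply: (@squeeze_cvgr _ _ _ _ (fun=> 0)
  (fun n => 2 * (fine (L2norm P (fun x => u n x - f x)) * fine (L2norm P g)))).
- near=> n; rewrite normc_ge0 andTb.
  have -> : cintegral P (fun x => u n x * g x) - cintegral P (fun x => f x * g x)
     = cintegral P (fun x => (u n x - f x) * g x).
    by rewrite -cintegralB//; congr cintegral; apply/funext => x; rewrite mulrBl.
  have nfin : L2norm P (fun x => u n x - f x) \is a fin_num by near: n; exact: ufin.
  have nlty : (L2norm P (fun x => (u n x - f x)%R) < +oo)%E.
    by rewrite -ge0_fin_numE ?Lnorm_ge0.
  by have [] := hoelder_L2 (cmeasB (mu n) mf) mg nlty g3.
- exact: cvg_cst.
- rewrite [X in _ --> X](_ : 0 = 2 * (0 * fine (L2norm P g))); last by rewrite mul0r mulr0.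
  by apply: cvgMc; apply: cvgM => //; apply: cvg_cst.
Unshelve. all: by end_near. Qed.

Lemma square_integrable_dom f (h : T -> R) : cmeasurable f ->
  P.-integrable setT (EFin \o h) -> (forall x, normc (f x) ^+ 2 <= h x) ->
  square_integrable P f.
Proof.
move=> mf ih fh; have [f1 f2] := mf; split => //.
have i2 : P.-integrable setT (EFin \o (fun x => normc (f x) ^+ 2)).
  apply: (dominated_integrable _ ih).
    by apply: measurable_funX; apply: cmeas_normc.
  by move=> x; rewrite ger0_norm ?sqr_ge0.
have := integrable_fin_num measurableT i2.
have -> : (\int[P]_x (EFin \o (fun x => (normc (f x) ^+ 2)%R)) x = L2norm P f `^ 2)%E.
  rewrite /L2norm powR_Lnorm ?pnatr_eq0//; apply: eq_integral => x _ /=.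
  by rewrite ger0_norm ?normc_ge0// powR_mulrn ?normc_ge0.
rewrite ltey; apply: contraTneq => ->.
by rewrite poweRyr// pnatr_eq0.
Qed.

End L2_pairing.

(** * Wick exponentials and the power series of the S-transform *)

Section wick_exponential.
Variables (R : realType) (m : nat) (mu : probability (dualM R m) R).
Hypothesis gaussian_mu : standard_gaussian mu.
Local Notation position := (position m).
Local Notation transpose := (@transpose m).
Implicit Types (A : dualM R m) (xi : cmatrices R m).

Let mrc := @measurable_rcoord R m.
Let chr := char_rcoord gaussian_mu.

Lemma pairing_rcoord M A xi : boxed M xi ->
  pairing A xi = \sum_(a <- box M) coord xi a * (rcoord a A)%:C.
Proof.
move=> bx; rewrite (pairing_coord _ bx); apply: eq_bigr => a _.
by rewrite coord_dualM.
Qed.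

Definition wexp xi A : R[i] := cexp (pairing A xi - inner xi xi / 2).

Lemma wexpE xi A : wexp xi A = cexp (- (inner xi xi / 2)) * cexp (pairing A xi).
Proof. by rewrite -cexpD addrC. Qed.

Lemma cmeas_pairing M xi : boxed M xi -> cmeasurable (fun A => pairing A xi).
Proof.
move=> bx; under eq_fun do rewrite (pairing_rcoord _ bx).
exact: (@cmeas_linear _ _ _ _ _ mrc _ xpredT).
Qed.

Lemma exp_integrable_pairing M xi eta : boxed M xi -> boxed M eta ->
  exp_integrable mu (fun A => pairing A eta) (fun A => cexp (pairing A xi)).
Proof.
move=> bx be; have := exp_integrable_linear mrc chr (box M) xpredT xpredT (coord xi) (coord eta).
by congr exp_integrable; apply/funext => A; rewrite ?(pairing_rcoord _ bx) ?(pairing_rcoord _ be).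
Qed.

Lemma cmeas_wexp M xi : boxed M xi -> cmeasurable (wexp xi).
Proof.
move=> bx; apply: cmeas_cexp; apply: cmeasB; last exact: cmeas_cst.
exact: cmeas_pairing bx.
Qed.

Lemma square_integrable_wexp M xi : boxed M xi -> square_integrable mu (wexp xi).
Proof.
move=> bx.
have := cintegrable_cexp (exp_integrable_pairing bx bx) 1.
under eq_fun do rewrite mul1r -cexpD.
move=> i2; pose c := normc (cexp (- (inner xi xi / 2))) ^+ 2.
apply: (square_integrable_dom (h := fun A => c * normc (cexp (pairing A xi + pairing A xi)))).
- exact: cmeas_wexp bx.
- apply: (@integrableZl _ _ _ mu setT measurableT c
    (fun A => (normc (cexp (pairing A xi + pairing A xi)))%:E)).
  exact: integrable_normc i2.
- move=> A; rewrite wexpE cexpD; set u := cexp (pairing A xi); rewrite /c.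
  have -> : normc (u * u) = normc u ^+ 2 by rewrite normcM.
  by rewrite -exprMn -normcM.
Qed.

Lemma tensor_power_symmetric n xi : symmetric_tensor (tensor_power (n := n) xi).
Proof. by move=> s t /(perm_big _); apply. Qed.

Lemma inner_linear M xi (F : cmatrices R m) (t : R[i]) : boxed M xi -> boxed M F ->
  \sum_(a <- box M) (coord xi a + t * coord F a) ^+ 2
  = inner xi xi + 2 * t * pairing xi F + t ^+ 2 * inner F F.
Proof.
move=> bx bF; rewrite (inner_coord _ bx) (inner_coord _ bF) (pairing_coord _ bF).
rewrite !mulr_sumr -!big_split; apply: eq_bigr => a _ /=; ring.
Qed.

(** Weighted by exp<A,xi>, the pairing <A,F> has the exponential moments of a normal variable with
    mean <xi,F> and variance (F,F). A Hermite polynomial whose parameter is the variance has a power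
    of the mean as its expectation. *)
Lemma wick_hermite_expectation M xi (F : cmatrices R m) n :
  boxed M xi -> spaceM F -> boxed M F ->
  cintegrable mu (fun A => cexp (pairing A xi) * hermite (pairing A F) (inner F F) n) /\
  cintegral mu (fun A => cexp (pairing A xi) * hermite (pairing A F) (inner F F) n)
  = cexp (inner xi xi / 2) * pairing xi F ^+ n.
Proof.
move=> bx sF bF; have iXY := exp_integrable_pairing bx bF.
split; first exact: cintegrable_hermite.
rewrite (cintegral_hermite (C := cexp (inner xi xi / 2)) (a := pairing xi F)
  (b := - inner F F) iXY) => [|t]; first by rewrite addNr hermite_s0.
pose z a := coord xi a + t%:C * coord F a.
have -> : (fun A => cexp (pairing A xi) * cexp (t%:C * pairing A F))
  = (fun A => cexp (\sum_(a <- box M) z a * (rcoord a A)%:C)).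
  apply/funext => A; rewrite (pairing_rcoord _ bx) (pairing_rcoord _ bF) -cexpD mulr_sumr -big_split.
  by congr cexp; apply: eq_bigr => a _; rewrite mulrDl mulrA.
rewrite (gaussian_linear mrc chr _ (box_uniq _ _)) (inner_linear _ bx bF) -cexpD.
by congr cexp; field.
Qed.

(** The coefficients that recover an entry of a symmetric tensor from its pairings are the same for
    all tensors. Used for the Wick power and for the tensor power of [xi], they give both formulas
    with common [c] and [F]. *)
Lemma wick_coef n (t : n.-tuple position) :
  exists (J : finType) (c : J -> R[i]) (F : J -> cmatrices R m),
    [/\ forall j, spaceM (F j),
        forall A, wick A n t = \sum_j c j * hermite (pairing A (F j)) (inner (F j) (F j)) n &
        forall xi, (\prod_(a <- t) entry xi a = \sum_j c j * pairing xi (F j) ^+ n)].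
Proof.
have [J [c [F [sF cF]]]] := symmetric_tensor_coef R t.
exists J, c, F; split => // [A|xi].
  rewrite cF; last exact: wick_symmetric.
  by apply: eq_bigr => j _; rewrite wick_pairing.
have := cF _ (@tensor_power_symmetric n xi); rewrite {1}/tensor_power => ->.
apply: eq_bigr => j _; have [M bF] := spaceM_boxed (sF j).
rewrite (tensor_pairing_power _ bF) (pairing_box _ bF) -sum_tbox_prod; congr (_ * _).
by apply: eq_bigr => u _; rewrite big_split.
Qed.

Lemma cmeas_wick n (t : n.-tuple position) : cmeasurable (fun A => wick A n t).
Proof.
have [J [c [F [sF cF _]]]] := wick_coef t.
under eq_fun do rewrite cF.
apply: cmeas_sum => j _; apply: cmeasM; first exact: cmeas_cst.
by have [M bF] := spaceM_boxed (sF j); apply: cmeas_hermite; apply: cmeas_pairing bF.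
Qed.

Lemma wick_wexp M xi n (t : n.-tuple position) : boxed M xi ->
  cintegrable mu (fun A => wick A n t * wexp xi A) /\
  cintegral mu (fun A => wick A n t * wexp xi A) = \prod_(a <- t) entry xi a.
Proof.
move=> bx; have [J [c [F [sF cF cxi]]]] := wick_coef t.
pose K := cexp (- (inner xi xi / 2)).
have E : (fun A => wick A n t * wexp xi A) = (fun A => \sum_j (K * c j) *
    (cexp (pairing A xi) * hermite (pairing A (F j)) (inner (F j) (F j)) n)).
  by apply/funext => A; rewrite cF wexpE mulr_suml; apply: eq_bigr => j _; rewrite -/K; ring.
have H j : cintegrable mu (fun A => cexp (pairing A xi) *
    hermite (pairing A (F j)) (inner (F j) (F j)) n) /\
  cintegral mu (fun A => cexp (pairing A xi) * hermite (pairing A (F j)) (inner (F j) (F j)) n)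
  = cexp (inner xi xi / 2) * pairing xi (F j) ^+ n.
  have [N bF] := spaceM_boxed (sF j).
  by apply: (@wick_hermite_expectation (M + N)) => //;
    [apply: boxed_sub bx; rewrite leq_addr|apply: boxed_sub bF; rewrite leq_addl].
rewrite E; split.
  by apply: cintegrable_sum => j _; apply: cintegrableZ; case: (H j).
rewrite cintegral_sum => [|j _]; last by apply: cintegrableZ; case: (H j).
rewrite cxi; apply: eq_bigr => j _; have [iH eH] := H j.
rewrite cintegralZ// eH mulrACA -cexpD addNr cexp0 mul1r.
by [].
Qed.

Definition strans (f : dualM R m -> R[i]) xi : R[i] :=
  cintegral mu (fun A => f A * wexp xi A).

(** The pairing of the n-th tensor power of [xi] with [k]; it no longer depends on M once the box
    contains the support of [xi]. *)
Definition tsum M n xi (k : tensor R m n) : R[i] :=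
  \sum_(t <- tbox M n) (\prod_(a <- t) entry xi a) * k [tuple of map transpose t].

Lemma truncate_pairing M n (w k : tensor R m n) :
  tensor_pairing w (truncate M k)
  = \sum_(t <- tbox M n) w t * k [tuple of map transpose t].
Proof.
have inM (t : n.-tuple position) :
    all (fun a : position => (a.1.2 < M)%N && (a.2 < M)%N) [tuple of map transpose t]
    = (t \in tbox M n).
  rewrite mem_tbox all_map; apply: eq_all => a /=.
  by rewrite -[RHS]transpose_box mem_box.
rewrite (@tensor_pairing_box _ _ M) => [|t tM]; last first.
  by rewrite /truncate inM (negbTE tM).
by apply: eq_big_seq => t tM; rewrite /truncate inM tM.
Qed.

Lemma tsum_sub M N n xi (k : tensor R m n) : boxed M xi -> (M <= N)%N ->
  tsum N xi k = tsum M xi k.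
Proof.
move=> bx MN; have z t : t \notin tbox M n ->
    (\prod_(a <- t) entry xi a) * k [tuple of map transpose t] = 0.
  rewrite mem_tbox => /allPn[a at_ aM].
  by rewrite (big_rem a at_) /= bx// !mul0r.
rewrite /tsum -(fsum_seq (tbox_uniq _ M n) z) (fsum_seq (tbox_uniq _ N n))// => t tN.
apply: z; apply: contra tN; rewrite !mem_tbox => /allP tM.
by apply/allP => a /tM; apply: box_sub.
Qed.

(** The defining L^2-limit is tested against the square-integrable [wexp xi], and the tested
    sequence is constant as soon as the truncation contains the box of [xi]. *)
Lemma strans_wick_integral M n xi (k : tensor R m n) g : boxed M xi ->
  wick_integral mu k g -> strans g xi = tsum M xi k.
Proof.
move=> bx [g2 gk].
have E N : (fun A => tensor_pairing (wick A n) (truncate N k) * wexp xi A)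
   = (fun A => \sum_(t <- tbox N n) k [tuple of map transpose t] * (wick A n t * wexp xi A)).
  apply/funext => A; rewrite truncate_pairing mulr_suml.
  by apply: eq_bigr => t _; ring.
have i1 N : cintegrable mu (fun A => tensor_pairing (wick A n) (truncate N k) * wexp xi A).
  rewrite E; apply: cintegrable_sum => t _; apply: cintegrableZ.
  by case: (wick_wexp t bx).
have E2 N : cintegral mu (fun A => tensor_pairing (wick A n) (truncate N k) * wexp xi A)
   = tsum N xi k.
  rewrite E cintegral_sum => [|t _]; last by apply: cintegrableZ; case: (wick_wexp t bx).
  apply: eq_bigr => t _; have [i e] := wick_wexp t bx.
  by rewrite cintegralZ// e mulrC.
have mW N : cmeasurable (fun A => tensor_pairing (wick A n) (truncate N k)).
  under eq_fun do rewrite truncate_pairing.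
  by apply: cmeas_sum => t _; apply: cmeasM; [apply: cmeas_wick|apply: cmeas_cst].
have := cvg_L2_pairing mW i1 g2 (square_integrable_wexp bx) gk.
move=> /ccvg_unique; apply; apply: (@ccvg_eventually _ _ _ M) => N MN.
by rewrite E2 (tsum_sub _ bx).
Qed.

Lemma strans_chaos M f xi k : boxed M xi -> chaos_decomposition mu f k ->
  ccvg (fun N => \sum_(n < N) tsum M xi (k n)) (strans f xi).
Proof.
move=> bx [f2 symk [g gk gf]]; have [w1 w2 w3] := square_integrable_wexp bx.
have mw : cmeasurable (wexp xi) by [].
have ig n : cmeasurable (g n) /\ cintegrable mu (fun A => g n A * wexp xi A).
  have [[g1 g2 g3] _] := gk n; have mg : cmeasurable (g n) by [].
  by split => //; case: (hoelder_L2 mg mw g3 w3).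
have E N : (fun A => (\sum_(n < N) g n A) * wexp xi A)
   = (fun A => \sum_(n < N) g n A * wexp xi A).
  by apply/funext => A; rewrite mulr_suml.
have := @cvg_L2_pairing _ _ _ mu (fun N A => \sum_(n < N) g n A) f (wexp xi) _ _ f2
  (square_integrable_wexp bx) gf.
have -> : (fun N => cintegral mu (fun A => (\sum_(n < N) g n A) * wexp xi A))
   = (fun N => \sum_(n < N) tsum M xi (k n)).
  apply/funext => N; rewrite E cintegral_sum => [|n _]; last by case: (ig n).
  by apply: eq_bigr => n _; rewrite -(strans_wick_integral bx (gk n)).
apply=> N; first by apply: cmeas_sum => n _; case: (ig n).
by rewrite E; apply: cintegrable_sum => n _; case: (ig n).
Qed.

End wick_exponential.

(** * Cauchy-Schwarz and the bound of the S-transform by the Hida norm *)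

Section cauchy_schwarz.
Variables (R : realType) (I : Type).

Lemma cauchy_schwarz_sum (r : seq I) (x y : I -> R) :
  (\sum_(i <- r) x i * y i) ^+ 2 <= (\sum_(i <- r) x i ^+ 2) * (\sum_(i <- r) y i ^+ 2).
Proof.
elim: r => [|i r IH]; first by rewrite !big_nil expr0n mul0r.
rewrite !big_cons; move: IH.
have : 0 <= \sum_(j <- r) x j ^+ 2 by apply: sumr_ge0 => j _; apply: sqr_ge0.
have : 0 <= \sum_(j <- r) y j ^+ 2 by apply: sumr_ge0 => j _; apply: sqr_ge0.
move: (\sum_(j <- r) x j ^+ 2) (\sum_(j <- r) y j ^+ 2) (\sum_(j <- r) _ * _) => A B C.
move: (x i) (y i) => u v B0 A0 AB.
have Y0 : 0 <= A * v ^+ 2 + B * u ^+ 2 by rewrite addr_ge0// mulr_ge0// sqr_ge0.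
(* What remains is the inequality of means for A v^2 and B u^2, given C^2 <= A B. *)
suff : 2 * C * (u * v) <= A * v ^+ 2 + B * u ^+ 2 by nra.
have H : (2 * C * (u * v)) ^+ 2 <= (A * v ^+ 2 + B * u ^+ 2) ^+ 2.
  apply: (@le_trans _ _ (4 * (A * B) * (u * v) ^+ 2)).
    by rewrite exprMn ler_wpM2r ?sqr_ge0// exprMn (_ : 2 ^+ 2 = 4) ?ler_pM2l//; ring.
  by have := sqr_ge0 (A * v ^+ 2 - B * u ^+ 2); nra.
have [//|lt] := leP (2 * C * (u * v)) (A * v ^+ 2 + B * u ^+ 2).
have C0 : 0 <= 2 * C * (u * v) by rewrite ltW// (le_lt_trans Y0).
by move: H; rewrite ler_pXn2r ?nnegrE// leNgt lt.
Qed.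

End cauchy_schwarz.

Lemma normc_cauchy_schwarz (R : realType) (I : Type) (r : seq I) (x y : I -> R[i]) :
  normc (\sum_(i <- r) x i * y i) ^+ 2
  <= (\sum_(i <- r) normc (x i) ^+ 2) * (\sum_(i <- r) normc (y i) ^+ 2).
Proof.
apply: le_trans (cauchy_schwarz_sum r (fun i => normc (x i)) (fun i => normc (y i))).
rewrite ler_pXn2r ?nnegrE ?normc_ge0 ?sumr_ge0// => [|i _]; last by rewrite mulr_ge0 ?normc_ge0.
apply: le_trans (normc_sum _ _ _) _.
by apply: ler_sum => i _; rewrite normcM.
Qed.

Lemma normc_sqr_conj (R : realType) (z : R[i]) : normc z ^+ 2 = Re (z * z^*%C).
Proof.
case: z => x y; rewrite /= sqr_sqrtr ?addr_ge0 ?sqr_ge0//.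
by rewrite mulrN opprK !expr2.
Qed.

Lemma normc_sub_sqr (R : realType) (z w : R[i]) :
  normc (z - w) ^+ 2 = Re (z * z^*%C + w * w^*%C - 2 * (z * w^*%C)).
Proof.
rewrite normc_sqr_conj; case: z => a b; case: w => c d.
by rewrite -(rmorph_nat (real_complex R)) /=; ring.
Qed.

Lemma ccvg_Re (R : realType) (u : nat -> R[i]) l :
  ccvg u l -> Re (u n) @[n --> \oo] --> Re l.
Proof.
move=> ul; apply/cvgrPdist_le => e e0; move/cvgrPdist_le : ul => /(_ _ e0).
apply: filterS => n; rewrite sub0r normrN ger0_norm ?normc_ge0// normc_distC.
by apply: le_trans; rewrite -ReB; apply: Re_le_normc.
Qed.

Lemma ccvg_normc (R : realType) (u : nat -> R[i]) l :
  ccvg u l -> normc (u n) @[n --> \oo] --> normc l.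
Proof.
move=> ul; apply/cvgrPdist_le => e e0; move/cvgrPdist_le : ul => /(_ _ e0).
apply: filterS => n; rewrite sub0r normrN ger0_norm ?normc_ge0//; apply: le_trans.
have := le_normcD (u n - l) l; have := le_normcD (l - u n) (u n).
rewrite !subrK (normc_distC l) => h1 h2.
by rewrite ler_norml; apply/andP; split; lra.
Qed.

Section kernel_bounds.
Variables (R : realType) (m : nat).
Local Notation position := (position m).
Local Notation transpose := (@transpose m).
Local Notation one_weight := (fun _ _ : nat => 1%R : R).

Lemma sum_tbox_transpose M n (f : n.-tuple position -> R) :
  \sum_(t <- tbox M n) f [tuple of map transpose t] = \sum_(t <- tbox M n) f t.
Proof.
pose T (t : n.-tuple position) : n.-tuple position := [tuple of map transpose t].
have TK : involutive T.
  move=> t; apply: val_inj => /=; rewrite -map_comp map_id_in// => a _ /=.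
  by rewrite transposeK.
have p : perm_eq (map T (tbox M n)) (tbox M n).
  apply: uniq_perm; rewrite ?(map_inj_uniq (inv_inj TK)) ?tbox_uniq// => t.
  rewrite -{1}(TK t) (mem_map (inv_inj TK)) !mem_tbox all_map.
  by apply: eq_all => a /=; rewrite transpose_box.
by rewrite -[RHS](perm_big _ p) big_map.
Qed.

Lemma tensor_norm2_tbox M n (k : tensor R m n) :
  ((\sum_(t <- tbox M n) normc (k t) ^+ 2)%:E <= tensor_norm2 one_weight k)%E.
Proof.
apply: esum_ge; exists [set` tbox M n]; first by split => //; exact: finite_seq.
rewrite -fsbig_seq ?tbox_uniq// -sumEFin.
by apply: lee_sum => t _; rewrite big1 ?mul1r.
Qed.

Lemma kernel_partial_le M N q (k : kernel_family R m) (c : R) :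
  (kernel_norm one_weight q k <= c%:E)%E ->
  \sum_(n < N) n`!%:R * 2 ^+ (n * q) * (\sum_(t <- tbox M n) normc (k n t) ^+ 2) <= c ^+ 2.
Proof.
rewrite /kernel_norm; set S := (\sum_(_ <= _ <oo) _)%E => Sc.
have u0 n : (0 <= (n`!%:R * 2 ^+ (n * q))%:E * tensor_norm2 one_weight (k n))%E.
  apply: mule_ge0; first by rewrite lee_fin mulr_ge0// exprn_ge0.
  by apply: esum_ge0 => t _; rewrite lee_fin mulr_ge0 ?sqr_ge0// big1.
have S0 : (0 <= S)%E by apply: nneseries_ge0.
have c0 : 0 <= c by rewrite -lee_fin (le_trans _ Sc)// poweR_ge0.
have Sc2 : (S <= (c ^+ 2)%:E)%E.
  have -> : S = ((S `^ 2^-1) `^ 2)%E by rewrite -poweRrM mulVf// poweRe1.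
  apply: (@le_trans _ _ (c%:E `^ 2)%E).
    by apply: gt0_ler_poweR => //; rewrite in_itv /= ?poweR_ge0 ?lee_fin ?leey ?c0.
  by rewrite poweR_EFin powR_mulrn.
rewrite -lee_fin (le_trans _ Sc2)//.
apply: le_trans (nneseries_lim_ge N (fun n _ _ => u0 n)).
rewrite big_mkord -sumEFin; apply: lee_sum => n _.
rewrite [X in (X <= _)%E]EFinM lee_wpmul2l ?tensor_norm2_tbox//.
Qed.

End kernel_bounds.

Section strans_bound.
Variables (R : realType) (m : nat) (mu : probability (dualM R m) R).
Hypothesis gaussian_mu : standard_gaussian mu.
Local Notation position := (position m).
Implicit Types (xi eta : cmatrices R m).

Definition hprod M xi eta : R[i] := \sum_(a <- box M) entry xi a * (entry eta a)^*%C.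

(* The squared distance of a :exp<.,xi>: and b :exp<.,eta>: in the norm of degree
   weights r^n / n!, which is dual to the Hida norm when r = 2^-q. *)
Definition expdist (r : R) M (a b : R[i]) xi eta : R :=
  Re (a * a^*%C * cexp (r%:C * hprod M xi xi) + b * b^*%C * cexp (r%:C * hprod M eta eta)
      - 2 * (a * b^*%C * cexp (r%:C * hprod M xi eta))).

Lemma conj_prod n (t : n.-tuple position) xi :
  (\prod_(c <- t) entry xi c)^*%C = \prod_(c <- t) (entry xi c)^*%C.
Proof. exact: (rmorph_prod (conjc : {rmorphism R[i] -> R[i]})). Qed.

(** Both values pair the kernels with exponential vectors, so their combination is the pairing with
    one vector. Cauchy-Schwarz with weights n! 2^(n q), over tuples and then over degrees, splits
    off the norm of the kernels and leaves [expdist]. Bounding the two values separately would lose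
    the cancellation on which convergence rests. *)
Lemma strans_bound M q f k (c : R) (a b : R[i]) xi eta :
  boxed M xi -> boxed M eta -> chaos_decomposition mu f k ->
  (kernel_norm (fun _ _ => 1%R) q k <= c%:E)%E ->
  normc (a * strans mu f xi - b * strans mu f eta) ^+ 2
  <= c ^+ 2 * expdist ((2 ^+ q)^-1) M a b xi eta.
Proof.
move=> bx be fk kc.
pose r : R := (2 ^+ q)^-1.
pose p z n (t : n.-tuple position) : R[i] := \prod_(c <- t) entry z c.
(* At parameter 0, [hcoef z 0 n] is z^n / n!, so the Hermite series doubles as the exponential
   series. *)
pose D N := Re (\sum_(n < N) (a * a^*%C * hcoef (r%:C * hprod M xi xi) 0 n
   + b * b^*%C * hcoef (r%:C * hprod M eta eta) 0 n
   - 2 * (a * b^*%C * hcoef (r%:C * hprod M xi eta) 0 n))).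
pose U N := \sum_(n < N) (a * tsum M xi (k n) - b * tsum M eta (k n)).
have sx := strans_chaos gaussian_mu bx fk.
have se := strans_chaos gaussian_mu be fk.
have UD N : normc (U N) ^+ 2 <= c ^+ 2 * D N.
  pose x n (t : n.-tuple position) := a * p xi n t - b * p eta n t.
  pose y n (t : n.-tuple position) := k n [tuple of map (@transpose m) t].
  pose X n := \sum_(t <- tbox M n) normc (x n t) ^+ 2.
  pose Y n := \sum_(t <- tbox M n) normc (y n t) ^+ 2.
  pose w n : R := n`!%:R * 2 ^+ (n * q).
  have w0 n : 0 < w n by rewrite mulr_gt0 ?exprn_gt0// ltr0n fact_gt0.
  have X0 n : 0 <= X n by apply: sumr_ge0 => t _; apply: sqr_ge0.
  have Y0 n : 0 <= Y n by apply: sumr_ge0 => t _; apply: sqr_ge0.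
  have XD : D N = \sum_(n < N) Num.sqrt (X n / w n) ^+ 2.
    rewrite /D Re_sum; apply: eq_bigr => n _.
    rewrite sqr_sqrtr ?divr_ge0 ?(ltW (w0 _))//.
    have pp z z' : \sum_(t <- tbox M n) p z n t * (p z' n t)^*%C = hprod M z z' ^+ n.
      rewrite /hprod -sum_tbox_prod; apply: eq_bigr => t _.
      by rewrite conj_prod -big_split.
    have hh z : hcoef (r%:C * z) 0 n = ((w n)^-1)%:C * z ^+ n.
      have -> : ((w n)^-1)%:C = (n`!%:R)^-1 * r%:C ^+ n :> R[i].
        rewrite /w invfM rmorphM fmorphV rmorph_nat; congr (_ * _).
        by rewrite mulnC exprM -exprVn rmorphXn.
      by rewrite /hcoef hermite_s0 exprMn mulrA.
    have ReZ (s : R) z : Re (s%:C * z) = s * Re z by rewrite ReM /= mul0r subr0.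
    have -> : X n = Re (a * a^*%C * hprod M xi xi ^+ n + b * b^*%C * hprod M eta eta ^+ n
        - 2 * (a * b^*%C * hprod M xi eta ^+ n)).
      rewrite -!pp !mulr_sumr -big_split -sumrB Re_sum; apply: eq_bigr => t _.
      by rewrite normc_sub_sqr !rmorphM /=; congr Re; ring.
    by rewrite !hh [RHS]mulrC -ReZ; congr Re; ring.
  have Yc : \sum_(n < N) Num.sqrt (w n * Y n) ^+ 2 <= c ^+ 2.
    apply: le_trans (kernel_partial_le M N kc); apply: ler_sum => n _.
    rewrite sqr_sqrtr ?mulr_ge0 ?(ltW (w0 _))// /Y.
    by rewrite (sum_tbox_transpose M (fun t => normc (k n t) ^+ 2)).
  apply: (@le_trans _ _ ((\sum_(n < N) Num.sqrt (X n / w n) * Num.sqrt (w n * Y n)) ^+ 2)).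
    rewrite ler_pXn2r ?nnegrE ?normc_ge0 ?sumr_ge0//.
    apply: le_trans (normc_sum _ _ _) _; apply: ler_sum => n _.
    rewrite -sqrtrM ?divr_ge0 ?(ltW (w0 _))//.
    have -> : X n / w n * (w n * Y n) = X n * Y n by field; rewrite gt_eqF.
    have -> : a * tsum M xi (k n) - b * tsum M eta (k n) = \sum_(t <- tbox M n) x n t * y n t.
      by rewrite /tsum !mulr_sumr -sumrB; apply: eq_bigr => t _; rewrite /x /y /p; ring.
    rewrite -(ler_pXn2r (n := 2))// ?nnegrE ?normc_ge0 ?sqrtr_ge0// sqr_sqrtr ?mulr_ge0//.
    exact: normc_cauchy_schwarz.
  apply: le_trans (cauchy_schwarz_sum _ _ _) _.
  by rewrite XD mulrC ler_wpM2r// sumr_ge0// => n _; apply: sqr_ge0.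
have cU : ccvg U (a * strans mu f xi - b * strans mu f eta).
  have := ccvgD (ccvgZ a sx) (ccvgZ (- b) se).
  rewrite mulNr; apply: ccvg_ext => N; rewrite /U sumrB -!mulr_sumr mulNr.
  by [].
have cD : D N @[N --> \oo] --> expdist r M a b xi eta.
  apply: ccvg_Re; have hs (x : R[i]) : ccvg (fun N => \sum_(n < N) hcoef x 0 n) (cexp x).
    by have := @hcoef_series _ x 0; rewrite mul0r subr0.
  have := ccvgD (ccvgD (ccvgZ (a * a^*%C) (hs (r%:C * hprod M xi xi)))
    (ccvgZ (b * b^*%C) (hs (r%:C * hprod M eta eta))))
    (ccvgZ (- 2) (ccvgZ (a * b^*%C) (hs (r%:C * hprod M xi eta)))).
  rewrite mulNr; apply: ccvg_ext => N; rewrite sumrB big_split /= -!mulr_sumr mulNr.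
  by [].
have h : (fun N => c ^+ 2 * D N) @ \oo --> c ^+ 2 * expdist r M a b xi eta by exact: cvgMc.
have nU := ccvg_normc cU.
have nU2 : normc (U N) ^+ 2 @[N --> \oo] --> normc (a * strans mu f xi - b * strans mu f eta) ^+ 2.
  exact: (cvgM nU nU).
by apply: ler_cvg_to nU2 h _; near=> N; exact: UD.
Unshelve. all: by end_near. Qed.

End strans_bound.

(** * Differences of chaos decompositions *)

Section L2_sub.
Context d (T : measurableType d) (R : realType) (P : probability T R).
Implicit Types f g : T -> R[i].

Lemma L2norm_sub f g : cmeasurable f -> cmeasurable g ->
  (L2norm P (fun x => f x - g x)%R <= L2norm P f + L2norm P g)%E.
Proof.
move=> mf mg.
have mnf := cmeas_normc mf; have mng := cmeas_normc mg.
have := minkowski_EFin (p := 2) P mnf mng _.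
move=> /(_ ltac:(lra)); apply: le_trans.
have pos (h : T -> \bar R) : Lnorm P 2 h = ((Lnorm P 2 h `^ 2) `^ 2^-1)%E.
  by rewrite -poweRrM mulfV// poweRe1// Lnorm_ge0.
rewrite /L2norm pos [leRHS]pos; apply: gt0_ler_poweR.
- by rewrite invr_ge0.
- by rewrite in_itv /= poweR_ge0 leey.
- by rewrite in_itv /= poweR_ge0 leey.
have n2 : (2 : R) != 0 by rewrite pnatr_eq0.
rewrite !(powR_Lnorm _ _ n2).
have mX (h : T -> R) : measurable_fun setT h ->
    measurable_fun setT (fun x => (`|(h x)%:E| `^ 2)%E).
  move=> mh; under eq_fun do rewrite /= powR_mulrn//.
  by apply/measurable_EFinP; apply: measurable_funX; apply: measurableT_comp.
apply: ge0_le_integral => //.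
- by move=> x _; rewrite poweR_ge0.
- by apply: mX; apply: cmeas_normc; apply: cmeasB.
- by apply: mX; apply: measurable_funD.
move=> x _; rewrite /= lee_fin !powR_mulrn// ler_pXn2r ?nnegrE//.
rewrite !ger0_norm ?addr_ge0 ?normc_ge0//.
by apply: le_trans (le_normcD _ _) _; rewrite normcN.
Qed.

Lemma square_integrable_sub f g : square_integrable P f -> square_integrable P g ->
  square_integrable P (fun x => f x - g x).
Proof.
move=> [f1 f2 f3] [g1 g2 g3]; have mf : cmeasurable f by []. have mg : cmeasurable g by [].
have [m1 m2] := cmeasB mf mg; split => //.
by rewrite (le_lt_trans (L2norm_sub mf mg))// lte_add_pinfty.
Qed.

Lemma cvg_L2_sub (u v : nat -> T -> R[i]) f g :
  (forall n, cmeasurable (u n)) -> (forall n, cmeasurable (v n)) ->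
  cmeasurable f -> cmeasurable g -> cvg_L2 P u f -> cvg_L2 P v g ->
  cvg_L2 P (fun n x => u n x - v n x) (fun x => f x - g x).
Proof.
move=> mu mv mf mg uf vg.
have h : (L2norm P (fun x => (u n x - f x)%R) + L2norm P (fun x => (v n x - g x)%R))%E
   @[n --> \oo] --> (0 : \bar R)%E.
  by rewrite -[X in _ --> X](adde0 (0 : \bar R)%E); apply: cvgeD.
apply: (squeeze_cvge _ (cvg_cst 0%E) h).
near=> n; rewrite Lnorm_ge0 /=.
have -> : (fun x => u n x - v n x - (f x - g x)) = (fun x => (u n x - f x) - (v n x - g x)).
  by apply/funext => x; ring.
by apply: L2norm_sub; apply: cmeasB.
Unshelve. all: by end_near. Qed.

End L2_sub.

Section chaos_sub.
Variables (R : realType) (m : nat) (mu : probability (dualM R m) R).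
Local Notation position := (position m).

Lemma tensor_norm2_sub n (k l : tensor R m n) :
  (tensor_norm2 (fun _ _ => 1%R) k < +oo)%E -> (tensor_norm2 (fun _ _ => 1%R) l < +oo)%E ->
  (tensor_norm2 (fun _ _ => 1%R) (fun t => k t - l t)%R < +oo)%E.
Proof.
move=> kf lf; rewrite /tensor_norm2 in kf lf *.
pose u (j : tensor R m n) (t : n.-tuple position) : \bar R := ((\prod_(a <- t) 1) * normc (j t) ^+ 2)%:E.
have u0 j t : (0 <= u j t)%E by rewrite lee_fin big1// mul1r sqr_ge0.
have : (\esum_(t in [set: n.-tuple position]) (u k t + u l t + (u k t + u l t)) < +oo)%E.
  rewrite esumD ?esumD//; try by move=> t _; rewrite ?adde_ge0.
  by rewrite !lte_add_pinfty.
apply: le_lt_trans; apply: le_esum => t _.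
rewrite /u big1// !mul1r -!EFinD lee_fin.
have := le_normcD (k t) (- l t); rewrite normcN.
have := normc_ge0 (k t - l t); move: (normc _) (normc (k t)) (normc (l t)) => x y z x0 xyz.
have := sqr_ge0 (y - z); nra.
Qed.

Lemma wick_integral_sub n (k l : tensor R m n) f g : standard_gaussian mu ->
  wick_integral mu k f -> wick_integral mu l g ->
  wick_integral mu (fun t => k t - l t) (fun A => f A - g A).
Proof.
move=> gmu [f2 kf] [g2 lg]; split; first exact: square_integrable_sub.
have mW M (j : tensor R m n) : cmeasurable (fun A => tensor_pairing (wick A n) (truncate M j)).
  under eq_fun do rewrite truncate_pairing.
  by apply: cmeas_sum => t _; apply: cmeasM; [exact: cmeas_wick|apply: cmeas_cst].
have [f1 f1' _] := f2; have [g1 g1' _] := g2.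
have := cvg_L2_sub (mW^~ k) (mW^~ l) (conj f1 f1') (conj g1 g1') kf lg.
rewrite /cvg_L2; apply: cvg_trans; apply: near_eq_cvg; near=> M; congr L2norm; apply/funext => A.
congr (_ - _); rewrite !truncate_pairing -sumrB.
by apply: eq_bigr => t _; rewrite mulrBr.
Unshelve. all: by end_near. Qed.

(** Continuity of a Hida distribution involves the norm of a difference, read from a chosen kernel
    of that difference; a decomposition has to exist for the choice to be one. *)
Lemma chaos_sub f g k l : standard_gaussian mu ->
  chaos_decomposition mu f k -> chaos_decomposition mu g l ->
  chaos_decomposition mu (fun A => f A - g A) (fun n t => k n t - l n t).
Proof.
move=> gmu [f2 sk [F Fk Ff]] [g2 sl [G Gl Gg]]; split.
- exact: square_integrable_sub.
- move=> n; have [sk1 sk2] := sk n; have [sl1 sl2] := sl n; split.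
    by move=> s t st; rewrite (sk1 _ _ st) (sl1 _ _ st).
  exact: tensor_norm2_sub.
- exists (fun n A => F n A - G n A) => [n|]; first exact: wick_integral_sub.
  have [f1 f1' _] := f2; have [g1 g1' _] := g2.
  have mF N : cmeasurable (fun A => \sum_(n < N) F n A).
    by apply: cmeas_sum => n _; have [[]] := Fk n.
  have mG N : cmeasurable (fun A => \sum_(n < N) G n A).
    by apply: cmeas_sum => n _; have [[]] := Gl n.
  have := cvg_L2_sub mF mG (conj f1 f1') (conj g1 g1') Ff Gg.
  rewrite /cvg_L2; apply: cvg_trans; apply: near_eq_cvg; near=> N; congr L2norm; apply/funext => A.
  by rewrite sumrB.
Unshelve. all: by end_near. Qed.

Lemma chaos_kernelP f : chaos_decomposition mu f !=set0 ->
  chaos_decomposition mu f (chaos_kernel mu f).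
Proof. by move=> ?; exact: xgetPex. Qed.

End chaos_sub.

(** * Gaussian means of the S-transform *)

Section quadratic_form.
Variables (R : realType) (m : nat) (N : nat) (J : position m -> position m).
Hypotheses (JK : involutive J) (Jbox : forall a, (J a \in @box m N) = (a \in @box m N)).
Local Notation box := (@box m).
Implicit Types (B : dualM R m).

Lemma big_invol (T : Type) (idx : T) (op : Monoid.com_law idx) (Q : pred (position m))
    (f : position m -> T) :
  \big[op/idx]_(a <- box N | Q (J a)) f (J a) = \big[op/idx]_(a <- box N | Q a) f a.
Proof.
have p : perm_eq (map J (box N)) (box N).
  apply: uniq_perm; rewrite ?(map_inj_uniq (inv_inj JK)) ?box_uniq// => a.
  by rewrite -{1}(JK a) (mem_map (inv_inj JK)) Jbox.
by rewrite -[RHS](perm_big _ p) big_map.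
Qed.

Lemma sum_invol (V : nmodType) (f : position m -> V) :
  \sum_(a <- box N) f (J a) = \sum_(a <- box N) f a.
Proof. exact: (big_invol _ xpredT). Qed.

Lemma hprod_coord M (X Y : cmatrices R m) :
  hprod M X Y = \sum_(a <- box M) coord X a * (coord Y a)^*%C.
Proof.
pose Z : cmatrices R m := fun k i j => (Y k j i)^*%C.
rewrite /hprod; transitivity (\sum_(a <- box M) entry X a * entry Z (transpose a)) => //.
rewrite parseval; apply: eq_bigr => a _; congr (_ * _).
case: a => [[k i] j]; rewrite /coord /entry /= /Z.
by rewrite -(rmorph_nat (real_complex R)); case: (Y k i j) (Y k j i) => [u v] [u' v'] /=;
  apply: complex_eqP; rewrite /=; field.
Qed.

Definition rsqr B : R := \sum_(a <- box N) rcoord a B ^+ 2.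
Definition rcross B : R := \sum_(a <- box N) rcoord a B * rcoord (J a) B.

(* The matrix x P_N B + i y J P_N B. *)
Definition point (x y : R) B : cmatrices R m := of_coord (fun a =>
  if a \in box N then (x * rcoord a B)%:C + 'i%C * (y * rcoord (J a) B)%:C else 0).

Lemma boxed_point x y B : boxed N (point x y B).
Proof. by apply: boxed_of_coord => a /negbTE ->. Qed.

(** J permutes the box, so B and J B have the same sum of squares. The cross terms merge into a
    multiple of i that vanishes when (x, y) = (x', y'). *)
Lemma hprod_point x y x' y' B :
  hprod N (point x y B) (point x' y' B)
  = ((x * x' + y * y') * rsqr B)%:C + 'i%C * ((y * x' - x * y') * rcross B)%:C.
Proof.
have -> : (x * x' + y * y') * rsqr B = \sum_(a <- box N) (x * x' * rcoord a B ^+ 2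
   + y * y' * rcoord (J a) B ^+ 2).
  by rewrite big_split -!mulr_sumr (sum_invol (fun a => rcoord a B ^+ 2)) mulrDl.
rewrite hprod_coord /rcross mulr_sumr !real_complex_sum mulr_sumr -big_split.
apply: eq_big_seq => a aN; rewrite !of_coordK aN.
move: (rcoord a B) (rcoord (J a) B) => u v.
by apply: complex_eqP => /=; ring.
Qed.

Lemma rsqr_ge0 B : 0 <= rsqr B.
Proof. by apply: sumr_ge0 => a _; apply: sqr_ge0. Qed.

Lemma measurable_rsqr : measurable_fun setT rsqr.
Proof.
apply: measurable_sum => a; apply: measurable_funX; exact: measurable_rcoord.
Qed.

Lemma measurable_rcross : measurable_fun setT rcross.
Proof.
apply: measurable_sum => a; apply: measurable_funM; exact: measurable_rcoord.
Qed.

Variable mu : probability (dualM R m) R.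
Hypothesis gaussian_mu : standard_gaussian mu.

Let mrc := @measurable_rcoord R m.
Let chr := char_rcoord gaussian_mu.

Lemma integrable_exp_rsqr (c : R) : c < 1 ->
  mu.-integrable setT (EFin \o (fun B => expR (c / 2 * rsqr B))).
Proof.
move=> c1.
have [i _] := gaussian_quad mrc chr (fun=> 0) (box_uniq m N) (fun=> c1).
have := integrable_normc i; congr (_.-integrable _ _); apply/funext => B /=.
rewrite normc_cexp Re_sum; congr (expR _)%:E; rewrite mulr_sumr; apply: eq_bigr => a _.
by rewrite mul0r addr0.
Qed.

Lemma expdist_point r (k k' x y x' y' : R) B :
  expdist r N k%:C k'%:C (point x y B) (point x' y' B)
  = k ^+ 2 * expR (r * (x ^+ 2 + y ^+ 2) * rsqr B)
    + k' ^+ 2 * expR (r * (x' ^+ 2 + y' ^+ 2) * rsqr B)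
    - 2 * (k * k' * (expR (r * (x * x' + y * y') * rsqr B)
                     * cos (r * (y * x' - x * y') * rcross B))).
Proof.
have E (u v p t : R) : Re (u%:C * v%:C^*%C * cexp (r%:C * (p%:C + 'i%C * t%:C)))
    = u * v * (expR (r * p) * cos (r * t)).
  have -> : r%:C * (p%:C + 'i%C * t%:C) = (r * p) +i* (r * t) by apply: complex_eqP => /=; ring.
  by rewrite cexp_pair /=; ring.
rewrite /expdist !hprod_point ReB ReD (_ : 2 = 2%:C); last by rewrite rmorph_nat.
rewrite (ReM 2%:C) mul0r subr0 !E -!expr2 !mulrA.
rewrite (_ : y * x - x * y = 0); last by ring.
rewrite (_ : y' * x' - x' * y' = 0); last by ring.
by rewrite !(mulr0, mul0r, cos0, mulr1).
Qed.

(** The factor 4^-1 is 2^-q for q = 2. With x^2 + y^2 <= 2 all exponents are at most rsqr B / 2, so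
    the root of the distance is at most a multiple of exp(rsqr B / 4), which the Gaussian measure
    integrates. *)
Lemma expdist_point_le (k k' x y x' y' : R) B :
  0 <= k -> 0 <= k' -> x ^+ 2 + y ^+ 2 <= 2 -> x' ^+ 2 + y' ^+ 2 <= 2 ->
  expdist (4^-1) N k%:C k'%:C (point x y B) (point x' y' B)
  <= ((k + k') * expR (4^-1 * rsqr B)) ^+ 2.
Proof.
move=> k0 k'0 xy xy'; rewrite expdist_point.
have S0 := rsqr_ge0 B; set S := rsqr B in S0 *; set e := expR (4^-1 * S).
have e2 : e ^+ 2 = expR (2^-1 * S).
  by rewrite expr2 -expRD; congr expR; field.
have le_e (t : R) : t <= 2 -> expR (4^-1 * t * S) <= e ^+ 2.
  by move=> t2; rewrite e2 ler_expR; nra.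
have h1 := le_e _ xy; have h2 := le_e _ xy'.
have h3 : expR (4^-1 * (x * x' + y * y') * S) <= e ^+ 2.
  by apply: le_e; have := sqr_ge0 (x - x'); have := sqr_ge0 (y - y'); nra.
set c := cos _; have c1 : `|expR (4^-1 * (x * x' + y * y') * S) * c| <= e ^+ 2.
  rewrite normrM (ger0_norm (expR_ge0 _)) -[leRHS]mulr1 ler_pM ?expR_ge0//.
  by rewrite ler_norml cos_geN1 cos_le1.
move: c1; rewrite ler_norml => /andP[c1 _].
have kk : 0 <= k * k' by rewrite mulr_ge0.
rewrite exprMn.
have := ler_wpM2l (sqr_ge0 k) h1; have := ler_wpM2l (sqr_ge0 k') h2.
have := ler_wpM2l kk c1; nra.
Qed.

Lemma measurable_expdist_point r (k k' x y x' y' : R) :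
  measurable_fun setT (fun B => expdist r N k%:C k'%:C (point x y B) (point x' y' B)).
Proof.
under eq_fun do rewrite expdist_point.
have mE (c : R) : measurable_fun setT (fun B => expR (c * rsqr B)).
  by apply: measurableT_comp => //; apply: measurable_funM => //; exact: measurable_rsqr.
have mC (c : R) : measurable_fun setT (fun B => cos (c * rcross B)).
  apply: (measurableT_comp (continuous_measurable_fun (@continuous_cos R))).
  by apply: measurable_funM => //; exact: measurable_rcross.
by apply: measurable_funB; [apply: measurable_funD|]; repeat (apply: measurable_funM => //).
Qed.

Local Notation one_weight := (fun _ _ : nat => 1%R : R).

Lemma strans_point_dist f (h k k' x y x' y' : R) B :
  chaos_decomposition mu f !=set0 -> (hida_norm mu one_weight 2 f <= h%:E)%E ->
  normc (k%:C * strans mu f (point x y B) - k'%:C * strans mu f (point x' y' B))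
  <= h * Num.sqrt (expdist (4^-1) N k%:C k'%:C (point x y B) (point x' y' B)).
Proof.
move=> fk fh; have h0 : 0 <= h by rewrite -lee_fin (le_trans _ fh)// poweR_ge0.
have := strans_bound gaussian_mu k%:C k'%:C (boxed_point x y B) (boxed_point x' y' B) (chaos_kernelP fk) fh.
rewrite (_ : 2 ^- 2 = 4^-1 :> R); last by congr (_^-1); ring.
set D := expdist _ _ _ _ _ _ => H.
(* That [D] is nonnegative is read off from the bound itself, by dividing by h^2. *)
have [h00|hpos] := eqVneq h 0.
  move: H; rewrite h00 expr0n mul0r mul0r => H.
  by rewrite -(ler_pXn2r (n := 2))// ?nnegrE ?normc_ge0// expr0n.
have D0 : 0 <= D.
  by rewrite -(@pmulr_rge0 _ (h ^+ 2)) ?exprn_even_gt0// (le_trans _ H)// sqr_ge0.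
rewrite -(ler_pXn2r (n := 2))// ?nnegrE ?normc_ge0 ?mulr_ge0 ?sqrtr_ge0//.
have E : Num.sqrt D ^+ 2 = D by exact: sqr_sqrtr.
by rewrite [leRHS]exprMn E.
Qed.

Lemma strans_point_le f (h x y : R) B : x ^+ 2 + y ^+ 2 <= 2 ->
  chaos_decomposition mu f !=set0 -> (hida_norm mu one_weight 2 f <= h%:E)%E ->
  normc (strans mu f (point x y B)) <= h * expR (4^-1 * rsqr B).
Proof.
move=> xy fk fh; have h0 : 0 <= h by rewrite -lee_fin (le_trans _ fh)// poweR_ge0.
(* A single value is a difference whose second coefficient is 0. *)
have := @strans_point_dist f h 1 0 x y x y B fk fh.
rewrite mul0r subr0 mul1r => /le_trans; apply; rewrite ler_wpM2l//.
have := expdist_point_le B ler01 (lexx 0) xy xy; rewrite addr0 mul1r => e.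
rewrite -[leRHS]ger0_norm ?expR_ge0// -sqrtr_sqr.
by rewrite ler_wsqrtr.
Qed.

Lemma ccvg_cmeasurable (u : nat -> dualM R m -> R[i]) f : (forall n, cmeasurable (u n)) ->
  (forall A, ccvg (u^~ A) (f A)) -> cmeasurable f.
Proof.
move=> mu_ uf; split.
  apply: (measurable_fun_cvg (h := fun n A => Re (u n A))) => [n|A _]; first by case: (mu_ n).
  exact: ccvg_Re.
apply: (measurable_fun_cvg (h := fun n A => Im (u n A))) => [n|A _]; first by case: (mu_ n).
have Imi z : Im z = Re (- 'i%C * z) by case: z => a b /=; ring.
by under eq_fun do rewrite Imi; rewrite Imi; apply: ccvg_Re; apply: ccvgZ.
Qed.

Lemma cmeas_point x y a : cmeasurable (fun B => entry (point x y B) a).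
Proof.
have mc b : cmeasurable (fun B : dualM R m => if b \in box N
    then (x * rcoord b B)%:C + 'i%C * (y * rcoord (J b) B)%:C else 0).
  case: (b \in box N); last exact: cmeas_cst.
  apply: cmeasD; last (apply: cmeasM; first exact: cmeas_cst).
    by apply: cmeas_real; apply: measurable_funM => //; exact: measurable_rcoord.
  by apply: cmeas_real; apply: measurable_funM => //; exact: measurable_rcoord.
under eq_fun do rewrite entry_of_coord.
apply: cmeasM; last exact: cmeas_cst.
by apply: cmeasD; apply: cmeasM => //; exact: cmeas_cst.
Qed.

(** As a function of B this is a pointwise limit of polynomials in the coordinates of B. *)
Lemma cmeas_strans_point f x y : chaos_decomposition mu f !=set0 ->
  cmeasurable (fun B => strans mu f (point x y B)).
Proof.
move=> /chaos_kernelP fk.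
apply: ccvg_cmeasurable (fun B => strans_chaos gaussian_mu (boxed_point x y B) fk) => n.
apply: cmeas_sum => l _; apply: cmeas_sum => t _; apply: cmeasM; last exact: cmeas_cst.
by apply: cmeas_prod => a _; exact: cmeas_point.
Qed.
Definition gauss_mean (k x y : R) (f : dualM R m -> R[i]) : R[i] :=
  cintegral mu (fun B => k%:C * strans mu f (point x y B)).

Lemma weight1 : weight one_weight.
Proof. by split. Qed.

Lemma test_hida_norm f : test_function mu f ->
  chaos_decomposition mu f !=set0 /\ exists h, (hida_norm mu one_weight 2 f <= h%:E)%E.
Proof.
move=> [fk fn]; split => //; exists (fine (hida_norm mu one_weight 2 f)).
by rewrite fineK// ge0_fin_numE ?poweR_ge0// fn//; exact: weight1.
Qed.

Let iE : mu.-integrable setT (EFin \o (fun B => expR (4^-1 * rsqr B))).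
Proof.
have -> : 4^-1 = 2^-1 / 2 :> R by rewrite -invfM; congr (_^-1); ring.
by apply: integrable_exp_rsqr; lra.
Qed.

Let iZ (c : R) : mu.-integrable setT (EFin \o (fun B => c * expR (4^-1 * rsqr B))).
Proof. exact: (@integrableZl _ _ _ mu setT measurableT c (fun B => (expR (4^-1 * rsqr B))%:E)). Qed.

Lemma cintegrable_strans_point f (x y : R) : x ^+ 2 + y ^+ 2 <= 2 ->
  test_function mu f -> cintegrable mu (fun B => strans mu f (point x y B)).
Proof.
move=> xy /test_hida_norm[fk [h fh]].
apply: (cintegrable_dom (g := fun B => h * expR (4^-1 * rsqr B))) => //.
  exact: cmeas_strans_point.
by move=> B; apply: strans_point_le.
Qed.

Lemma strans_linear (a : R[i]) f g xi : boxed N xi -> square_integrable mu f ->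
  square_integrable mu g ->
  strans mu (fun A => a * f A + g A) xi = a * strans mu f xi + strans mu g xi.
Proof.
move=> bx [f1 f2 f3] [g1 g2 g3].
have [w1 w2 w3] := square_integrable_wexp gaussian_mu bx.
have [fi _] := hoelder_L2 (conj f1 f2) (conj w1 w2) f3 w3.
have [gi _] := hoelder_L2 (conj g1 g2) (conj w1 w2) g3 w3.
rewrite /strans -cintegralZ// -cintegralD//; last exact: cintegrableZ.
by congr cintegral; apply/funext => A; rewrite mulrDl mulrA.
Qed.

Lemma gauss_mean_linear k x y (a : R[i]) f g : x ^+ 2 + y ^+ 2 <= 2 ->
  test_function mu f -> test_function mu g ->
  gauss_mean k x y (fun A => a * f A + g A) = a * gauss_mean k x y f + gauss_mean k x y g.
Proof.
move=> xy tf tg; have fi := cintegrable_strans_point xy tf; have gi := cintegrable_strans_point xy tg.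
have [[? [f2 _ _]] _] := tf; have [[? [g2 _ _]] _] := tg.
rewrite /gauss_mean -cintegralZ; last exact: cintegrableZ.
rewrite -cintegralD; [|apply: cintegrableZ; exact: cintegrableZ|exact: cintegrableZ].
by congr cintegral; apply/funext => B; rewrite strans_linear//; [ring|exact: boxed_point].
Qed.

Lemma gauss_mean_continuous k x y f (e : R) : x ^+ 2 + y ^+ 2 <= 2 ->
  test_function mu f -> 0 < e ->
  exists p q, exists2 delta : R, weight p /\ 0 < delta &
      forall g, test_function mu g ->
        (hida_norm mu p q (fun A => (g A - f A)%R) < delta%:E)%E ->
        normc (gauss_mean k x y g - gauss_mean k x y f) < e.
Proof.
move=> xy tf e0; pose E := \int[mu]_B expR (4^-1 * rsqr B).
have E0 : 0 <= E by apply: Rintegral_ge0 => B _; exact: expR_ge0.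
(* The 2 is that of [normc_cintegral]; the added 1 keeps [K] positive and the final inequality
   strict. *)
pose K := 2 * (`|k| * E) + 1.
have K0 : 0 < K by rewrite ltr_wpDl// !mulr_ge0.
exists one_weight, 2%N, (e / K).
  by split; [exact: weight1|rewrite divr_gt0].
move=> g tg hg; pose h A := g A - f A.
have [fk _] := tf; have [gk _] := tg.
have hk : chaos_decomposition mu h !=set0.
  case: fk => l fl; case: gk => l' gl; eexists; exact: chaos_sub gaussian_mu gl fl.
have fi := cintegrable_strans_point xy tf; have gi := cintegrable_strans_point xy tg.
have [? [f2 _ _]] := fk; have [? [g2 _ _]] := gk.
have sE B : k%:C * strans mu g (point x y B) - k%:C * strans mu f (point x y B)
   = k%:C * strans mu h (point x y B).
  have := strans_linear (-1) (boxed_point x y B) f2 g2.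
  rewrite (_ : (fun A => _) = h); last by apply/funext => A; rewrite mulN1r addrC.
  by move=> ->; ring.
have -> : gauss_mean k x y g - gauss_mean k x y f
   = cintegral mu (fun B => k%:C * strans mu h (point x y B)).
  rewrite /gauss_mean -cintegralB; try exact: cintegrableZ.
  by congr cintegral; apply/funext => B; rewrite sE.
have hi : cintegrable mu (fun B => k%:C * strans mu h (point x y B)).
  have := cintegrableB (cintegrableZ k%:C gi) (cintegrableZ k%:C fi).
  by congr cintegrable; apply/funext => B; rewrite sE.
have bnd B : normc (k%:C * strans mu h (point x y B)) <= (`|k| * (e / K)) * expR (4^-1 * rsqr B).
  rewrite normcM normc_real -mulrA ler_wpM2l//.
  by apply: strans_point_le => //; exact: ltW.
have := normc_cintegral hi (iZ _) bnd; move=> /le_lt_trans; apply.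
rewrite RintegralZl// -/E.
have -> : 2 * (`|k| * (e / K) * E) = e * ((2 * (`|k| * E)) / K) by ring.
by rewrite gtr_pMr// ltr_pdivrMr// mul1r ltrDl.
Qed.

Definition hida_gauss_mean k x y (xy : x ^+ 2 + y ^+ 2 <= 2) : hida_distribution mu :=
  HidaDistribution (fun a f g => @gauss_mean_linear k x y a f g xy)
    (fun f e => @gauss_mean_continuous k x y f e xy).

Lemma gauss_mean_strong_cvg (k x y : R -> R) (xy : forall e, x e ^+ 2 + y e ^+ 2 <= 2) :
  (forall e, 0 <= k e <= k 0) -> {for 0, continuous k} ->
  {for 0, continuous x} -> {for 0, continuous y} ->
  strong_cvg_at0 (fun e => hida_gauss_mean (k e) (xy e)) (hida_gauss_mean (k 0) (xy 0)).
Proof.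
move=> k0 kc xc yc.
pose D e B := expdist (4^-1) N (k e)%:C (k 0)%:C (point (x e) (y e) B) (point (x 0) (y 0) B).
have k00 : 0 <= k 0 by have /andP[] := k0 0.
(* The bound [k e <= k 0] makes the dominating function independent of e. *)
have Dle e B : Num.sqrt (D e B) <= (k 0 + k 0) * expR (4^-1 * rsqr B).
  have /andP[ke0 kek] := k0 e.
  rewrite -[leRHS]ger0_norm ?mulr_ge0 ?addr_ge0 ?expR_ge0// -sqrtr_sqr ler_wsqrtr//.
  apply: le_trans (expdist_point_le B ke0 k00 (xy e) (xy 0)) _.
  by rewrite !exprMn ler_wpM2r ?sqr_ge0// ler_pXn2r ?nnegrE ?addr_ge0// lerD2r.
have mD e : measurable_fun setT (fun B => Num.sqrt (D e B)).
  apply: (measurableT_comp (continuous_measurable_fun (@sqrt_continuous R))).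
  exact: measurable_expdist_point.
have D0 : \int[mu]_B Num.sqrt (D e B) @[e --> 0^'+] --> (0 : R).
  apply/cvg_at_rightP => u [u0 uc].
  have -> : 0 = \int[mu]_B (fun=> 0 : R) B by rewrite Rintegral_cst// mul0r.
  apply: (dominated_Rintegral (g := fun B => (k 0 + k 0) * expR (4^-1 * rsqr B))) => //.
    (* Writing the limit 0 as the distance at e = 0 turns the claim into continuity in the
       parameters. *)
    move=> B; rewrite [X in _ --> X](_ : 0 = Num.sqrt (D 0 B)); last first.
      rewrite /D expdist_point; set S := rsqr B; set T := rcross B.
      rewrite (_ : y 0 * x 0 - x 0 * y 0 = 0); last by ring.
      rewrite mulr0 mul0r cos0 mulr1 -!expr2.
      by set u1 := expR _; rewrite (_ : _ - _ = 0) ?sqrtr0//; ring.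
    apply: (continuous_cvg _ (@sqrt_continuous R _)).
    rewrite /D; under eq_fun do rewrite expdist_point.
    rewrite expdist_point.
    have ku : k (u n) @[n --> \oo] --> k 0 by exact: continuous_cvg kc uc.
    have xu : x (u n) @[n --> \oo] --> x 0 by exact: continuous_cvg xc uc.
    have yu : y (u n) @[n --> \oo] --> y 0 by exact: continuous_cvg yc uc.
    have aC (a : nat -> R) (l S : R) : a n @[n --> \oo] --> l ->
        4^-1 * a n * S @[n --> \oo] --> 4^-1 * l * S.
      by move=> al; apply: cvgM; [apply: cvgMc|apply: cvg_cst].
    have eC (a : nat -> R) (l S : R) : a n @[n --> \oo] --> l ->
        expR (4^-1 * a n * S) @[n --> \oo] --> expR (4^-1 * l * S).
      by move=> al; apply: (continuous_cvg _ (@continuous_expR R _)); exact: aC.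
    have cC (a : nat -> R) (l S : R) : a n @[n --> \oo] --> l ->
        cos (4^-1 * a n * S) @[n --> \oo] --> cos (4^-1 * l * S).
      by move=> al; apply: (continuous_cvg _ (@continuous_cos R _)); exact: aC.
    have sqC (a : nat -> R) (l : R) : a n @[n --> \oo] --> l -> a n ^+ 2 @[n --> \oo] --> l ^+ 2.
      by move=> al; exact: (cvgM al al).
    have mC (a : nat -> R) (l c : R) : a n @[n --> \oo] --> l -> a n * c @[n --> \oo] --> l * c.
      by move=> al; apply: cvgM => //; exact: cvg_cst.
    apply: cvgB; first apply: cvgD.
    - apply: cvgM; first exact: sqC.
      by apply: eC; apply: cvgD; exact: sqC.
    - exact: cvg_cst.
    - apply: cvgMc; apply: cvgM; first exact: mC.
      apply: cvgM; first by apply: eC; apply: cvgD; exact: mC.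
      by apply: cC; apply: cvgB; exact: mC.
  by move=> n B; rewrite ger0_norm ?sqrtr_ge0// Dle.
apply/fam_cvgP => F [Ft Fb] P /uniform_nbhs[E [entE EP]].
move: entE; rewrite -entourage_from_ballE => -[e e0 eE].
have [c cF] := Fb one_weight 2%N weight1.
(* Radii of balls in [R[i]^o] are complex; a positive one has imaginary part zero. *)
have e1 : 0 < Re e by move: e0; rewrite /= ltcE => /andP[].
have e2 : (Re e)%:C = e by move: e0; rewrite /= ltcE; case: (e) => a b /= /andP[/eqP ->].
have cD : 2 * (`|c| * \int[mu]_B Num.sqrt (D e B)) @[e --> 0^'+] --> (0 : R).
  rewrite [X in _ --> X](_ : 0 = 2 * (`|c| * 0)); last by rewrite !mulr0.
  by apply: cvgM; [exact: cvg_cst|apply: cvgM => //; exact: cvg_cst].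
move/cvgr0Pnorm_lt : cD => /(_ _ e1); apply: filterS => h hlt.
apply: EP => f Ff; apply: eE => /=; rewrite -ball_normE /= -e2 normr_normc ltcR.
have tf := Ft _ Ff; have [fk _] := tf.
have fi t := cintegrable_strans_point (xy t) tf.
rewrite normc_distC /gauss_mean -cintegralB; try exact: cintegrableZ.
apply: le_lt_trans hlt.
apply: le_trans (ler_norm _).
have iD : mu.-integrable setT (EFin \o (fun B => Num.sqrt (D h B))).
  by apply: (dominated_integrable (mD h) (iZ _)) => B; rewrite ger0_norm ?sqrtr_ge0.
rewrite -RintegralZl//; apply: normc_cintegral.
- by apply: cintegrableB; exact: cintegrableZ.
- exact: (@integrableZl _ _ _ mu setT measurableT `|c| (fun B => (Num.sqrt (D h B))%:E)).
- move=> B; apply: strans_point_dist => //; apply: le_trans (cF _ Ff) _.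
  by rewrite lee_fin ler_norm.
Qed.

Definition csqr (F : cmatrices R m) : R[i] := \sum_(a <- box N) coord F a ^+ 2.
Definition ccross (F : cmatrices R m) : R[i] := \sum_(a <- box N) coord F a * coord F (J a).

Lemma strans_cexp M F xi : boxed M F -> boxed M xi ->
  strans mu (fun A => cexp ('i%C * pairing A F)) xi
  = cexp ('i%C * pairing xi F - inner F F / 2).
Proof.
move=> bF bx.
have E (A : dualM R m) : cexp ('i%C * pairing A F) * wexp xi A = cexp (- (inner xi xi / 2)) *
    cexp (\sum_(a <- box M) (coord xi a + 'i%C * coord F a) * (rcoord a A)%:C).
  rewrite wexpE -!cexpD; congr cexp; rewrite addrCA; congr (_ + _).
  rewrite (pairing_rcoord _ bF) (pairing_rcoord _ bx) mulr_sumr -big_split.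
  by apply: eq_bigr => a _ /=; ring.
rewrite /strans; under eq_fun do rewrite E.
rewrite cintegralZ; last exact: (cintegrable_linear mrc chr).
rewrite (gaussian_linear mrc chr _ (box_uniq _ _)) (inner_linear _ bx bF) -cexpD.
by congr cexp; rewrite sqr_i; field.
Qed.

Lemma pairing_point M x y B F : boxed M F ->
  'i%C * pairing (point x y B) F
  = \sum_(a <- box N) ('i%C * x%:C * coord F a - y%:C * coord F (J a)) * (rcoord a B)%:C.
Proof.
move=> bF; pose K := (M + N)%N.
have bF' : boxed K F by apply: boxed_sub bF; exact: leq_addr.
have bp := boxed_point x y B.
have bp' : boxed K (point x y B) by apply: boxed_sub bp; exact: leq_addl.
have -> : pairing (point x y B) F = \sum_(a <- box N) coord F a * coord (point x y B) a.
  rewrite -(inner_coord _ bp) -(inner_pairing _ bF') (inner_coord _ bF') (inner_coord _ bp').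
  by apply: eq_bigr => a _; rewrite mulrC.
transitivity (\sum_(a <- box N) ('i%C * x%:C * coord F a * (rcoord a B)%:C
   + - (y%:C * coord F (J (J a)) * (rcoord (J a) B)%:C))).
  rewrite mulr_sumr; apply: eq_big_seq => a aN; rewrite of_coordK aN JK !rmorphM.
  have i2 : 'i%C * 'i%C = -1 :> R[i] by rewrite -expr2 sqr_i.
  rewrite [LHS](_ : _ = 'i%C * x%:C * coord F a * (rcoord a B)%:C +
    'i%C * 'i%C * (y%:C * coord F a * (rcoord (J a) B)%:C)); last by ring.
  by rewrite i2 mulN1r.
rewrite big_split /= (sum_invol (fun a => - (y%:C * coord F (J a) * (rcoord a B)%:C))).
by rewrite -big_split; apply: eq_bigr => a _ /=; ring.
Qed.

(** A Gaussian mean of a linear exponent with coefficients i x F_a - y F_(J a). Their squares sum to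
    (y^2 - x^2) [csqr F] - 2 i x y [ccross F], since J preserves the sum of squares. *)
Lemma gauss_mean_cexp M k x y F : boxed M F ->
  gauss_mean k x y (fun A => cexp ('i%C * pairing A F))
  = k%:C * (cexp (- (inner F F / 2))
    * cexp ((y ^+ 2 - x ^+ 2)%:C / 2 * csqr F - 'i%C * (x * y)%:C * ccross F)).
Proof.
move=> bF; pose K := (M + N)%N.
have bF' : boxed K F by apply: boxed_sub bF; exact: leq_addr.
have E B : k%:C * strans mu (fun A => cexp ('i%C * pairing A F)) (point x y B)
  = (k%:C * cexp (- (inner F F / 2))) * cexp (\sum_(a <- box N)
     ('i%C * x%:C * coord F a - y%:C * coord F (J a)) * (rcoord a B)%:C).
  rewrite (strans_cexp bF'); last by apply: boxed_sub (boxed_point _ _ _); exact: leq_addl.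
  by rewrite (pairing_point _ _ _ bF) cexpD [X in k%:C * X]mulrC mulrA.
rewrite /gauss_mean; under eq_fun do rewrite E.
rewrite cintegralZ; last exact: (cintegrable_linear mrc chr).
rewrite (gaussian_linear mrc chr _ (box_uniq _ _)) mulrA; congr (_ * cexp _).
have i2 : 'i%C * 'i%C = -1 :> R[i] by rewrite -expr2 sqr_i.
transitivity (((y ^+ 2)%:C * (\sum_(a <- box N) coord F (J a) ^+ 2) - (x ^+ 2)%:C * csqr F
   - 2 * ('i%C * (x * y)%:C) * ccross F) / 2).
  rewrite /csqr /ccross !mulr_sumr -!sumrB; congr (_ / 2); apply: eq_bigr => a _.
  rewrite !rmorphM [LHS](_ : _ = 'i%C * 'i%C * (x%:C ^+ 2 * coord F a ^+ 2)
    + y%:C ^+ 2 * coord F (J a) ^+ 2 - 2 * ('i%C * (x%:C * y%:C)) * (coord F a * coord F (J a))); last by ring.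
  by rewrite i2; ring.
rewrite (sum_invol (fun a => coord F a ^+ 2)) -/(csqr F) rmorphB; by field.
Qed.
Lemma big_box_restrict (T : Type) (idx : T) (op : Monoid.com_law idx) M (f : position m -> T) :
  (N <= M)%N ->
  \big[op/idx]_(a <- box M) (if a \in box N then f a else idx) = \big[op/idx]_(a <- box N) f a.
Proof.
move=> NM; rewrite -big_mkcond -big_filter; apply: perm_big.
apply: uniq_perm; rewrite ?filter_uniq ?box_uniq// => a.
rewrite mem_filter andb_idr//; exact: box_sub.
Qed.

(** * The regularized function as an iterated Gaussian integral over pairs of coordinates *)

Variable U : pred (position m).
Hypothesis UJ : forall a, U (J a) = ~~ U a.

Lemma big_half (T : Type) (idx : T) (op : Monoid.com_law idx) (f : position m -> T) :
  \big[op/idx]_(a <- box N) f a = \big[op/idx]_(a <- box N | U a) op (f a) (f (J a)).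
Proof.
rewrite (bigID U) /= big_split -(big_invol _ (fun a => ~~ U a)); congr (op _ _).
by apply: eq_bigl => a; rewrite UJ negbK.
Qed.

Lemma real_complex_half (x : R) : (x / 2)%:C = x%:C / 2 :> R[i].
Proof. by rewrite rmorphM fmorphV rmorph_nat. Qed.

Lemma divc_half (z : R[i]) (r : R) : z / r%:C / 2 = z * (r^-1 / 2)%:C.
Proof. by rewrite real_complex_half fmorphV mulrA. Qed.

Lemma gaussian_linear_real (w : position m -> R) :
  (\int[mu]_B (expR (\sum_(a <- box N) w a * rcoord a B))%:E
   = (expR ((\sum_(a <- box N) w a ^+ 2) / 2))%:E)%E.
Proof.
have E (B : dualM R m) : cexp (\sum_(a <- box N) (w a)%:C * (rcoord a B)%:C)
   = (expR (\sum_(a <- box N) w a * rcoord a B))%:C.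
  by rewrite -cexp_real real_complex_sum; congr cexp; apply: eq_bigr => a _; rewrite rmorphM.
have i := cintegrable_linear mrc chr (box N) (fun a => (w a)%:C).
have := gaussian_linear mrc chr (fun a => (w a)%:C) (box_uniq _ N).
have -> : (\sum_(a <- box N) (w a)%:C ^+ 2) / 2 = ((\sum_(a <- box N) w a ^+ 2) / 2)%:C :> R[i].
  rewrite real_complex_half real_complex_sum; congr (_ / _).
  by apply: eq_bigr => a _; rewrite rmorphXn.
rewrite cexp_real; move: i; under eq_fun do rewrite E; move=> [i _].
rewrite cintegral_real => /complexI <-.
by rewrite fineK//; apply: integrable_fin_num.
Qed.

(* For a pair u, v of coordinates exchanged by J, exp(i u v) is the mean of
   exp((u / s + i s v) B - (u^2 / s^2 - s^2 v^2) / 2) over an auxiliary standard normal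
   variable B.  This leaves real quadratic forms in u, v, which are diagonal, and
   with s^2 = eps / 2 both have a coefficient below 1 in front of u^2/2 and v^2/2. *)
Section oscillating_quadratic.
Variables (eps : R) (M : nat) (F : cmatrices R m).
Hypotheses (eps0 : 0 < eps) (NM : (N <= M)%N) (bF : boxed M F) (hF : is_hermitian F).

Let s := Num.sqrt (eps / 2).

Let s2 : s ^+ 2 = eps / 2.
Proof. by rewrite sqr_sqrtr// divr_ge0// ltW. Qed.

Let s0 : 0 < s.
Proof. by rewrite sqrtr_gt0 divr_gt0. Qed.

(** In each pair the mean over the auxiliary variable adds s^-2 to the coefficient of u^2 / 2 and -
    s^2 to that of v^2 / 2. Subtracting this from 1 - eps leaves the two values. *)
Let cA a : R := if a \in box N then if U a then 1 - eps - 2 / eps else 1 - eps / 2 else 0.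

Let cA1E (b : bool) : (if b then 1 - eps - 2 / eps else 1 - eps / 2) < 1.
Proof.
case: b; last by rewrite gtrDl oppr_lt0 divr_gt0.
by rewrite -addrA gtrDl -opprD oppr_lt0 addr_gt0// divr_gt0.
Qed.

Let cA1 a : cA a < 1.
Proof. by rewrite /cA; case: ifP. Qed.

Let zA (B : dualM R m) a : R[i] := 'i%C * coord F a + if a \in box N then
  if U a then (s^-1 * rcoord a B)%:C else 'i%C * (s * rcoord (J a) B)%:C else 0.

Let wB (A : dualM R m) a : R[i] :=
  if U a then (s^-1 * rcoord a A)%:C + 'i%C * (s * rcoord (J a) A)%:C else 0.

Let pA (A : dualM R m) : R[i] :=
  \sum_(a <- box M) ((cA a / 2 * rcoord a A ^+ 2)%:C + 'i%C * coord F a * (rcoord a A)%:C).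

(** For fixed A the exponent is linear in B apart from the constant [pA A], with coefficients [wB];
    for fixed B it is quadratic in A, with linear coefficients [zA]. B is a second matrix under the
    product measure, and its coordinates in [U] are the auxiliary variables. *)
Let G (z : dualM R m * dualM R m) : R[i] :=
  cexp (pA z.1 + \sum_(a <- box N) wB z.1 a * (rcoord a z.2)%:C).

Let G_quad A B : G (A, B)
  = cexp (\sum_(a <- box M) ((cA a / 2 * rcoord a A ^+ 2)%:C + zA B a * (rcoord a A)%:C)).
Proof.
rewrite /G /=; congr cexp.
have -> : \sum_(a <- box N) wB A a * (rcoord a B)%:C
   = \sum_(a <- box M) (if a \in box N then
      (if U a then (s^-1 * rcoord a B)%:C else 'i%C * (s * rcoord (J a) B)%:C)
      * (rcoord a A)%:C else 0).
  rewrite big_box_restrict// [RHS]big_half [LHS](bigID U) /=.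
  rewrite [X in _ + X]big1 ?addr0 => [|a /negbTE aU]; last by rewrite /wB aU mul0r.
  apply: eq_bigr => a aU; rewrite /wB UJ aU JK /= !rmorphM; ring.
rewrite -big_split; apply: eq_bigr => a _; rewrite /zA /=.
by case: (a \in box N); rewrite ?addr0// mulrDl addrA.
Qed.

Let linear_part A : \sum_(a <- box N) wB A a ^+ 2
  = (\sum_(a <- box N | U a) (s ^- 2 * rcoord a A ^+ 2 - s ^+ 2 * rcoord (J a) A ^+ 2))%:C
    + 'i%C * (rcross A)%:C.
Proof.
have i2 : 'i%C * 'i%C = -1 :> R[i] by rewrite -expr2 sqr_i.
have sn : s != 0 by rewrite gt_eqF.
have -> : \sum_(a <- box N) wB A a ^+ 2 = \sum_(a <- box N | U a) wB A a ^+ 2.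
  rewrite [LHS](bigID U) /= [X in _ + X]big1 ?addr0// => a /negbTE aU.
  by rewrite /wB aU expr0n.
rewrite /rcross [X in 'i%C * X%:C]big_half.
rewrite !real_complex_sum mulr_sumr -big_split; apply: eq_bigr => a aU; rewrite /wB aU JK /=.
move: (rcoord a A) (rcoord (J a) A) => u v.
by apply: complex_eqP => /=; field.
Qed.

Let exponent A : pA A + (\sum_(a <- box N) wB A a ^+ 2) / 2
  = 'i%C * pairing A F + ((1 - eps) / 2 * rsqr A)%:C + 'i%C * (rcross A / 2)%:C.
Proof.
have sn : s != 0 by rewrite gt_eqF.
rewrite linear_part mulrDl addrA -mulrA -real_complex_half; congr (_ + _).
rewrite /pA big_split /= addrAC [RHS]addrC; congr (_ + _); last first.
  by rewrite (pairing_rcoord _ bF) mulr_sumr; apply: eq_bigr => a _; rewrite mulrA.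
rewrite -real_complex_sum -real_complex_half -rmorphD; congr (_%:C).
have -> : \sum_(a <- box M) cA a / 2 * rcoord a A ^+ 2
   = \sum_(a <- box M) (if a \in box N then (if U a then 1 - eps - 2 / eps else 1 - eps / 2)
      / 2 * rcoord a A ^+ 2 else 0).
  by apply: eq_bigr => a _; rewrite /cA; case: ifP => // _; rewrite !mul0r.
rewrite big_box_restrict// big_half /rsqr [in RHS]big_half mulr_suml mulr_sumr -big_split.
apply: eq_bigr => a aU; rewrite UJ aU /= s2.
move: (rcoord a A) (rcoord (J a) A) => u v; field; exact: lt0r_neq0.
Qed.

Let inner_integral A : cintegral mu (fun B => G (A, B))
  = cexp ('i%C * pairing A F) * cexp (((1 - eps) / 2 * rsqr A)%:C + 'i%C * (rcross A / 2)%:C).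
Proof.
under eq_fun do rewrite /G /= cexpD.
rewrite cintegralZ; last exact: (cintegrable_linear mrc chr).
by rewrite (gaussian_linear mrc chr _ (box_uniq _ _)) -!cexpD exponent addrA.
Qed.

Let mG : cmeasurable G.
Proof.
have m1 (f : dualM R m -> R[i]) : cmeasurable f -> cmeasurable (fun z : dualM R m * dualM R m => f z.1).
  by move=> [f1 f2]; split; [exact: (measurableT_comp f1)|exact: (measurableT_comp f2)].
have m2 (f : dualM R m -> R[i]) : cmeasurable f -> cmeasurable (fun z : dualM R m * dualM R m => f z.2).
  by move=> [f1 f2]; split; [exact: (measurableT_comp f1)|exact: (measurableT_comp f2)].
have mr (c : R) a : cmeasurable (fun A => (c * rcoord a A)%:C).
  by apply: cmeas_real; apply: measurable_funM => //; exact: measurable_rcoord.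
apply: cmeas_cexp; apply: cmeasD.
  apply: (m1 pA); apply: cmeas_sum => a _; apply: cmeasD.
    apply: cmeas_real; apply: measurable_funM => //; apply: measurable_funX.
    exact: measurable_rcoord.
  by apply: cmeasM; [exact: cmeas_cst|apply: cmeas_real; exact: measurable_rcoord].
apply: cmeas_sum => a _; apply: cmeasM.
  apply: (m1 (fun A => wB A a)); rewrite /wB; case: (U a); last exact: cmeas_cst.
  by apply: cmeasD => //; apply: cmeasM => //; exact: cmeas_cst.
by apply: (m2 (fun A => (rcoord a A)%:C)); apply: cmeas_real; exact: measurable_rcoord.
Qed.

(** For Hermitian F the term i<A,F> is imaginary, as is the v-part of [wB]. Averaging |G| over B
    thus cancels the 2 / eps and leaves the coefficients 1 - eps for u^2 / 2 and 1 - eps / 2 for v^2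
    / 2. *)
Let G_bound A : (\int[mu]_B (normc (G (A, B)))%:E <= (expR ((1 - eps / 2) / 2 * rsqr A))%:E)%E.
Proof.
have sn : s != 0 by rewrite gt_eqF.
pose w a := if U a then s^-1 * rcoord a A else 0.
have rw a : Re (wB A a) = w a.
  by rewrite /wB /w; case: (U a) => //=; ring.
have nG B : normc (G (A, B)) = expR (Re (pA A)) * expR (\sum_(a <- box N) w a * rcoord a B).
  rewrite /G /= normc_cexp ReD expRD; congr (_ * expR _); rewrite Re_sum.
  by apply: eq_bigr => a _; rewrite ReM /= mulr0 subr0 rw.
under eq_integral do rewrite nG EFinM.
rewrite ge0_integralZl//; last first.
  apply/measurable_EFinP; apply: measurableT_comp => //; apply: measurable_sum => a.
  by apply: measurable_funM => //; exact: measurable_rcoord.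
rewrite gaussian_linear_real -EFinM lee_fin -expRD ler_expR.
have -> : Re (pA A) = \sum_(a <- box M) (if a \in box N then
    (if U a then 1 - eps - 2 / eps else 1 - eps / 2) / 2 * rcoord a A ^+ 2 else 0).
  rewrite /pA Re_sum; apply: eq_bigr => a _.
  have F0 : Im (coord F a) = 0 by exact: (hermitian_coordP F).1.
  rewrite ReD [X in _ + X](_ : _ = 0) ?addr0; last first.
    by case: (coord F a) F0 => f1 f2 /= ->; ring.
  by rewrite /cA; case: ifP => //= _; rewrite !mul0r.
have -> : \sum_(a <- box N) w a ^+ 2 = \sum_(a <- box N | U a) s ^- 2 * rcoord a A ^+ 2.
  rewrite [LHS](bigID U) /= [X in _ + X]big1 ?addr0.
    by apply: eq_bigr => a aU; rewrite /w aU exprMn exprVn.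
  by move=> a /negbTE aU; rewrite /w aU expr0n.
rewrite big_box_restrict// big_half /rsqr [in leRHS]big_half mulr_suml mulr_sumr -big_split.
apply: ler_sum => a aU; rewrite UJ aU /= s2.
move: (rcoord a A) (rcoord (J a) A) => u v.
have -> : (1 - eps - 2 / eps) / 2 * u ^+ 2 + (1 - eps / 2) / 2 * v ^+ 2
   + (eps / 2)^-1 * u ^+ 2 / 2 = (1 - eps) / 2 * u ^+ 2 + (1 - eps / 2) / 2 * v ^+ 2.
  by field; exact: lt0r_neq0.
rewrite mulrDr lerD2r ler_wpM2r ?sqr_ge0// ler_pM2r// lerD2l lerN2.
by rewrite ler_pdivrMr// mulr_natr mulr2n lerDl ltW.
Qed.

(** After integration over A the auxiliary variable has the quadratic coefficient s^-2 / (eps + 2 /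
    eps) from u and -1 from v; [q] is their sum. *)
Let q : R := - (eps ^+ 2 / 2) / (1 + eps ^+ 2 / 2).

Let h0 : 0 < 1 + eps ^+ 2 / 2.
Proof. by rewrite ltr_wpDr// divr_ge0// sqr_ge0. Qed.

Let q1 : q < 1.
Proof. by rewrite (@le_lt_trans _ _ 0)// /q mulNr oppr_le0 !divr_ge0 ?sqr_ge0// ltW. Qed.

Let qB a : R := if U a then q else 0.

Let lB a : R[i] := if U a then
    'i%C * coord F a * (s^-1 * (eps / 2) / (1 + eps ^+ 2 / 2))%:C - coord F (J a) * (s^-1)%:C
  else 0.

(** The terms free of B. Each 1 compensates for - (F,F) / 2, which is pulled out over the whole
    support of F and not only over the box of P_N. *)
Let kB a : R[i] := coord F a ^+ 2 * ((1 - (eps / 2) / (1 + eps ^+ 2 / 2)) / 2)%:C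
  + coord F (J a) ^+ 2 * ((1 - 2 / eps) / 2)%:C.

Let outer_exponent B : \sum_(a <- box M) zA B a ^+ 2 / (1 - cA a)%:C / 2
  = - (inner F F / 2) + \sum_(a <- box N | U a) kB a
    + \sum_(a <- box N) ((qB a / 2 * rcoord a B ^+ 2)%:C + lB a * (rcoord a B)%:C).
Proof.
have sn : s != 0 by rewrite gt_eqF.
have i2 : 'i%C * 'i%C = -1 :> R[i] by rewrite -expr2 sqr_i.
have -> : \sum_(a <- box M) zA B a ^+ 2 / (1 - cA a)%:C / 2
   = \sum_(a <- box M) - (coord F a ^+ 2 / 2) + \sum_(a <- box M)
     (if a \in box N then zA B a ^+ 2 / (1 - cA a)%:C / 2 + coord F a ^+ 2 / 2 else 0).
  rewrite -big_split; apply: eq_bigr => a _; rewrite /=; case: ifPn => aN; first by ring.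
  rewrite /zA /cA (negbTE aN) !addr0 subr0 divr1 exprMn sqr_i; ring.
rewrite big_box_restrict// -addrA; congr (_ + _).
  rewrite (inner_coord _ bF) sumrN mulr_suml; congr (- _).
have -> : \sum_(a <- box N) (zA B a ^+ 2 / (1 - cA a)%:C / 2 + coord F a ^+ 2 / 2)
  = \sum_(a <- box N) (('i%C * coord F a + if U a then (s^-1 * rcoord a B)%:C
       else 'i%C * (s * rcoord (J a) B)%:C) ^+ 2
      / (1 - if U a then 1 - eps - 2 / eps else 1 - eps / 2)%:C / 2 + coord F a ^+ 2 / 2).
  by apply: eq_big_seq => a aN; rewrite /zA /cA aN.
rewrite [LHS]big_half [X in _ = _ + X]big_half -big_split; apply: eq_bigr => a aU.
rewrite /qB /lB /kB UJ aU JK /= !mul0r !addr0.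
move: (coord F a) (coord F (J a)) (rcoord a B) => x y u.
rewrite /q !divc_half; move: (s) s0 s2 => r r0 r2.
(* Expressing eps through the root makes both sides rational in r. *)
have -> : eps = 2 * r ^+ 2 by rewrite r2 mulrC divfK.
have rn : r != 0 by rewrite gt_eqF.
have r4 : 0 <= r ^+ 4 by rewrite exprn_ge0// ltW.
have r2n : 1 - (1 - r ^+ 2) != 0 by rewrite (_ : _ - _ = r ^+ 2) ?expf_neq0//; ring.
have r4n : 1 + 2 * r ^+ 4 != 0 by rewrite gt_eqF// ltr_wpDr// mulr_ge0.
by case: x => x1 x2; case: y => y1 y2; apply: complex_eqP => /=; field; rewrite rn r4n r2n.
Qed.

(** For each pair, the matrix with eps on the diagonal and - i off it has determinant 1 + eps^2, and
    its inverse has eps / (1 + eps^2) on the diagonal and i / (1 + eps^2) off it; these give the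
    constant and the exponent on the right. *)
Lemma gaussian_oscillating :
  cintegrable mu (fun A => cexp ('i%C * pairing A F)
    * cexp (((1 - eps) / 2 * rsqr A)%:C + 'i%C * (rcross A / 2)%:C)) /\
  cintegral mu (fun A => cexp ('i%C * pairing A F)
    * cexp (((1 - eps) / 2 * rsqr A)%:C + 'i%C * (rcross A / 2)%:C))
  = ((Num.sqrt (1 + eps ^+ 2))^-1 ^+ count U (box N))%:C * (cexp (- (inner F F / 2))
    * cexp ((1 - eps / (1 + eps ^+ 2))%:C / 2 * csqr F
            - 'i%C * ((1 + eps ^+ 2)^-1 / 2)%:C * ccross F)).
Proof.
have quad B := gaussian_quad mrc chr (zA B) (box_uniq _ M) cA1.
have iG : mu.-integrable setT (EFin \o (fun A => expR ((1 - eps / 2) / 2 * rsqr A))).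
  by apply: integrable_exp_rsqr; rewrite gtrDl oppr_lt0 divr_gt0.
have [|] := cFubini mG G_bound iG.
  move=> B; under eq_fun do rewrite G_quad.
  by case: (quad B).
have -> : (fun A => cintegral mu (fun B => G (A, B))) = (fun A => cexp ('i%C * pairing A F) *
    cexp (((1 - eps) / 2 * rsqr A)%:C + 'i%C * (rcross A / 2)%:C)).
  by apply/funext => A; exact: inner_integral.
move=> i1 ->; split => //.
pose K := - (inner F F / 2) + \sum_(a <- box N | U a) kB a.
pose C1 := \prod_(a <- box M) ((Num.sqrt (1 - cA a))^-1)%:C : R[i].
have E B : cintegral mu (fun A => G (A, B)) = C1 * cexp K *
    cexp (\sum_(a <- box N) ((qB a / 2 * rcoord a B ^+ 2)%:C + lB a * (rcoord a B)%:C)).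
  under eq_fun do rewrite G_quad.
  by rewrite (quad B).2 big_split /= -cexp_sum outer_exponent cexpD mulrA.
under eq_fun do rewrite E.
have qB1 a : qB a < 1 by rewrite /qB; case: (U a).
have [i2 e2] := gaussian_quad mrc chr lB (box_uniq _ N) qB1.
rewrite cintegralZ// e2 big_split /= -cexp_sum mulrACA -!cexpD.
congr (_ * _); last congr cexp.
  transitivity (\prod_(a <- box N | U a) ((Num.sqrt (1 + eps ^+ 2))^-1)%:C : R[i]); last first.
    by rewrite -rmorph_prod big_const_seq iter_mulr_1.
  have -> : C1 = \prod_(a <- box M) (if a \in box N then
     ((Num.sqrt (1 - if U a then 1 - eps - 2 / eps else 1 - eps / 2))^-1)%:C else 1).
    by apply: eq_bigr => a _; rewrite /cA; case: ifP => // _; rewrite subr0 sqrtr1 invr1.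
  rewrite big_box_restrict// [X in X * _]big_half [X in _ * X]big_half -big_split.
  apply: eq_bigr => a aU; rewrite /= /qB UJ aU /= subr0 sqrtr1 invr1 mulr1 -!rmorphM.
  congr (_%:C).
  have e1 : 0 <= 1 - (1 - eps - 2 / eps) by rewrite ltW// subr_gt0; have := cA1E true.
  have e3 : 0 <= 1 - (1 - eps / 2) by rewrite ltW// subr_gt0; have := cA1E false.
  rewrite -!invfM -!sqrtrM ?mulr_ge0//; congr (Num.sqrt _)^-1.
  rewrite /q; field.
  by rewrite !gt_eqF// ltr_wpDr// sqr_ge0.
rewrite /K -addrA; congr (_ + _).
rewrite big_half /csqr /ccross [X in _ = _ / 2 * X - _]big_half [X in _ = _ - _ * X]big_half.
rewrite !mulr_sumr -big_split -sumrB; apply: eq_bigr => a aU.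
rewrite /kB /qB /lB UJ aU JK /= expr0n !mul0r addr0 /q !divc_half.
move: (coord F a) (coord F (J a)) (s) s0 s2 => x y r r0 r2.
have -> : eps = 2 * r ^+ 2 by rewrite r2 mulrC divfK.
have rn : r != 0 by rewrite gt_eqF.
have r4 : 0 <= r ^+ 4 by rewrite exprn_ge0// ltW.
rewrite -[X in X * (_ + _) - _]real_complex_half.
have r4n : 1 + 2 * r ^+ 4 != 0 by rewrite gt_eqF// ltr_wpDr// mulr_ge0.
have r4n' : 1 + (2 * r ^+ 2) ^+ 2 != 0 by rewrite gt_eqF// ltr_wpDr// sqr_ge0.
by case: x => x1 x2; case: y => y1 y2; apply: complex_eqP => /=; field; rewrite rn r4n r4n'.
Qed.

End oscillating_quadratic.

End quadratic_form.
(** * The parameters of the Feynman distributions *)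

Section square_root.
Variable R : realType.
Implicit Types e : R.

(** [al] and i [be] are the entries of the inverse matrix that appears in the T-transform of the
    regularized function. *)
Let al e : R := e / (1 + e ^+ 2).
Let be e : R := (1 + e ^+ 2)^-1.

Let den0 e : 0 < 1 + e ^+ 2.
Proof. by rewrite ltr_wpDr// sqr_ge0. Qed.

(** The modulus of 1 - al - i be; the wanted y - i x is the square root of that number with positive
    real part, so x^2 + y^2 equals [rho]. *)
Let rho e : R := Num.sqrt ((1 - al e) ^+ 2 + be e ^+ 2).

(* x = xroot e, y = yroot e solve y^2 - x^2 = 1 - e / (1 + e^2), 2 x y = 1 / (1 + e^2). *)
Definition yroot e : R := Num.sqrt (((1 - al e) + rho e) / 2).
Definition xroot e : R := be e / (2 * yroot e).

(** This keeps 1 - al positive for every real e, so [yroot] never vanishes and [xroot] may be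
    defined by division. *)
Let al_le e : `|al e| <= 2^-1.
Proof.
rewrite ler_norml /al ler_pdivlMr// ler_pdivrMr//.
by apply/andP; split; have := sqr_ge0 (e - 1); have := sqr_ge0 (e + 1); nra.
Qed.

Let rho0 e : 0 < (1 - al e) + rho e.
Proof.
have := al_le e; rewrite ler_norml => /andP[_ h].
by rewrite ltr_wpDr ?sqrtr_ge0//; lra.
Qed.

Let rho2 e : rho e ^+ 2 = (1 - al e) ^+ 2 + be e ^+ 2.
Proof. by rewrite sqr_sqrtr// addr_ge0// sqr_ge0. Qed.

Let yroot_gt0 e : 0 < yroot e.
Proof. by rewrite sqrtr_gt0 divr_gt0. Qed.

Let yroot2 e : yroot e ^+ 2 = ((1 - al e) + rho e) / 2.
Proof. by rewrite sqr_sqrtr// divr_ge0// ltW. Qed.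

Let xroot2 e : xroot e ^+ 2 = (rho e - (1 - al e)) / 2.
Proof.
rewrite /xroot expr_div_n exprMn yroot2.
have -> : be e ^+ 2 = (rho e - (1 - al e)) * ((1 - al e) + rho e).
  by rewrite -[LHS](addKr ((1 - al e) ^+ 2)) -rho2; ring.
by field; rewrite gt_eqF.
Qed.

Lemma xyroot e : xroot e * yroot e = (1 + e ^+ 2)^-1 / 2.
Proof. by rewrite /xroot /be; field; rewrite gt_eqF ?yroot_gt0//= gt_eqF. Qed.

Lemma yroot2_sub e : yroot e ^+ 2 - xroot e ^+ 2 = 1 - e / (1 + e ^+ 2).
Proof. by rewrite yroot2 xroot2 -/(al e); field. Qed.

Lemma xyroot_le e : xroot e ^+ 2 + yroot e ^+ 2 <= 2.
Proof.
rewrite yroot2 xroot2 [leLHS](_ : _ = rho e); last by field.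
rewrite -(ler_pXn2r (n := 2)) ?nnegrE ?sqrtr_ge0// rho2.
have b1 : be e <= 1 by rewrite invf_le1// lerDl sqr_ge0.
have b0 : 0 <= be e by rewrite invr_ge0 ltW.
have := al_le e; rewrite ler_norml => /andP[h1 h2]; nra.
Qed.

Let cbe : continuous be.
Proof.
move=> e; apply: cvgV; first by rewrite gt_eqF.
by apply: cvgD; [exact: cvg_cst|exact: exprn_continuous].
Qed.

Let cal : continuous al.
Proof. by move=> e; apply: cvgM; [exact: cvg_id|exact: cbe]. Qed.

Lemma continuous_yroot : continuous yroot.
Proof.
move=> e; apply: (continuous_cvg _ (@sqrt_continuous R _)).
have c1 : 1 - al e0 @[e0 --> e] --> 1 - al e.
  by apply: cvgB; [exact: cvg_cst|exact: cal].
apply: cvgM; last exact: cvg_cst.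
apply: cvgD => //.
apply: (continuous_cvg _ (@sqrt_continuous R _)); apply: cvgD.
  exact: (cvgM c1 c1).
exact: (cvgM (@cbe e) (@cbe e)).
Qed.

Lemma continuous_xroot : continuous xroot.
Proof.
move=> e; apply: cvgM; first exact: cbe.
apply: cvgV; first by rewrite gt_eqF// mulr_gt0.
by apply: cvgM; [exact: cvg_cst|exact: continuous_yroot].
Qed.

Definition normalization (c : R) n e : R := c * (Num.sqrt (1 + e ^+ 2))^-1 ^+ n.

Lemma normalization0 c n : normalization c n 0 = c.
Proof. by rewrite /normalization expr0n addr0 sqrtr1 invr1 expr1n mulr1. Qed.

(** The value at 0 is the largest, which provides the domination uniform in eps. *)
Lemma normalization_bounds c n e : 0 <= c -> 0 <= normalization c n e <= normalization c n 0.
Proof.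
move=> c0; have s1 : 1 <= Num.sqrt (1 + e ^+ 2).
  by rewrite -[leLHS]sqrtr1 ler_wsqrtr// lerDl sqr_ge0.
have s0 : 0 < Num.sqrt (1 + e ^+ 2) by rewrite (lt_le_trans ltr01).
rewrite normalization0 /normalization mulr_ge0 ?exprn_ge0 ?invr_ge0 ?(ltW s0)//=.
by rewrite ler_piMr// exprn_ile1 ?invr_ge0 ?(ltW s0)// invf_le1.
Qed.

Lemma continuous_kroot c n : continuous (normalization c n).
Proof.
move=> e; apply: cvgM; first exact: cvg_cst.
apply: (@continuous_comp _ _ _ (fun e => (Num.sqrt (1 + e ^+ 2))^-1) (fun x => x ^+ n)); last exact: exprn_continuous.
apply: cvgV; first by rewrite gt_eqF// sqrtr_gt0.
apply: (continuous_cvg _ (@sqrt_continuous R _)).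
by apply: cvgD; [exact: cvg_cst|exact: exprn_continuous].
Qed.

End square_root.

(** * The exchange of the two halves and the projections in coordinates *)

Section doubling.
Variables (R : realType) (d : nat).
Local Notation position := (position (d + d)).

Definition swap_half (k : 'I_(d + d)) : 'I_(d + d) :=
  match fintype.split k with inl l => rshift d l | inr l => lshift d l end.

Definition swap_pos (a : position) : position := (swap_half a.1.1, a.1.2, a.2).

Definition upper_pos : pred position := fun a => (a.1.1 < d)%N.

Lemma split_lshift_d (l : 'I_d) : fintype.split (lshift d l) = inl l.
Proof. exact: (unsplitK (inl l)). Qed.

Lemma split_rshift_d (l : 'I_d) : fintype.split (rshift d l) = inr l.
Proof. exact: (unsplitK (inr l)). Qed.

Definition split_d := (split_lshift_d, split_rshift_d).

Lemma swap_half_lshift l : swap_half (lshift d l) = rshift d l.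
Proof. by rewrite /swap_half split_d. Qed.

Lemma swap_half_rshift l : swap_half (rshift d l) = lshift d l.
Proof. by rewrite /swap_half split_d. Qed.

Lemma half_ind (P : 'I_(d + d) -> Prop) :
  (forall l, P (lshift d l)) -> (forall l, P (rshift d l)) -> forall k, P k.
Proof. by move=> Pl Pr k; rewrite -(splitK k); case: (fintype.split k). Qed.

Lemma swap_posK : involutive swap_pos.
Proof.
case=> [[k i] j]; rewrite /swap_pos /=; congr (_, _, _).
by elim/half_ind: k => l; rewrite !(swap_half_lshift, swap_half_rshift).
Qed.

Lemma swap_pos_box N a : (swap_pos a \in box N) = (a \in box N).
Proof. by rewrite !mem_box. Qed.

Lemma upper_swap_pos a : upper_pos (swap_pos a) = ~~ upper_pos a.
Proof.
case: a => [[k i] j]; rewrite /upper_pos /=.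
elim/half_ind: k => l; rewrite ?(swap_half_lshift, swap_half_rshift) /= ltn_ord.
  by rewrite ltnNge leq_addr.
by rewrite ltnNge leq_addr.
Qed.

Lemma projN_vcat N (X Y : cmatrices R d) :
  vcat (projN N X) (projN N Y) = projN N (vcat X Y).
Proof.
apply/funext => k; apply/funext => i; apply/funext => j.
by elim/half_ind: k => l; rewrite /projN /vcat split_d.
Qed.

Lemma vcat_upper_lower (X : cmatrices R (d + d)) : vcat (upper X) (lower X) = X.
Proof. by apply/funext => k; elim/half_ind: k => l; rewrite /vcat split_d. Qed.

Lemma coord_projN m N (X : cmatrices R m) a :
  coord (projN N X) a = if a \in box N then coord X a else 0.
Proof.
rewrite /coord.
have E b : entry (projN N X) b = if b \in box N then entry X b else 0.
  by case: b => [[k i] j]; rewrite mem_box.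
by rewrite !E transpose_box; case: (a \in box N); rewrite // !mulr0 addr0 mul0r.
Qed.

Lemma boxed_projN m N (X : cmatrices R m) : boxed N (projN N X).
Proof. by case=> [[k i] j]; rewrite mem_box /entry /projN /= => /negbTE ->. Qed.

Lemma coord_K_op eps (X : cmatrices R (d + d)) a :
  coord (K_op eps X) a = - ((1 - eps)%:C * coord X a + 'i%C * coord X (swap_pos a)).
Proof.
case: a => [[k i] j].
have E i' j' : entry (K_op eps X) (k, i', j')
    = - ((1 - eps)%:C * entry X (k, i', j') + 'i%C * entry X (swap_pos (k, i', j'))).
  rewrite /entry /K_op /swap_pos /=; congr (- (_ + _ * _)).
  by elim/half_ind: k => l; rewrite /vcat split_d ?(swap_half_lshift, swap_half_rshift).
by rewrite /coord !E /transpose /=; ring.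
Qed.

Lemma boxed_K_op eps N (X : cmatrices R (d + d)) : boxed N X -> boxed N (K_op eps X).
Proof.
move=> bX [[k i] j] aN; have h k' : X k' i j = 0.
  by apply: (bX (k', i, j)); move: aN; rewrite !mem_box.
rewrite /entry /K_op /=.
by elim/half_ind: k {aN} => l; rewrite /vcat split_d /lower /upper !h !mulr0 addr0 oppr0.
Qed.

(** The minus sign of K cancels that of the exponent: for eps < 1 the modulus grows like exp((1 -
    eps) rsqr / 2), just below the decay of the measure. *)
Lemma feynman_regularizedE N eps (A : dualM R (d + d)) : feynman_regularized N eps A
  = feynman_const R N d * cexp (((1 - eps) / 2 * rsqr N A)%:C
      + 'i%C * (rcross N swap_pos A / 2)%:C).
Proof.
rewrite /feynman_regularized projN_vcat vcat_upper_lower; congr (_ * cexp _).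
rewrite (inner_coord _ (boxed_K_op _ (@boxed_projN _ N A))).
rewrite /rsqr /rcross !mulr_suml mulr_sumr !real_complex_sum mulr_sumr -big_split -sumrN.
apply: eq_big_seq => a aN; rewrite coord_K_op !coord_projN swap_pos_box aN !coord_dualM.
rewrite -(rmorph_nat (real_complex R)) -fmorphV.
by apply: complex_eqP => /=; field.
Qed.

Lemma coord_vcat_lshift (X Y : cmatrices R d) l i j :
  coord (vcat X Y) (lshift d l, i, j) = coord X (l, i, j).
Proof. by rewrite /coord /entry /= /vcat split_d. Qed.

Lemma coord_vcat_rshift (X Y : cmatrices R d) l i j :
  coord (vcat X Y) (rshift d l, i, j) = coord Y (l, i, j).
Proof. by rewrite /coord /entry /= /vcat split_d. Qed.

(** Each pair of exchanged positions is counted once from either half, whence the factor 2. *)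
Lemma ccross_vcat N (X Y : cmatrices R d) :
  ccross N swap_pos (vcat X Y) = 2 * \sum_(k < d) mtrace (mprod (projN N X k) (projN N Y k)).
Proof.
have -> : \sum_(k < d) mtrace (mprod (projN N X k) (projN N Y k)) = inner (projN N Y) (projN N X).
  by [].
rewrite (inner_coord _ (@boxed_projN _ N X)) /ccross.
have -> : \sum_(a <- box N) coord (projN N Y) a * coord (projN N X) a
   = \sum_(a <- box N) coord Y a * coord X a.
  by apply: eq_big_seq => a aN; rewrite !coord_projN aN.
rewrite !big_box big_split_ord /= mulr_sumr -big_split; apply: eq_bigr => k _ /=.
rewrite -big_split mulr_sumr; apply: eq_bigr => i _ /=.
rewrite -big_split mulr_sumr; apply: eq_bigr => j _ /=.
rewrite /swap_pos /= swap_half_lshift swap_half_rshift coord_vcat_lshift coord_vcat_rshift.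
ring.
Qed.

Lemma inner_projNc m N M (X : cmatrices R m) : (N <= M)%N -> boxed M X ->
  inner (projNc N X) (projNc N X) = inner X X - csqr N X.
Proof.
move=> NM bX.
have cX a : coord (projNc N X) a = if a \in box N then 0 else coord X a.
  have -> : coord (projNc N X) a = coord X a - coord (projN N X) a.
    by rewrite /coord /entry /projNc; ring.
  by rewrite coord_projN; case: (a \in box N); rewrite ?subrr ?subr0.
have bc : boxed M (projNc N X).
  move=> a aM; have := coordK (projNc N X) a; rewrite entry_of_coord !cX => <-.
  by rewrite !(boxed_coord bX) ?transpose_box// !if_same !mulr0 addr0 mul0r.
rewrite (inner_coord _ bc) (inner_coord _ bX) /csqr -(big_box_restrict _ _ NM) -sumrB.
apply: eq_bigr => a _; rewrite cX; case: (a \in box N); last by rewrite subr0.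
by rewrite mul0r -expr2 subrr.
Qed.

Lemma projNc_vcat N (X Y : cmatrices R d) :
  vcat (projNc N X) (projNc N Y) = projNc N (vcat X Y).
Proof.
apply/funext => k; apply/funext => i; apply/funext => j.
by elim/half_ind: k => l; rewrite /projNc /projN /vcat split_d.
Qed.

Lemma boxed_vcat M (X Y : cmatrices R d) : boxed M X -> boxed M Y -> boxed M (vcat X Y).
Proof.
move=> bX bY [[k i] j]; rewrite mem_box /entry /= => h.
elim/half_ind: k => l; rewrite /vcat split_d.
  by apply: (bX (l, i, j)); rewrite mem_box.
by apply: (bY (l, i, j)); rewrite mem_box.
Qed.

End doubling.

Theorem corollary3p7 (R : realType) (N d : nat)
    (mu : probability (dualM R (d + d)) R) (gaussian_mu : standard_gaussian mu) :
  exists (Phi_ : R -> hida_distribution mu) (Phi : hida_distribution mu),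
    [/\ forall eps : R, 0 < eps ->
          represents_L1 (Phi_ eps) (feynman_regularized N eps),
        strong_cvg_at0 Phi_ Phi &
        forall F G : cmatrices R d, spaceM F -> spaceM G ->
          T_transform Phi (vcat F G) =
          feynman_const R N d
          * cexp (- 'i%C * \sum_(k < d) mtrace (mprod (projN N F k) (projN N G k)))
          * cexp (- (inner (vcat (projNc N F) (projNc N G))
                           (vcat (projNc N F) (projNc N G)) / 2))].
Proof.
pose c : R := 2 ^+ (d * N) * pi ^+ (d * N ^ 2).
have c0 : 0 <= c by rewrite mulr_ge0// exprn_ge0// pi_ge0.
(* The number of pairs of exchanged coordinates; each contributes a factor (1 + eps^2)^(-1/2), which
   is 1 at eps = 0. *)
pose n := count (@upper_pos d) (@box (d + d) N).
pose Phi_ eps := hida_gauss_mean (@swap_posK d) (@swap_pos_box d N) gaussian_mu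
  (normalization c n eps) (xyroot_le eps).
exists Phi_, (Phi_ 0); split.
- move=> eps eps0.
  have osc M F NM bF hF := @gaussian_oscillating R (d + d) N _ (@swap_posK d)
    (@swap_pos_box d N) mu gaussian_mu _ (@upper_swap_pos d) eps M F eps0 NM bF hF.
  have bounded0 : boxed N ((fun _ _ _ => 0) : cmatrices R (d + d)) by [].
  split.
    (* Integrability of the regularized function itself is the case F = 0. *)
    have [+ _] := osc N _ (leqnn N) bounded0 (@zero_hermitian _ _).
    move=> /(cintegrableZ c%:C); congr cintegrable; apply/funext => A.
    rewrite feynman_regularizedE (pairing_rcoord _ bounded0) big1 ?mulr0 ?cexp0 ?mul1r// => a _.
    by rewrite /coord /entry !mulr0 addr0 !mul0r.
  move=> F sF; have [M bF] := spaceM_boxed sF; have [hF _] := sF.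
  have bF' : boxed (M + N) F by apply: boxed_sub bF; exact: leq_addr.
  have [i e] := osc (M + N)%N F (leq_addl _ _) bF' hF.
  rewrite /T_transform /= (gauss_mean_cexp (@swap_posK d) (@swap_pos_box d N) gaussian_mu _ _ _ bF).
  under [in RHS]eq_fun do rewrite feynman_regularizedE mulrCA.
  rewrite cintegralZ// e yroot2_sub xyroot /normalization rmorphM.
  by rewrite /feynman_const -/c !mulrA.
- refine (@gauss_mean_strong_cvg _ _ N _ (@swap_posK d) (@swap_pos_box d N) mu gaussian_mu
    (normalization c n) (@xroot R) (@yroot R) (@xyroot_le R) _ _ _ _).
  + by move=> e; exact: normalization_bounds.
  + exact: continuous_kroot.
  + exact: continuous_xroot.
  + exact: continuous_yroot.
- move=> F G sF sG.
  have [M1 bF] := spaceM_boxed sF; have [M2 bG] := spaceM_boxed sG.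
  pose M := (M1 + M2 + N)%N.
  have bV : boxed M (vcat F G).
    apply: boxed_vcat; [apply: boxed_sub bF|apply: boxed_sub bG]; rewrite /M; lia.
  rewrite /T_transform /= (gauss_mean_cexp (@swap_posK d) (@swap_pos_box d N) gaussian_mu _ _ _ bV).
  (* At eps = 0, y^2 - x^2 = 1 removes the P_N part from the Gaussian factor, and 2 x y = 1 gives
     the phase, as [ccross] is twice the sum of traces. *)
  rewrite projNc_vcat (inner_projNc _ bV) ?leq_addl// normalization0 yroot2_sub xyroot ccross_vcat.
  rewrite expr0n mul0r subr0 addr0 invr1 -[RHS]mulrA /feynman_const -/c; congr (_ * _).
  rewrite -!cexpD; congr cexp.
  by rewrite real_complex_half; field.
Qed.
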